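(* Let $f\in{\cal N}_1$ have divisor $D$. There is $C<\infty$ such that for every simply connected bounded domain $E\subset\mathbb{C}$ with $m_1(\partial E)<\infty$ and every holomorphic function $g$ on $E$, $$\Big|\int_Eg(w)\,d\mu_D(w)\Big|\le C\sup_E|g|\,(m_1(\partial E)+1);$$ in particular $|\mu_D(E)|\le C(m_1(\partial E)+1)$. Moreover, for each $k\in\mathbb{Z}$ there is $C_k<\infty$ such that for all $1<r<R<\infty$, $$\Big|\int_{r<|w|\le R}w^k\,d\mu_D(w)\Big|<C_k(r^{k+1}+R^{k+1}).$$ These constants are unchanged if $D$ is replaced by any translate $((a_n-c),(b_n-c))$, $c\in\mathbb{C}$.
   Context: $\rho_S$ is the spherical metric. A meromorphic $f$ on $\mathbb{C}$ is normal if every sequence of translates $f(z+h_n)$ has a subsequence Cauchy in $\rho_S$ uniformly on compacta; $f\in{\cal N}_1$ if moreover no limit of translates is a constant function (including $\infty$). The divisor $D=((a_n),(b_n))$ lists zeros $a_n$ and poles $b_n$ with multiplicity; $\mu_D=\sum_n\delta_{a_n}-\sum_n\delta_{b_n}$ is the associated signed discrete measure. $m_1$ denotes one-dimensional Hausdorff measure (length). *)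

(* Defs.v *)
From Stdlib Require Import Reals Lra ZArith List.
Open Scope R_scope.

Definition Cx : Type := (R * R)%type.
Definition C0 : Cx := (0, 0).
Definition C1 : Cx := (1, 0).
Definition Cadd (z w : Cx) : Cx := (fst z + fst w, snd z + snd w).
Definition Copp (z : Cx) : Cx := (- fst z, - snd z).
Definition Csub (z w : Cx) : Cx := Cadd z (Copp w).
Definition Cmul (z w : Cx) : Cx :=
  (fst z * fst w - snd z * snd w, fst z * snd w + snd z * fst w).
Definition Cnorm (z : Cx) : R := sqrt (fst z * fst z + snd z * snd z).
Definition Cinv (z : Cx) : Cx :=
  let d := fst z * fst z + snd z * snd z in (fst z / d, - snd z / d).
Definition Cdiv (z w : Cx) : Cx := Cmul z (Cinv w).
Fixpoint Cpow (z : Cx) (n : nat) : Cx :=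
  match n with O => C1 | S m => Cmul z (Cpow z m) end.
Definition Cpowz (z : Cx) (k : Z) : Cx :=
  if (0 <=? k)%Z then Cpow z (Z.to_nat k) else Cinv (Cpow z (Z.to_nat (- k))).
Definition CofZ (n : Z) : Cx := (IZR n, 0).

Definition open_set (U : Cx -> Prop) : Prop :=
  forall z, U z -> exists r, 0 < r /\ forall w, Cnorm (Csub w z) < r -> U w.

Definition C_differentiable_at (U : Cx -> Prop) (g : Cx -> Cx) (z : Cx) : Prop :=
  exists l : Cx, forall eps, 0 < eps -> exists delta, 0 < delta /\
    forall h, 0 < Cnorm h < delta -> U (Cadd z h) ->
      Cnorm (Csub (Csub (g (Cadd z h)) (g z)) (Cmul l h)) <= eps * Cnorm h.

Definition holomorphic_on (U : Cx -> Prop) (g : Cx -> Cx) : Prop :=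
  open_set U /\ forall z, U z -> C_differentiable_at U g z.

Definition disc (a : Cx) (r : R) : Cx -> Prop := fun z => Cnorm (Csub z a) < r.

(* ---------- meromorphic functions C -> Riemann sphere (None = infinity) ---------- *)
Definition meromorphic (f : Cx -> option Cx) : Prop :=
  (forall z, exists r, 0 < r /\
     forall w, 0 < Cnorm (Csub w z) < r -> f w <> None) /\
  (forall z, f z <> None -> exists r g, 0 < r /\ holomorphic_on (disc z r) g /\
     forall w, disc z r w -> f w = Some (g w)) /\
  (forall p, f p = None -> exists r h, 0 < r /\ holomorphic_on (disc p r) h /\
     h p = C0 /\ forall w, disc p r w -> w <> p -> exists v, f w = Some v /\ Cmul v (h w) = C1).

Definition rhoS (u v : option Cx) : R :=
  match u, v with
  | Some z, Some w => 2 * Cnorm (Csub z w) /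
       sqrt ((1 + Cnorm z ^ 2) * (1 + Cnorm w ^ 2))
  | Some z, None | None, Some z => 2 / sqrt (1 + Cnorm z ^ 2)
  | None, None => 0
  end.

(* uniformly Cauchy in rhoS on compacta (every compact set lies in a closed disc) *)
Definition unif_cauchy_compacta (F : nat -> Cx -> option Cx) : Prop :=
  forall Rr eps, 0 < Rr -> 0 < eps -> exists N, forall m n, (N <= m)%nat -> (N <= n)%nat ->
    forall z, Cnorm z <= Rr -> rhoS (F m z) (F n z) < eps.

Definition unif_conv_compacta (F : nat -> Cx -> option Cx) (G : Cx -> option Cx) : Prop :=
  forall Rr eps, 0 < Rr -> 0 < eps -> exists N, forall n, (N <= n)%nat ->
    forall z, Cnorm z <= Rr -> rhoS (F n z) (G z) < eps.

Definition translates (f : Cx -> option Cx) (h : nat -> Cx) : nat -> Cx -> option Cx :=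
  fun n z => f (Cadd z (h n)).

Definition normal_fn (f : Cx -> option Cx) : Prop :=
  meromorphic f /\
  forall h : nat -> Cx, exists phi : nat -> nat,
    (forall n, (phi n < phi (S n))%nat) /\
    unif_cauchy_compacta (fun n => translates f h (phi n)).

Definition N1 (f : Cx -> option Cx) : Prop :=
  normal_fn f /\
  forall (h : nat -> Cx) (G : Cx -> option Cx),
    unif_conv_compacta (translates f h) G -> ~ (exists v, forall z, G z = v).

Definition order_at (f : Cx -> option Cx) (a : Cx) (n : Z) : Prop :=
  ((0 < n)%Z /\ exists r h, 0 < r /\ holomorphic_on (disc a r) h /\ h a <> C0 /\
      forall z, disc a r z -> f z = Some (Cmul (Cpow (Csub z a) (Z.to_nat n)) (h z)))
  \/ ((n < 0)%Z /\ exists r h, 0 < r /\ holomorphic_on (disc a r) h /\ h a <> C0 /\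
      forall z, disc a r z -> z <> a ->
        f z = Some (Cdiv (h z) (Cpow (Csub z a) (Z.to_nat (- n)))))
  \/ (n = 0%Z /\ f a <> Some C0 /\ f a <> None).

Definition is_divisor (f : Cx -> option Cx) (nu : Cx -> Z) : Prop :=
  forall z, order_at f z (nu z).

(* integral of g against mu_D over the set A, given a duplicate-free list L
   enumerating exactly the points of A in the support of D *)
Definition enumerates_support (nu : Cx -> Z) (A : Cx -> Prop) (L : list Cx) : Prop :=
  NoDup L /\ forall z, In z L <-> (A z /\ nu z <> 0%Z).

Definition div_integral (nu : Cx -> Z) (g : Cx -> Cx) (L : list Cx) : Cx :=
  fold_right (fun z acc => Cadd (Cmul (CofZ (nu z)) (g z)) acc) C0 L.

Definition div_mass (nu : Cx -> Z) (L : list Cx) : Z :=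
  fold_right (fun z acc => (nu z + acc)%Z) 0%Z L.

Definition cont_path (gam : R -> Cx) : Prop :=
  forall t, 0 <= t <= 1 -> forall eps, 0 < eps -> exists delta, 0 < delta /\
    forall s, 0 <= s <= 1 -> Rabs (s - t) < delta -> Cnorm (Csub (gam s) (gam t)) < eps.

Definition cont_homotopy (H : R -> R -> Cx) : Prop :=
  forall s t, 0 <= s <= 1 -> 0 <= t <= 1 -> forall eps, 0 < eps -> exists delta, 0 < delta /\
    forall s' t', 0 <= s' <= 1 -> 0 <= t' <= 1 -> Rabs (s' - s) < delta -> Rabs (t' - t) < delta ->
      Cnorm (Csub (H s' t') (H s t)) < eps.

Definition path_connected (E : Cx -> Prop) : Prop :=
  forall z w, E z -> E w -> exists gam, cont_path gam /\ gam 0 = z /\ gam 1 = w /\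
    forall t, 0 <= t <= 1 -> E (gam t).

Definition simply_connected (E : Cx -> Prop) : Prop :=
  forall gam, cont_path gam -> gam 0 = gam 1 -> (forall t, 0 <= t <= 1 -> E (gam t)) ->
  exists H, cont_homotopy H /\
    (forall t, 0 <= t <= 1 -> H 0 t = gam t) /\
    (forall s, 0 <= s <= 1 -> H s 0 = H s 1) /\
    (forall t, 0 <= t <= 1 -> H 1 t = H 1 0) /\
    (forall s t, 0 <= s <= 1 -> 0 <= t <= 1 -> E (H s t)).

Definition bounded_set (E : Cx -> Prop) : Prop :=
  exists M, forall z, E z -> Cnorm z <= M.

Definition simply_connected_bounded_domain (E : Cx -> Prop) : Prop :=
  open_set E /\ (exists z, E z) /\ path_connected E /\ simply_connected E /\ bounded_set E.

Definition boundary (E : Cx -> Prop) : Cx -> Prop :=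
  fun z => ~ E z /\ forall r, 0 < r -> exists w, E w /\ Cnorm (Csub w z) < r.

(* hausdorff1_le A M  <->  m_1(A) <= M, where
   m_1(A) = lim_{delta->0} inf { sum_i diam U_i : A subset U_i U_i, diam U_i <= delta } *)
Definition hausdorff1_le (A : Cx -> Prop) (M : R) : Prop :=
  forall delta eps, 0 < delta -> 0 < eps ->
  exists (U : nat -> Cx -> Prop) (d : nat -> R),
    (forall i, 0 <= d i <= delta) /\
    (forall i z w, U i z -> U i w -> Cnorm (Csub z w) <= d i) /\
    (forall z, A z -> exists i, U i z) /\
    (forall n, sum_f_R0 d n <= M + eps).

(* Main.v *)
(* On a contour that keeps a fixed distance from the divisor, [f'/f] is bounded uniformly over all translates
   of [f], so the residue theorem bounds the integral of [g] against the divisor by [sup |g|] times the length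
   of the contour, up to the boundedly many points left out per unit of boundary.  The bound for [f'/f] and
   the bound on the number of divisor points in a disc both come from one principle: a bounded holomorphic
   function that is tiny at many separated points of a square is small on a larger square, so that translates
   of [f] with a tiny value far from all zeros would tend to the constant 0, which [N1] excludes; poles are
   handled by passing to [1/f].  The contour is the boundary of a union of grid cells, namely the cells deep
   inside the domain together with the clusters of cells near the divisor attached to them.  For a simply
   connected domain the number of cells near the boundary is controlled by its length, because by a winding
   number argument the boundary meets every small circle around each of its points (unless the whole domain
   is small). *)

Require Import Defs.
From Stdlib Require Import Reals Lra Lia ZArith List FinFun Psatz Classical ClassicalEpsilon.
From Coquelicot Require Import Coquelicot.
Open Scope R_scope.

(** * Complex differentiability *)

(** Normality is used without limit functions: it enters only as equicontinuity at one fixed scale,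
    which makes [f] or [1/f] holomorphic and bounded by 2 on a disc of fixed radius around every
    point. The only limits of translates that ever occur are the constants 0 and infinity. Complex
    analysis is done on squares, since the final contour consists of grid edges. The price is a loss
    of fixed factors (16 where the maximum principle has 1), so the interpolation argument must gain
    a geometric factor per point. Contours are never traced: the integral around a union of cells is
    a sum over all grid edges of differences of an indicator function, so neither orientations nor
    Jordan curves occur. Once [f'/f] is bounded, [f] disappears. What remains are the numbers [rho],
    [N], [e], [B] in translation-invariant conditions, and this makes the constants uniform in the
    translation. An annulus is not simply connected; its boundary cells are counted directly along
    the two circles. *)

Definition opn (U : C -> Prop) : Prop :=
  forall z, U z -> exists r, 0 < r /\ forall w, Cmod (w - z) < r -> U w.

Definition Ccont (f : C -> C) (z : C) : Prop :=
  forall eps, 0 < eps -> exists d, 0 < d /\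
    forall w, Cmod (w - z) < d -> Cmod (f w - f z) < eps.

(** Caratheodory's form of the derivative: the rules for sums, products and quotients become
    algebraic identities between the functions [q], leaving only continuity at [z] to check. *)
Definition cder (f : C -> C) (z l : C) : Prop :=
  exists q, Ccont q z /\ q z = l /\ forall w, f w = (f z + (w - z) * q w)%C.

Definition hol (U : C -> Prop) (f : C -> C) : Prop :=
  forall z, U z -> exists l, cder f z l.

Lemma Cmod_minus_sym (z w : C) : Cmod (z - w) = Cmod (w - z).
Proof. rewrite <- Cmod_opp. f_equal. ring. Qed.

Lemma Cmod_tri (u v w : C) : Cmod (u - w) <= Cmod (u - v) + Cmod (v - w).
Proof. replace (u - w)%C with ((u - v) + (v - w))%C by ring. apply Cmod_triangle. Qed.

Lemma Cmod_refl (z : C) : Cmod (z - z) = 0.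
Proof. replace (z - z)%C with (RtoC 0) by ring. apply Cmod_0. Qed.

Lemma Cmod_diff_le (z w : C) : Cmod z <= Cmod w + Cmod (z - w).
Proof. replace z with (w + (z - w))%C at 1 by ring. apply Cmod_triangle. Qed.

Lemma re_le_Cmod (z : C) : Rabs (fst z) <= Cmod z.
Proof. eapply Rle_trans; [apply Rmax_l|apply Rmax_Cmod]. Qed.

Lemma im_le_Cmod (z : C) : Rabs (snd z) <= Cmod z.
Proof. eapply Rle_trans; [apply Rmax_r|apply Rmax_Cmod]. Qed.

Lemma Cmod_le_re_im (z : C) : Cmod z <= Rabs (fst z) + Rabs (snd z).
Proof.
  destruct z as [x y]; simpl.
  replace (x, y) with (RtoC x + Ci * RtoC y)%C by
    (unfold Ci, RtoC, Cplus, Cmult; simpl; f_equal; ring).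
  eapply Rle_trans; [apply Cmod_triangle|].
  rewrite Cmod_mult, Cmod_Ci, !Cmod_R; lra.
Qed.

Lemma Ccont_ext f g z r : 0 < r -> (forall w, Cmod (w - z) < r -> f w = g w) ->
  Ccont f z -> Ccont g z.
Proof.
  intros Hr E H eps He. destruct (H eps He) as [d [Hd H1]].
  exists (Rmin d r); split; [apply Rmin_pos; auto|].
  intros w Hw. rewrite <- (E w), <- (E z).
  - apply H1. eapply Rlt_le_trans; [apply Hw|apply Rmin_l].
  - rewrite Cmod_refl; auto.
  - eapply Rlt_le_trans; [apply Hw|apply Rmin_r].
Qed.

Lemma Ccont_const c z : Ccont (fun _ => c) z.
Proof. intros e He; exists 1; split; [lra|]; intros; rewrite Cmod_refl; auto. Qed.

Lemma Ccont_id z : Ccont (fun w => w) z.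
Proof. intros e He; exists e; split; auto. Qed.

Lemma Ccont_plus f g z : Ccont f z -> Ccont g z -> Ccont (fun w => f w + g w)%C z.
Proof.
  intros Hf Hg e He. destruct (Hf (e/2)) as [d1 [Hd1 H1]]; [lra|].
  destruct (Hg (e/2)) as [d2 [Hd2 H2]]; [lra|].
  exists (Rmin d1 d2); split; [apply Rmin_pos; auto|]; intros w Hw.
  replace (f w + g w - (f z + g z))%C with ((f w - f z) + (g w - g z))%C by ring.
  eapply Rle_lt_trans; [apply Cmod_triangle|].
  assert (Cmod (f w - f z) < e/2) by (apply H1; eapply Rlt_le_trans; [apply Hw|apply Rmin_l]).
  assert (Cmod (g w - g z) < e/2) by (apply H2; eapply Rlt_le_trans; [apply Hw|apply Rmin_r]).
  lra.
Qed.

Lemma Ccont_mult f g z : Ccont f z -> Ccont g z -> Ccont (fun w => f w * g w)%C z.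
Proof.
  intros Hf Hg e He.
  set (a := Cmod (f z)). set (b := Cmod (g z)).
  assert (Ha : 0 <= a) by apply Cmod_ge_0. assert (Hb : 0 <= b) by apply Cmod_ge_0.
  destruct (Hf (e / (2 * (b + 1)))) as [d1 [Hd1 H1]].
  { apply Rdiv_lt_0_compat; lra. }
  set (k := Rmin 1 (e / (2 * (a + 1)))).
  assert (Hk : 0 < k) by (apply Rmin_pos; [lra|apply Rdiv_lt_0_compat; lra]).
  destruct (Hg k Hk) as [d2 [Hd2 H2]].
  exists (Rmin d1 d2); split; [apply Rmin_pos; auto|]; intros w Hw.
  replace (f w * g w - f z * g z)%C with ((f w - f z) * g w + f z * (g w - g z))%C by ring.
  eapply Rle_lt_trans; [apply Cmod_triangle|]. rewrite !Cmod_mult.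
  assert (A1 : Cmod (f w - f z) < e / (2 * (b + 1)))
    by (apply H1; eapply Rlt_le_trans; [apply Hw|apply Rmin_l]).
  assert (A2 : Cmod (g w - g z) < k)
    by (apply H2; eapply Rlt_le_trans; [apply Hw|apply Rmin_r]).
  assert (K1 : k <= 1) by apply Rmin_l.
  assert (K2 : k <= e / (2 * (a + 1))) by apply Rmin_r.
  assert (Hgw : Cmod (g w) <= b + 1).
  { pose proof (Cmod_diff_le (g w) (g z)) as T. fold b in T. lra. }
  assert (B1 : Cmod (f w - f z) * Cmod (g w) <= Cmod (f w - f z) * (b+1)).
  { apply Rmult_le_compat_l; [apply Cmod_ge_0|auto]. }
  assert (B2 : Cmod (f w - f z) * (b+1) < e / (2 * (b + 1)) * (b + 1)).
  { apply Rmult_lt_compat_r; lra. }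
  assert (B3 : e / (2 * (b + 1)) * (b + 1) = e / 2) by (field; lra).
  assert (B4 : Cmod (f z) * Cmod (g w - g z) <= a * (e / (2 * (a + 1)))).
  { apply Rmult_le_compat; [apply Cmod_ge_0|apply Cmod_ge_0|apply Rle_refl|lra]. }
  assert (B5 : a * (e / (2 * (a + 1))) <= e / 2).
  { replace (a * (e / (2 * (a + 1)))) with (e / 2 * (a / (a + 1))) by (field; lra).
    rewrite <- (Rmult_1_r (e/2)) at 2. apply Rmult_le_compat_l; [lra|].
    apply Rmult_le_reg_r with (a + 1); [lra|]. unfold Rdiv. rewrite Rmult_assoc, Rinv_l; lra. }
  lra.
Qed.

Lemma Ccont_opp f z : Ccont f z -> Ccont (fun w => - f w)%C z.
Proof.
  intros H e He; destruct (H e He) as [d [Hd H1]]; exists d; split; auto; intros w Hw.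
  replace (- f w - - f z)%C with (- (f w - f z))%C by ring. rewrite Cmod_opp; auto.
Qed.

Lemma Ccont_minus f g z : Ccont f z -> Ccont g z -> Ccont (fun w => f w - g w)%C z.
Proof. intros; apply Ccont_plus; auto; apply Ccont_opp; auto. Qed.

Lemma Ccont_nz f z : Ccont f z -> f z <> 0 -> exists d, 0 < d /\
  forall w, Cmod (w - z) < d -> Cmod (f z) / 2 < Cmod (f w).
Proof.
  intros H Hz. assert (0 < Cmod (f z)) by (apply Cmod_gt_0; auto).
  destruct (H (Cmod (f z) / 2)) as [d [Hd H1]]; [lra|].
  exists d; split; auto; intros w Hw. specialize (H1 w Hw).
  pose proof (Cmod_diff_le (f z) (f w)) as T. rewrite Cmod_minus_sym in T. lra.
Qed.

Lemma Cinv_diff (u v : C) : u <> 0 -> v <> 0 -> (/ u - / v)%C = (- (u - v) * / (u * v))%C.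
Proof. intros; field; auto. Qed.

Lemma Ccont_inv f z : Ccont f z -> f z <> 0 -> Ccont (fun w => / f w)%C z.
Proof.
  intros H Hz e He. set (m := Cmod (f z)).
  assert (Hm : 0 < m) by (apply Cmod_gt_0; auto).
  destruct (Ccont_nz f z H Hz) as [d1 [Hd1 H1]].
  destruct (H (e * (m * (m / 2)))) as [d2 [Hd2 H2]].
  { repeat apply Rmult_lt_0_compat; lra. }
  exists (Rmin d1 d2); split; [apply Rmin_pos; auto|]; intros w Hw.
  assert (A1 : m / 2 < Cmod (f w))
    by (apply H1; eapply Rlt_le_trans; [apply Hw|apply Rmin_l]).
  assert (A2 : Cmod (f w - f z) < e * (m * (m/2)))
    by (apply H2; eapply Rlt_le_trans; [apply Hw|apply Rmin_r]).
  assert (f w <> 0) by (apply Cmod_gt_0; lra).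
  rewrite Cinv_diff; auto.
  rewrite Cmod_mult, Cmod_opp, Cmod_inv by (apply Cmult_neq_0; auto).
  rewrite Cmod_mult. fold m.
  assert (0 < m * (m/2)) by (apply Rmult_lt_0_compat; lra).
  assert (m * (m/2) <= Cmod (f w) * m) by (rewrite Rmult_comm; apply Rmult_le_compat_r; lra).
  apply Rmult_lt_reg_r with (Cmod (f w) * m); [lra|].
  rewrite Rmult_assoc, Rinv_l by lra.
  assert (e * (m * (m/2)) <= e * (Cmod (f w) * m)) by (apply Rmult_le_compat_l; lra). lra.
Qed.

Lemma Ccont_div f g z : Ccont f z -> Ccont g z -> g z <> 0 -> Ccont (fun w => f w / g w)%C z.
Proof. intros; unfold Cdiv; apply Ccont_mult; auto; apply Ccont_inv; auto. Qed.

Lemma Ccont_pow f z n : Ccont f z -> Ccont (fun w => (f w ^ n)%C) z.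
Proof.
  intros H; induction n; [exact (Ccont_const 1 z)|].
  apply Ccont_ext with (f := fun w => (f w * f w ^ n)%C) (r := 1); [lra| |].
  intros; rewrite Cpow_S; auto. apply Ccont_mult; auto.
Qed.

Lemma cder_cont f z l : cder f z l -> Ccont f z.
Proof.
  intros [q [Hq [Hl Hf]]].
  apply Ccont_ext with (f := fun w => (f z + (w - z) * q w)%C) (r := 1); [lra|intros; rewrite <- Hf; auto|].
  apply Ccont_plus; [apply Ccont_const|]. apply Ccont_mult; auto.
  apply Ccont_minus; [apply Ccont_id|apply Ccont_const].
Qed.

(* The difference quotient is pinned down off [z], so it suffices to produce it near [z]. *)
Lemma cder_local f z l r q : 0 < r -> Ccont q z -> q z = l ->
  (forall w, Cmod (w - z) < r -> f w = (f z + (w - z) * q w)%C) -> cder f z l.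
Proof.
  intros Hr Hq Hl Hf.
  exists (fun w => if excluded_middle_informative (w = z) then l else ((f w - f z) / (w - z))%C).
  split; [|split].
  - apply Ccont_ext with (f := q) (r := r); auto.
    intros w Hw. destruct excluded_middle_informative as [->|N]; auto.
    rewrite (Hf w Hw). field. intro E; apply N. apply Ceq_minus; auto.
  - destruct excluded_middle_informative; tauto.
  - intros w. destruct excluded_middle_informative as [->|N]; [ring|].
    field. intro E; apply N. apply Ceq_minus; auto.
Qed.

Lemma cder_ext f g z l r : 0 < r -> (forall w, Cmod (w - z) < r -> f w = g w) ->
  cder f z l -> cder g z l.
Proof.
  intros Hr E [q [Hq [Hl Hf]]]. apply cder_local with (r := r) (q := q); auto.
  intros w Hw. rewrite <- (E w Hw), <- (E z), Hf; auto. rewrite Cmod_refl; auto.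
Qed.

Lemma cder_const c z : cder (fun _ => c) z 0.
Proof. exists (fun _ => RtoC 0); split; [apply Ccont_const|split; auto]. intros; ring. Qed.

Lemma cder_id z : cder (fun w => w) z 1.
Proof. exists (fun _ => RtoC 1); split; [apply Ccont_const|split; auto]. intros; ring. Qed.

Lemma cder_plus f g z l m : cder f z l -> cder g z m -> cder (fun w => f w + g w)%C z (l + m)%C.
Proof.
  intros [q [Hq [<- Hf]]] [p [Hp [<- Hg]]]. exists (fun w => q w + p w)%C.
  split; [apply Ccont_plus; auto|split; auto]. intros w; rewrite (Hf w), (Hg w); ring.
Qed.

Lemma cder_mult f g z l m : cder f z l -> cder g z m ->
  cder (fun w => f w * g w)%C z (l * g z + f z * m)%C.
Proof.
  intros Df Dg. pose proof (cder_cont _ _ _ Dg) as Cg.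
  destruct Df as [q [Hq [<- Hf]]], Dg as [p [Hp [<- Hg]]].
  exists (fun w => q w * g w + f z * p w)%C.
  split; [|split; auto].
  - apply Ccont_plus; apply Ccont_mult; auto. apply Ccont_const.
  - intros w; rewrite (Hf w), (Hg w); ring.
Qed.

Lemma cder_opp f z l : cder f z l -> cder (fun w => - f w)%C z (- l)%C.
Proof.
  intros [q [Hq [<- Hf]]]. exists (fun w => - q w)%C.
  split; [apply Ccont_opp; auto|split; auto]. intros w; rewrite (Hf w); ring.
Qed.

Lemma cder_minus f g z l m : cder f z l -> cder g z m -> cder (fun w => f w - g w)%C z (l - m)%C.
Proof. intros; apply cder_plus; auto; apply cder_opp; auto. Qed.

Lemma cder_inv f z l : cder f z l -> f z <> 0 -> cder (fun w => / f w)%C z (- l / (f z * f z))%C.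
Proof.
  intros Df Hz. pose proof (cder_cont _ _ _ Df) as Cf.
  destruct (Ccont_nz f z Cf Hz) as [d [Hd H1]].
  destruct Df as [q [Hq [<- Hf]]].
  apply cder_local with (r := d) (q := fun w => (- q w / (f w * f z))%C); auto.
  - apply Ccont_div; [apply Ccont_opp; auto| |apply Cmult_neq_0; auto].
    apply Ccont_mult; [auto|apply Ccont_const].
  - intros w Hw. assert (f w <> 0).
    { apply Cmod_gt_0. specialize (H1 w Hw). pose proof (Cmod_ge_0 (f z)); lra. }
    assert (E : (f w - f z)%C = ((w - z) * q w)%C) by (rewrite (Hf w); ring).
    replace (/ f w)%C with (/ f z + (/ f w - / f z))%C by ring.
    rewrite Cinv_diff; auto. rewrite E. field; auto.
Qed.

Lemma cder_div f g z l m : cder f z l -> cder g z m -> g z <> 0 ->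
  cder (fun w => f w / g w)%C z (l * / g z + f z * (- m / (g z * g z)))%C.
Proof. intros Hf Hg N. exact (cder_mult _ _ _ _ _ Hf (cder_inv _ _ _ Hg N)). Qed.

(** Serves twice: for the uniqueness of the derivative, and to see that a meromorphic function has
    no finite value at a point of negative order. *)
Lemma Ccont_eq_off f g z : Ccont f z -> Ccont g z ->
  (exists r, 0 < r /\ forall w, w <> z -> Cmod (w - z) < r -> f w = g w) -> f z = g z.
Proof.
  intros Hf Hg [r [Hr E]].
  destruct (Ceq_dec (f z) (g z)) as [|N]; auto. exfalso.
  set (e := Cmod (f z - g z)).
  assert (He : 0 < e) by (apply Cmod_gt_0; intro H; apply N; apply Ceq_minus; auto).
  destruct (Hf (e/2)) as [d1 [Hd1 H1]]; [lra|].
  destruct (Hg (e/2)) as [d2 [Hd2 H2]]; [lra|].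
  set (d := Rmin r (Rmin d1 d2) / 2).
  assert (Hd : 0 < Rmin r (Rmin d1 d2)) by (repeat apply Rmin_pos; auto).
  pose proof (Rmin_l r (Rmin d1 d2)). pose proof (Rmin_r r (Rmin d1 d2)).
  pose proof (Rmin_l d1 d2). pose proof (Rmin_r d1 d2).
  set (w := (z + RtoC d)%C).
  assert (Hw : Cmod (w - z) = d).
  { unfold w. replace (z + RtoC d - z)%C with (RtoC d) by ring. rewrite Cmod_R, Rabs_pos_eq; unfold d; lra. }
  assert (w <> z). { intro E1; rewrite E1, Cmod_refl in Hw. unfold d in Hw; lra. }
  assert (A1 := H1 w ltac:(rewrite Hw; unfold d; lra)).
  assert (A2 := H2 w ltac:(rewrite Hw; unfold d; lra)).
  rewrite (E w) in A1; auto; [|rewrite Hw; unfold d; lra].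
  assert (T : e <= Cmod (f z - g w) + Cmod (g w - g z)) by apply Cmod_tri.
  rewrite (Cmod_minus_sym (f z)) in T. lra.
Qed.

Lemma cder_unique f z l m : cder f z l -> cder f z m -> l = m.
Proof.
  intros [q [Hq [<- Hf]]] [p [Hp [<- Hg]]].
  apply Ccont_eq_off; auto. exists 1; split; [lra|]. intros w Hw _.
  assert (E : ((w - z) * q w)%C = ((w - z) * p w)%C).
  { transitivity (f w - f z)%C; [rewrite (Hf w)|rewrite (Hg w)]; ring. }
  assert (N : (w - z)%C <> 0) by (intro H; apply Hw; apply Ceq_minus; auto).
  replace (q w) with ((w - z) * q w / (w - z))%C by (field; auto). rewrite E. field; auto.
Qed.

Lemma hol_cont U f z : hol U f -> U z -> Ccont f z.
Proof. intros H Hz; destruct (H z Hz); eapply cder_cont; eauto. Qed.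

Lemma hol_sub (U V : C -> Prop) f : (forall z, V z -> U z) -> hol U f -> hol V f.
Proof. intros H Hf z Hz; apply Hf; auto. Qed.
Lemma hol_const U c : hol U (fun _ => c).
Proof. intros z _; eexists; apply cder_const. Qed.
Lemma hol_id U : hol U (fun w => w).
Proof. intros z _; eexists; apply cder_id. Qed.
Lemma hol_plus U f g : hol U f -> hol U g -> hol U (fun w => f w + g w)%C.
Proof. intros Hf Hg z Hz; destruct (Hf z Hz), (Hg z Hz); eexists; apply cder_plus; eauto. Qed.
Lemma hol_opp U f : hol U f -> hol U (fun w => - f w)%C.
Proof. intros Hf z Hz; destruct (Hf z Hz); eexists; apply cder_opp; eauto. Qed.
Lemma hol_minus U f g : hol U f -> hol U g -> hol U (fun w => f w - g w)%C.
Proof. intros; apply hol_plus; auto; apply hol_opp; auto. Qed.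
Lemma hol_mult U f g : hol U f -> hol U g -> hol U (fun w => f w * g w)%C.
Proof. intros Hf Hg z Hz; destruct (Hf z Hz), (Hg z Hz); eexists; apply cder_mult; eauto. Qed.
Lemma hol_inv U f : hol U f -> (forall z, U z -> f z <> 0) -> hol U (fun w => / f w)%C.
Proof. intros Hf Hn z Hz; destruct (Hf z Hz); eexists; apply cder_inv; eauto. Qed.
Lemma hol_div U f g : hol U f -> hol U g -> (forall z, U z -> g z <> 0) -> hol U (fun w => f w / g w)%C.
Proof. intros; unfold Cdiv; apply hol_mult; auto; apply hol_inv; auto. Qed.
Lemma hol_pow U f n : hol U f -> hol U (fun w => (f w ^ n)%C).
Proof.
  intros H; induction n; [exact (hol_const U 1)|].
  intros z Hz. destruct (hol_mult U _ _ H IHn z Hz) as [l Hl]. exists l.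
  eapply cder_ext; [apply Rlt_0_1| |apply Hl]. intros; symmetry; apply Cpow_S.
Qed.

Lemma opn_disc a r : opn (fun z => Cmod (z - a) < r).
Proof.
  intros z Hz. exists (r - Cmod (z - a)); split; [lra|]. intros w Hw.
  pose proof (Cmod_tri w z a). lra.
Qed.

(** * Integrals over the boundary of a rectangle *)

Definition CRInt (h : R -> C) (a b : R) : C :=
  (RInt (fun t => fst (h t)) a b, RInt (fun t => snd (h t)) a b).

Definition icont (h : R -> C) (a b : R) : Prop :=
  forall t, a <= t <= b ->
    continuous (fun t => fst (h t)) t /\ continuous (fun t => snd (h t)) t.

Lemma icont_ex h a b : a <= b -> icont h a b ->
  ex_RInt (fun t => fst (h t)) a b /\ ex_RInt (fun t => snd (h t)) a b.
Proof.
  intros Hab H; split; apply (ex_RInt_continuous (V := R_CompleteNormedModule)); intros t;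
  rewrite Rmin_left, Rmax_right by auto; intros Ht; apply H; auto.
Qed.

Lemma icont_sub h a b a' b' : a <= a' -> b' <= b -> icont h a b -> icont h a' b'.
Proof. intros A B H t Ht; apply H; lra. Qed.

Lemma CRInt_ext h k a b : a <= b -> (forall t, a <= t <= b -> h t = k t) -> CRInt h a b = CRInt k a b.
Proof.
  intros Hab E; unfold CRInt; f_equal; apply RInt_ext; intros t;
  rewrite Rmin_left, Rmax_right by auto; intros Ht; rewrite E; auto; lra.
Qed.

Lemma CRInt_chasles h a b c : a <= b <= c -> icont h a c -> (CRInt h a b + CRInt h b c)%C = CRInt h a c.
Proof.
  intros Hab H. destruct (icont_ex h a b) as [E1 E2]; [lra|eapply icont_sub; [| |apply H]; lra|].
  destruct (icont_ex h b c) as [E3 E4]; [lra|eapply icont_sub; [| |apply H]; lra|].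
  unfold CRInt, Cplus; simpl. f_equal; apply (RInt_Chasles (V := R_CompleteNormedModule)); auto.
Qed.

Lemma CRInt_plus h k a b : a <= b -> icont h a b -> icont k a b ->
  CRInt (fun t => h t + k t)%C a b = (CRInt h a b + CRInt k a b)%C.
Proof.
  intros Hab H K. destruct (icont_ex h a b) as [E1 E2]; auto.
  destruct (icont_ex k a b) as [E3 E4]; auto.
  unfold CRInt, Cplus; simpl. f_equal; apply (RInt_plus (V := R_CompleteNormedModule)); auto.
Qed.

Lemma CRInt_scal c h a b : a <= b -> icont h a b ->
  CRInt (fun t => c * h t)%C a b = (c * CRInt h a b)%C.
Proof.
  intros Hab H. destruct (icont_ex h a b) as [E1 E2]; auto.
  pose proof (RInt_correct (V := R_CompleteNormedModule) _ _ _ E1) as R1.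
  pose proof (RInt_correct (V := R_CompleteNormedModule) _ _ _ E2) as R2.
  destruct c as [u v]. unfold CRInt, Cmult; simpl. f_equal; apply is_RInt_unique.
  - exact (is_RInt_minus (V := R_NormedModule) _ _ a b _ _
      (is_RInt_scal (V := R_NormedModule) _ a b u _ R1) (is_RInt_scal (V := R_NormedModule) _ a b v _ R2)).
  - exact (is_RInt_plus (V := R_NormedModule) _ _ a b _ _
      (is_RInt_scal (V := R_NormedModule) _ a b u _ R2) (is_RInt_scal (V := R_NormedModule) _ a b v _ R1)).
Qed.

(** The factor 2 comes from bounding real and imaginary parts separately. Some fixed constant is all
    that is wanted; this one reappears in the 16 of [Jsq_bound]. *)
Lemma CRInt_bound h a b M : a <= b -> icont h a b -> (forall t, a <= t <= b -> Cmod (h t) <= M) ->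
  Cmod (CRInt h a b) <= 2 * (b - a) * M.
Proof.
  intros Hab H B. destruct (icont_ex h a b) as [E1 E2]; auto.
  eapply Rle_trans; [apply Cmod_le_re_im|]. unfold CRInt; simpl.
  assert (Rabs (RInt (fun t => fst (h t)) a b) <= (b - a) * M).
  { apply abs_RInt_le_const; auto. intros; eapply Rle_trans; [apply re_le_Cmod|auto]. }
  assert (Rabs (RInt (fun t => snd (h t)) a b) <= (b - a) * M).
  { apply abs_RInt_le_const; auto. intros; eapply Rle_trans; [apply im_le_Cmod|auto]. }
  lra.
Qed.

Lemma Cmod_re (x y u : R) : Cmod ((x, y) - (u, y))%C = Rabs (x - u).
Proof. replace ((x, y) - (u, y))%C with (RtoC (x - u)); [apply Cmod_R|].
  unfold RtoC, Cminus, Cplus, Copp; simpl; f_equal; ring. Qed.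
Lemma Cmod_im (x y u : R) : Cmod ((x, y) - (x, u))%C = Rabs (y - u).
Proof. replace ((x, y) - (x, u))%C with (Ci * RtoC (y - u))%C;
  [rewrite Cmod_mult, Cmod_Ci, Cmod_R; ring|].
  unfold Ci, RtoC, Cminus, Cplus, Copp, Cmult; simpl; f_equal; ring. Qed.

Lemma Ccont_hor F x y : Ccont F (x, y) ->
  continuous (fun t => fst (F (t, y))) x /\ continuous (fun t => snd (F (t, y))) x.
Proof.
  intros H; split; apply filterlim_locally; intros [e He];
  destruct (H e He) as [d [Hd H1]]; exists (mkposreal d Hd); intros t Ht;
  unfold ball in *; simpl in *; unfold AbsRing_ball, abs, minus, plus, opp in *; simpl in *;
  assert (T := H1 (t, y)); rewrite Cmod_re in T; specialize (T Ht);
  (eapply Rle_lt_trans; [|apply T]).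
  - apply (re_le_Cmod (F (t, y) - F (x, y))%C).
  - apply (im_le_Cmod (F (t, y) - F (x, y))%C).
Qed.

Lemma Ccont_ver F x y : Ccont F (x, y) ->
  continuous (fun t => fst (F (x, t))) y /\ continuous (fun t => snd (F (x, t))) y.
Proof.
  intros H; split; apply filterlim_locally; intros [e He];
  destruct (H e He) as [d [Hd H1]]; exists (mkposreal d Hd); intros t Ht;
  unfold ball in *; simpl in *; unfold AbsRing_ball, abs, minus, plus, opp in *; simpl in *;
  assert (T := H1 (x, t)); rewrite Cmod_im in T; specialize (T Ht);
  (eapply Rle_lt_trans; [|apply T]).
  - apply (re_le_Cmod (F (x, t) - F (x, y))%C).
  - apply (im_le_Cmod (F (x, t) - F (x, y))%C).
Qed.

Definition hint (F : C -> C) x1 x2 y : C := CRInt (fun t => F (t, y)) x1 x2.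
Definition vint (F : C -> C) x y1 y2 : C := (Ci * CRInt (fun t => F (x, t)) y1 y2)%C.
(** The integral of F(z) dz once around the rectangle, counterclockwise; the [Ci] in [vint] is dz =
    i dy. *)
Definition J F x1 x2 y1 y2 : C :=
  (hint F x1 x2 y1 + vint F x2 y1 y2 - hint F x1 x2 y2 - vint F x1 y1 y2)%C.

Definition inrect x1 x2 y1 y2 (z : C) : Prop := x1 <= fst z <= x2 /\ y1 <= snd z <= y2.
Definition onb x1 x2 y1 y2 (z : C) : Prop :=
  inrect x1 x2 y1 y2 z /\ (fst z = x1 \/ fst z = x2 \/ snd z = y1 \/ snd z = y2).

Lemma hint_icont F x1 x2 y : (forall x, x1 <= x <= x2 -> Ccont F (x, y)) ->
  icont (fun t => F (t, y)) x1 x2.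
Proof. intros H t Ht; apply Ccont_hor; auto. Qed.
Lemma vint_icont F x y1 y2 : (forall y, y1 <= y <= y2 -> Ccont F (x, y)) ->
  icont (fun t => F (x, t)) y1 y2.
Proof. intros H t Ht; apply Ccont_ver; auto. Qed.

Ltac onbtac := unfold onb, inrect; simpl; intuition lra.

Lemma J_ext F G x1 x2 y1 y2 : x1 <= x2 -> y1 <= y2 ->
  (forall z, onb x1 x2 y1 y2 z -> F z = G z) -> J F x1 x2 y1 y2 = J G x1 x2 y1 y2.
Proof.
  intros Hx Hy E. unfold J, hint, vint.
  rewrite (CRInt_ext (fun t => F (t, y1)) (fun t => G (t, y1))),
    (CRInt_ext (fun t => F (t, y2)) (fun t => G (t, y2))),
    (CRInt_ext (fun t => F (x1, t)) (fun t => G (x1, t))),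
    (CRInt_ext (fun t => F (x2, t)) (fun t => G (x2, t))); auto;
  intros; apply E; onbtac.
Qed.

Definition bcont F x1 x2 y1 y2 := forall z, onb x1 x2 y1 y2 z -> Ccont F z.

Lemma bcont_sides F x1 x2 y1 y2 : x1 <= x2 -> y1 <= y2 -> bcont F x1 x2 y1 y2 ->
  icont (fun t => F (t, y1)) x1 x2 /\ icont (fun t => F (t, y2)) x1 x2 /\
  icont (fun t => F (x1, t)) y1 y2 /\ icont (fun t => F (x2, t)) y1 y2.
Proof.
  intros Hx Hy H; split; [|split; [|split]]; try apply (hint_icont F); try apply (vint_icont F); auto;
  intros; apply H; onbtac.
Qed.

Lemma J_plus F G x1 x2 y1 y2 : x1 <= x2 -> y1 <= y2 ->
  bcont F x1 x2 y1 y2 -> bcont G x1 x2 y1 y2 ->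
  J (fun z => F z + G z)%C x1 x2 y1 y2 = (J F x1 x2 y1 y2 + J G x1 x2 y1 y2)%C.
Proof.
  intros Hx Hy HF HG. apply bcont_sides in HF; auto. apply bcont_sides in HG; auto.
  destruct HF as [? [? [? ?]]], HG as [? [? [? ?]]].
  unfold J, hint, vint. rewrite !CRInt_plus; auto. ring.
Qed.

Lemma J_scal c F x1 x2 y1 y2 : x1 <= x2 -> y1 <= y2 -> bcont F x1 x2 y1 y2 ->
  J (fun z => c * F z)%C x1 x2 y1 y2 = (c * J F x1 x2 y1 y2)%C.
Proof.
  intros Hx Hy HF. apply bcont_sides in HF; auto. destruct HF as [? [? [? ?]]].
  unfold J, hint, vint. rewrite !CRInt_scal; auto. ring.
Qed.

Lemma hint_bound F x1 x2 y M : x1 <= x2 -> (forall x, x1 <= x <= x2 -> Ccont F (x, y)) ->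
  (forall x, x1 <= x <= x2 -> Cmod (F (x, y)) <= M) -> Cmod (hint F x1 x2 y) <= 2 * (x2 - x1) * M.
Proof. intros; apply CRInt_bound; auto; apply hint_icont; auto. Qed.

Lemma vint_bound F x y1 y2 M : y1 <= y2 -> (forall y, y1 <= y <= y2 -> Ccont F (x, y)) ->
  (forall y, y1 <= y <= y2 -> Cmod (F (x, y)) <= M) -> Cmod (vint F x y1 y2) <= 2 * (y2 - y1) * M.
Proof.
  intros; unfold vint; rewrite Cmod_mult, Cmod_Ci, Rmult_1_l.
  apply (CRInt_bound (fun t => F (x, t))); auto; apply vint_icont; auto.
Qed.

Lemma J_bound F x1 x2 y1 y2 M : x1 <= x2 -> y1 <= y2 -> bcont F x1 x2 y1 y2 ->
  (forall z, onb x1 x2 y1 y2 z -> Cmod (F z) <= M) ->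
  Cmod (J F x1 x2 y1 y2) <= 4 * ((x2 - x1) + (y2 - y1)) * M.
Proof.
  intros Hx Hy HF HM.
  assert (A1 : Cmod (hint F x1 x2 y1) <= 2 * (x2 - x1) * M)
    by (apply hint_bound; auto; intros; [apply HF|apply HM]; onbtac).
  assert (A2 : Cmod (hint F x1 x2 y2) <= 2 * (x2 - x1) * M)
    by (apply hint_bound; auto; intros; [apply HF|apply HM]; onbtac).
  assert (A3 : Cmod (vint F x1 y1 y2) <= 2 * (y2 - y1) * M)
    by (apply vint_bound; auto; intros; [apply HF|apply HM]; onbtac).
  assert (A4 : Cmod (vint F x2 y1 y2) <= 2 * (y2 - y1) * M)
    by (apply vint_bound; auto; intros; [apply HF|apply HM]; onbtac).
  unfold J, Cminus.
  pose proof (Cmod_triangle (hint F x1 x2 y1 + vint F x2 y1 y2 + - hint F x1 x2 y2) (- vint F x1 y1 y2)).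
  pose proof (Cmod_triangle (hint F x1 x2 y1 + vint F x2 y1 y2) (- hint F x1 x2 y2)).
  pose proof (Cmod_triangle (hint F x1 x2 y1) (vint F x2 y1 y2)).
  rewrite !Cmod_opp in *. lra.
Qed.

(** The two integrals along the common side cancel as terms, which is why continuity is assumed on
    the outer boundary alone. *)
Lemma J_splitx F x1 m x2 y1 y2 : x1 <= m <= x2 -> y1 <= y2 -> bcont F x1 x2 y1 y2 ->
  J F x1 x2 y1 y2 = (J F x1 m y1 y2 + J F m x2 y1 y2)%C.
Proof.
  intros Hx Hy H. unfold J, hint.
  rewrite <- (CRInt_chasles (fun t => F (t, y1)) x1 m x2), <- (CRInt_chasles (fun t => F (t, y2)) x1 m x2); auto;
  try (apply (hint_icont F); intros; apply H; onbtac). ring.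
Qed.

Lemma J_splity F x1 x2 y1 m y2 : x1 <= x2 -> y1 <= m <= y2 -> bcont F x1 x2 y1 y2 ->
  J F x1 x2 y1 y2 = (J F x1 x2 y1 m + J F x1 x2 m y2)%C.
Proof.
  intros Hx Hy H. unfold J, vint.
  rewrite <- (CRInt_chasles (fun t => F (x1, t)) y1 m y2), <- (CRInt_chasles (fun t => F (x2, t)) y1 m y2); auto;
  try (apply (vint_icont F); intros; apply H; onbtac). ring.
Qed.

Lemma RInt_id a b : RInt (fun t => t) a b = (b * b - a * a) / 2.
Proof.
  apply is_RInt_unique.
  replace ((b * b - a * a) / 2) with (minus (b * b / 2) (a * a / 2))
    by (unfold minus, plus, opp; simpl; field).
  apply (is_RInt_derive (fun t => t * t / 2) (fun t => t)).
  - intros; auto_derive; auto. lra.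
  - intros; apply continuous_id.
Qed.

Lemma J_const c x1 x2 y1 y2 : x1 <= x2 -> y1 <= y2 -> J (fun _ => c) x1 x2 y1 y2 = 0.
Proof.
  intros. unfold J, hint, vint, CRInt. rewrite !RInt_const. unfold scal; simpl; unfold mult; simpl.
  apply injective_projections; simpl; ring.
Qed.

Lemma J_id x1 x2 y1 y2 : x1 <= x2 -> y1 <= y2 -> J (fun w => w) x1 x2 y1 y2 = 0.
Proof.
  intros. unfold J, hint, vint, CRInt; simpl. rewrite !RInt_const, !RInt_id.
  unfold scal; simpl; unfold mult; simpl.
  apply injective_projections; simpl; field.
Qed.

(** * Bisection of rectangles *)

Section RectInd.
Variable P : R -> R -> R -> R -> Prop.
Variables X Y A B : R.
Hypothesis HA : 0 < A.
Hypothesis HB : 0 < B.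
Let sub x y a b := X <= x /\ Y <= y /\ x + a <= X + A /\ y + b <= Y + B.
Hypothesis step : forall x y a b, 0 < a -> 0 < b -> sub x y a b ->
  P x y (a/2) (b/2) -> P (x + a/2) y (a/2) (b/2) ->
  P x (y + b/2) (a/2) (b/2) -> P (x + a/2) (y + b/2) (a/2) (b/2) -> P x y a b.
Hypothesis loc : forall u v, X <= u <= X + A -> Y <= v <= Y + B -> exists d, 0 < d /\
  forall x y a b, 0 < a < d -> 0 < b < d -> sub x y a b ->
    x <= u <= x + a -> y <= v <= y + b -> P x y a b.

Let bad (n : nat) (p : R * R) := ~ P (fst p) (snd p) (A / 2^n) (B / 2^n) /\
   sub (fst p) (snd p) (A / 2^n) (B / 2^n).
Let nest (n : nat) (p p' : R * R) := fst p <= fst p' /\ snd p <= snd p' /\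
   fst p' + A / 2^(S n) <= fst p + A / 2^n /\ snd p' + B / 2^(S n) <= snd p + B / 2^n.

(** Compactness in the form of an induction: nested bad quarters shrink to a point, the supremum of
    their lower left corners, where [loc] refutes them. Goursat's theorem and the boundedness of
    continuous functions are both instances. *)
Lemma rect_bisection : P X Y A B.
Proof.
  apply NNPP; intro N.
  assert (pw : forall n, 0 < / 2^n) by (intros; apply Rinv_0_lt_compat, pow_lt; lra).
  (* The implication sits under the existential so that the choice of the next corner is total: a
     corner that is not bad is answered by itself. *)
  assert (St : forall n p, exists p', bad n p -> bad (S n) p' /\ nest n p p').
  { intros n [x y]. destruct (classic (bad n (x, y))) as [[Hn Hs]|]; [|exists (x,y); tauto].
    simpl in *. set (a := A / 2^n) in *. set (b := B / 2^n) in *.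
    assert (Ha : A / 2 ^ S n = a / 2) by (unfold a; simpl; field; apply pow_nonzero; lra).
    assert (Hb : B / 2 ^ S n = b / 2) by (unfold b; simpl; field; apply pow_nonzero; lra).
    assert (a0 : 0 < a) by (unfold a, Rdiv; apply Rmult_lt_0_compat; auto).
    assert (b0 : 0 < b) by (unfold b, Rdiv; apply Rmult_lt_0_compat; auto).
    unfold bad, nest. setoid_rewrite Ha. setoid_rewrite Hb. simpl. fold a b.
    destruct (classic (P x y (a/2) (b/2))); [|exists (x,y); unfold sub in *; simpl; intuition lra].
    destruct (classic (P (x+a/2) y (a/2) (b/2))); [|exists (x+a/2,y); unfold sub in *; simpl; intuition lra].
    destruct (classic (P x (y+b/2) (a/2) (b/2))); [|exists (x,y+b/2); unfold sub in *; simpl; intuition lra].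
    destruct (classic (P (x+a/2) (y+b/2) (a/2) (b/2))); [|exists (x+a/2,y+b/2); unfold sub in *; simpl; intuition lra].
    exfalso; apply Hn, step; auto. }
  set (nx := fun n p => proj1_sig (constructive_indefinite_description _ (St n p))).
  assert (Hnx : forall n p, bad n p -> bad (S n) (nx n p) /\ nest n p (nx n p)).
  { intros n p. unfold nx. destruct constructive_indefinite_description; auto. }
  set (s := fix s n := match n with O => (X, Y) | S m => nx m (s m) end).
  assert (Hb : forall n, bad n (s n)).
  { induction n; [|simpl; apply Hnx; auto].
    split; simpl; unfold sub; rewrite ?Rdiv_1_r; auto. lra. }
  assert (Hst : forall n, nest n (s n) (s (S n))) by (intros; apply Hnx; auto).
  assert (Hk : forall n k, fst (s n) <= fst (s (n + k)%nat) /\ snd (s n) <= snd (s (n + k)%nat) /\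
    fst (s (n+k)%nat) + A / 2^(n+k) <= fst (s n) + A / 2^n /\
    snd (s (n+k)%nat) + B / 2^(n+k) <= snd (s n) + B / 2^n).
  { intros n k; induction k; [rewrite Nat.add_0_r; lra|].
    rewrite Nat.add_succ_r. destruct (Hst (n+k)%nat) as [? [? [? ?]]]. lra. }
  assert (dp : forall c n, 0 < c -> 0 < c / 2^n).
  { intros; unfold Rdiv; apply Rmult_lt_0_compat; auto. }
  assert (mn : forall m n, fst (s m) <= fst (s n) + A / 2^n /\ snd (s m) <= snd (s n) + B / 2^n).
  { intros m n. pose proof (dp A m HA). pose proof (dp B m HB). pose proof (dp A n HA). pose proof (dp B n HB).
    destruct (Nat.le_ge_cases m n).
    - replace n with (m + (n - m))%nat by lia. destruct (Hk m (n-m)%nat) as [? [? [? ?]]].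
      replace (m + (n - m))%nat with n in * by lia. lra.
    - destruct (Hk n (m-n)%nat) as [? [? [? ?]]].
      replace (n + (m - n))%nat with m in * by lia. lra. }
  destruct (completeness (fun t => exists n, t = fst (s n))) as [u [Hu1 Hu2]].
  { exists (fst (s O) + A / 2^0). intros t [n ->]. apply mn. }
  { exists (fst (s O)), O; auto. }
  destruct (completeness (fun t => exists n, t = snd (s n))) as [v [Hv1 Hv2]].
  { exists (snd (s O) + B / 2^0). intros t [n ->]. apply mn. }
  { exists (snd (s O)), O; auto. }
  assert (Hun : forall n, fst (s n) <= u <= fst (s n) + A / 2^n).
  { intros n; split; [apply Hu1; exists n; auto|]. apply Hu2; intros t [m ->]; apply mn. }
  assert (Hvn : forall n, snd (s n) <= v <= snd (s n) + B / 2^n).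
  { intros n; split; [apply Hv1; exists n; auto|]. apply Hv2; intros t [m ->]; apply mn. }
  pose proof (Hun O) as U0. pose proof (Hvn O) as V0. simpl in U0, V0. rewrite Rdiv_1_r in *.
  destruct (loc u v) as [d [Hd L]]; [lra|lra|].
  destruct (pow_lt_1_zero (1/2) ltac:(rewrite Rabs_pos_eq; lra) (d / (A + B))) as [n Hn].
  { apply Rdiv_lt_0_compat; lra. }
  specialize (Hn n (Nat.le_refl n)). rewrite Rabs_pos_eq in Hn by (apply pow_le; lra).
  replace ((1/2)^n) with (/ 2^n) in Hn by (unfold Rdiv; rewrite Rmult_1_l, pow_inv; auto).
  assert (Hn' : / 2^n * (A + B) < d).
  { apply Rmult_lt_reg_r with (/ (A + B)); [apply Rinv_0_lt_compat; lra|].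
    rewrite Rmult_assoc, Rinv_r, Rmult_1_r by lra. auto. }
  destruct (Hb n) as [Hn1 Hn2]. apply Hn1. specialize (pw n).
  pose proof (Rmult_lt_0_compat _ _ pw HA). pose proof (Rmult_lt_0_compat _ _ pw HB).
  apply L; auto; unfold Rdiv; rewrite Rmult_comm; lra.
Qed.
End RectInd.

(** The bound eps (a + b)^2 for sides a, b adds up exactly over the four quarters. Near a point it
    holds because the affine part of [F] integrates to 0 and the remainder is at most (a + b) eps /
    4, while [J_bound] costs 4 (a + b). *)
Theorem goursat F x1 x2 y1 y2 : x1 < x2 -> y1 < y2 ->
  (forall z, inrect x1 x2 y1 y2 z -> exists l, cder F z l) -> J F x1 x2 y1 y2 = 0.
Proof.
  intros Hx Hy H.
  assert (HC : forall z, inrect x1 x2 y1 y2 z -> Ccont F z).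
  { intros z Hz; destruct (H z Hz); eapply cder_cont; eauto. }
  assert (K : forall eps, 0 < eps -> Cmod (J F x1 x2 y1 y2) <= eps * (((x2 - x1) + (y2 - y1)) * ((x2 - x1) + (y2 - y1)))).
  { intros eps He.
    pose proof (rect_bisection (fun x y a b => Cmod (J F x (x + a) y (y + b)) <= eps * ((a + b) * (a + b)))
      x1 y1 (x2 - x1) (y2 - y1)) as T.
    cbv beta in T. replace (x1 + (x2 - x1)) with x2 in T by ring. replace (y1 + (y2 - y1)) with y2 in T by ring.
    apply T; try lra; clear T.
    - intros x y a b Ha Hb S P1 P2 P3 P4.
      assert (HB : bcont F x (x + a) y (y + b)).
      { intros z [Hz _]. apply HC. unfold inrect in *. lra. }
      assert (HB1 : bcont F x (x + a/2) y (y + b)).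
      { intros z [Hz _]. apply HC. unfold inrect in *. lra. }
      assert (HB2 : bcont F (x+a/2) (x + a) y (y + b)).
      { intros z [Hz _]. apply HC. unfold inrect in *. lra. }
      rewrite (J_splitx F x (x + a/2) (x + a)); auto; try lra.
      rewrite (J_splity F x (x+a/2) y (y + b/2) (y + b)); auto; try lra.
      rewrite (J_splity F (x+a/2) (x+a) y (y + b/2) (y + b)); auto; try lra.
      replace (x + a/2 + a/2) with (x + a) in * by field. replace (y + b/2 + b/2) with (y + b) in * by field.
      pose proof (Cmod_triangle (J F x (x + a / 2) y (y + b / 2) + J F x (x + a / 2) (y + b / 2) (y + b))
         (J F (x + a / 2) (x + a) y (y + b / 2) + J F (x + a / 2) (x + a) (y + b / 2) (y + b))).
      pose proof (Cmod_triangle (J F x (x + a / 2) y (y + b / 2)) (J F x (x + a / 2) (y + b / 2) (y + b))).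
      pose proof (Cmod_triangle (J F (x + a / 2) (x + a) y (y + b / 2)) (J F (x + a / 2) (x + a) (y + b / 2) (y + b))).
      assert (eps * ((a/2 + b/2) * (a/2 + b/2)) = eps * ((a + b) * (a + b)) / 4) by field. lra.
    - intros u v Hu Hv.
      destruct (H (u, v)) as [l [q [Hq [Hl HF]]]]; [unfold inrect; simpl; lra|].
      destruct (Hq (eps / 4)) as [d [Hd Hq']]; [lra|].
      exists (d / 2); split; [lra|]. intros x y a b Ha Hb S Hxu Hyv.
      set (G := fun w => ((F (u, v) - (u, v) * l) + (l * w + (w - (u, v)) * (q w - l)))%C).
      assert (E : forall w, F w = G w) by (intros w; unfold G; rewrite HF; ring).
      assert (Hcq : bcont (fun w => (w - (u, v)) * (q w - l))%C x (x + a) y (y + b)).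
      { intros z [Hz _]. apply Ccont_ext with (f := fun w => (F w - ((F (u, v) - (u, v) * l) + l * w))%C) (r := 1); [lra| |].
        - intros w _; rewrite E; unfold G; ring.
        - apply Ccont_minus; [apply HC; unfold inrect in *; lra|]. apply Ccont_plus; [apply Ccont_const|].
          apply Ccont_mult; [apply Ccont_const|apply Ccont_id]. }
      assert (Hid : bcont (fun w => w) x (x + a) y (y + b)) by (intros z _; apply Ccont_id).
      assert (Hlw : bcont (fun w => l * w)%C x (x + a) y (y + b))
        by (intros z _; apply Ccont_mult; [apply Ccont_const|apply Ccont_id]).
      rewrite (J_ext F G); auto; try lra. unfold G.
      rewrite J_plus; auto; try lra; [|intros z _; apply Ccont_const
         |intros z Hz; apply Ccont_plus; auto].
      rewrite J_plus; auto; try lra. rewrite J_const by lra. rewrite J_scal; auto; try lra. rewrite J_id by lra.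
      replace (0 + (l * 0 + J (fun w : C => (w - (u, v)) * (q w - l)) x (x + a) y (y + b)))%C
        with (J (fun w : C => (w - (u, v)) * (q w - l))%C x (x + a) y (y + b)) by ring.
      eapply Rle_trans; [apply J_bound with (M := (a + b) * (eps / 4)); auto; try lra|].
      + intros z [Hz _]. rewrite Cmod_mult.
        assert (Dz : Cmod (z - (u, v)) <= a + b).
        { eapply Rle_trans; [apply Cmod_le_re_im|]. unfold inrect in Hz; simpl.
          apply Rplus_le_compat; apply Rabs_le; lra. }
        apply Rmult_le_compat; try apply Cmod_ge_0; auto.
        rewrite <- Hl. left; apply Hq'. lra.
      + right; field. }
  apply Cmod_eq_0. apply Rle_antisym; [|apply Cmod_ge_0].
  set (k := ((x2 - x1) + (y2 - y1)) * ((x2 - x1) + (y2 - y1))) in *.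
  assert (Hk : 0 < k) by (unfold k; apply Rmult_lt_0_compat; lra).
  apply Rnot_lt_le; intro N. specialize (K (Cmod (J F x1 x2 y1 y2) / (2 * k))).
  assert (T : Cmod (J F x1 x2 y1 y2) / (2 * k) * k = Cmod (J F x1 x2 y1 y2) / 2) by (field; lra).
  rewrite T in K. specialize (K ltac:(apply Rdiv_lt_0_compat; lra)). lra.
Qed.

(** * Cauchy's formula and removable singularities *)

Definition tpi : C := (0, 2 * PI).

Lemma PI_gt_3 : 3 < PI.
Proof. pose proof PI2_3_2; lra. Qed.

Lemma tpi_nz : tpi <> 0.
Proof. intro H; pose proof PI_gt_3; injection H; intros; lra. Qed.

Lemma Cmod_tpi : Cmod tpi = 2 * PI.
Proof.
  replace tpi with (Ci * RtoC (2 * PI))%C by (apply injective_projections; unfold tpi; simpl; ring).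
  rewrite Cmod_mult, Cmod_Ci, Cmod_R, Rabs_pos_eq; pose proof PI_gt_3; lra.
Qed.

Lemma sq_pos_nz a b : b <> 0 -> 0 < a * a + b * b.
Proof. intros; nra. Qed.

Lemma RInt_ln_part a c x1 x2 : c <> 0 ->
  RInt (fun t => (t - a) / ((t - a) * (t - a) + c * c)) x1 x2 =
  ln ((x2 - a) * (x2 - a) + c * c) / 2 - ln ((x1 - a) * (x1 - a) + c * c) / 2.
Proof.
  intros Hc. apply is_RInt_unique.
  apply (is_RInt_derive (fun t => ln ((t - a) * (t - a) + c * c) / 2)).
  - intros t _. pose proof (sq_pos_nz (t - a) c Hc). auto_derive; [lra|field; lra].
  - intros t _. pose proof (sq_pos_nz (t - a) c Hc). apply (ex_derive_continuous (V := R_NormedModule)).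
    auto_derive. lra.
Qed.

Lemma RInt_atan_part a c x1 x2 : c <> 0 ->
  RInt (fun t => c / ((t - a) * (t - a) + c * c)) x1 x2 =
  atan ((x2 - a) / c) - atan ((x1 - a) / c).
Proof.
  intros Hc. apply is_RInt_unique.
  apply (is_RInt_derive (fun t => atan ((t - a) / c))).
  - intros t _. pose proof (sq_pos_nz (t - a) c Hc). auto_derive; auto. field.
    split; auto. rewrite <- Rplus_comm in H. simpl in *; nra.
  - intros t _. pose proof (sq_pos_nz (t - a) c Hc). apply (ex_derive_continuous (V := R_NormedModule)).
    auto_derive. lra.
Qed.

Lemma atan_compl u v : 0 < u -> 0 < v -> atan (u / v) + atan (v / u) = PI / 2.
Proof.
  intros Hu Hv. replace (v / u) with (/ (u / v)) by (field; lra).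
  rewrite atan_inv; [lra|apply Rdiv_lt_0_compat; auto].
Qed.

(** By explicit primitives: the logarithms at the four corners cancel, and the eight arctangents
    pair up, two per corner, to PI/2 each. *)
Lemma J_winding (a : C) x1 x2 y1 y2 : x1 < fst a < x2 -> y1 < snd a < y2 ->
  J (fun w => / (w - a))%C x1 x2 y1 y2 = tpi.
Proof.
  destruct a as [a b]; simpl; intros Ha Hb.
  unfold J, hint, vint, CRInt; simpl.
  assert (E1 : forall y, y - b <> 0 -> RInt (fun t : R => (t + - a) / ((t + - a) * ((t + - a) * 1) + (y + - b) * ((y + - b) * 1))) x1 x2
     = ln ((x2 - a) * (x2 - a) + (y - b) * (y - b)) / 2 - ln ((x1 - a) * (x1 - a) + (y - b) * (y - b)) / 2).
  { intros y Hy. rewrite <- RInt_ln_part by auto. apply RInt_ext; intros; f_equal. unfold Rminus; ring. }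
  assert (E2 : forall y, y - b <> 0 -> RInt (fun t : R => - (y + - b) / ((t + - a) * ((t + - a) * 1) + (y + - b) * ((y + - b) * 1))) x1 x2
     = - (atan ((x2 - a) / (y - b)) - atan ((x1 - a) / (y - b)))).
  { intros y Hy. rewrite <- RInt_atan_part by auto.
    rewrite <- (RInt_opp (V := R_CompleteNormedModule)).
    - apply RInt_ext; intros. unfold opp; simpl. unfold Rminus, Rdiv. rewrite Ropp_mult_distr_l. f_equal. f_equal. ring.
    - apply (ex_RInt_continuous (V := R_CompleteNormedModule)). intros t _. pose proof (sq_pos_nz (t - a) (y - b) Hy).
      apply (ex_derive_continuous (V := R_NormedModule)). auto_derive. lra. }
  assert (E3 : forall x, x - a <> 0 -> RInt (fun t : R => (x + - a) / ((x + - a) * ((x + - a) * 1) + (t + - b) * ((t + - b) * 1))) y1 y2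
     = atan ((y2 - b) / (x - a)) - atan ((y1 - b) / (x - a))).
  { intros x Hx. rewrite <- RInt_atan_part by auto. apply RInt_ext; intros; f_equal. unfold Rminus; ring. }
  assert (E4 : forall x, x - a <> 0 -> RInt (fun t : R => - (t + - b) / ((x + - a) * ((x + - a) * 1) + (t + - b) * ((t + - b) * 1))) y1 y2
     = - (ln ((y2 - b) * (y2 - b) + (x - a) * (x - a)) / 2 - ln ((y1 - b) * (y1 - b) + (x - a) * (x - a)) / 2)).
  { intros x Hx. rewrite <- RInt_ln_part by auto.
    rewrite <- (RInt_opp (V := R_CompleteNormedModule)).
    - apply RInt_ext; intros. unfold opp; simpl. unfold Rminus, Rdiv. rewrite Ropp_mult_distr_l. f_equal. f_equal. ring.
    - apply (ex_RInt_continuous (V := R_CompleteNormedModule)). intros t _. pose proof (sq_pos_nz (t - b) (x - a) Hx).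
      apply (ex_derive_continuous (V := R_NormedModule)). auto_derive. lra. }
  rewrite !E1, !E2, !E3, !E4 by lra.
  pose proof (atan_compl (x2 - a) (b - y1) ltac:(lra) ltac:(lra)) as T1.
  pose proof (atan_compl (a - x1) (b - y1) ltac:(lra) ltac:(lra)) as T2.
  pose proof (atan_compl (x2 - a) (y2 - b) ltac:(lra) ltac:(lra)) as T3.
  pose proof (atan_compl (a - x1) (y2 - b) ltac:(lra) ltac:(lra)) as T4.
  replace ((x2 - a) / (y1 - b)) with (- ((x2 - a) / (b - y1))) by (field; lra).
  replace ((x1 - a) / (y1 - b)) with ((a - x1) / (b - y1)) by (field; lra).
  replace ((y1 - b) / (x2 - a)) with (- ((b - y1) / (x2 - a))) by (field; lra).
  replace ((x1 - a) / (y2 - b)) with (- ((a - x1) / (y2 - b))) by (field; lra).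
  replace ((y2 - b) / (x1 - a)) with (- ((y2 - b) / (a - x1))) by (field; lra).
  replace ((y1 - b) / (x1 - a)) with ((b - y1) / (a - x1)) by (field; lra).
  rewrite !atan_opp.
  rewrite (Rplus_comm ((y2 - b) * (y2 - b))), (Rplus_comm ((y1 - b) * (y1 - b))),
    (Rplus_comm ((y2 - b) * (y2 - b)) ((x1 - a) * (x1 - a))), (Rplus_comm ((y1 - b) * (y1 - b)) ((x1 - a) * (x1 - a))).
  apply injective_projections; unfold tpi; simpl; lra.
Qed.

(** Cutting out a square of half-side [s] around [a] leaves four rectangles to which [goursat]
    applies, and the integral around the square is at most 16 s M with [s] arbitrarily small. *)
Lemma goursat_punct F (a : C) x1 x2 y1 y2 : x1 < fst a < x2 -> y1 < snd a < y2 ->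
  (forall z, inrect x1 x2 y1 y2 z -> Ccont F z) ->
  (forall z, inrect x1 x2 y1 y2 z -> z <> a -> exists l, cder F z l) -> J F x1 x2 y1 y2 = 0.
Proof.
  intros Hx Hy HC HD. destruct a as [a b]; simpl in *.
  set (M := Cmod (F (a, b)) + 1). assert (HM : 0 < M) by (pose proof (Cmod_ge_0 (F (a,b))); unfold M; lra).
  destruct (HC (a, b) ltac:(unfold inrect; simpl; lra) 1 ltac:(lra)) as [d [Hd H1]].
  set (m := Rmin d (Rmin (Rmin (a - x1) (x2 - a)) (Rmin (b - y1) (y2 - b)))).
  assert (Hm : 0 < m) by (unfold m; repeat apply Rmin_pos; lra).
  assert (Hms : m <= d /\ m <= a - x1 /\ m <= x2 - a /\ m <= b - y1 /\ m <= y2 - b).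
  { unfold m. pose proof (Rmin_l d (Rmin (Rmin (a - x1) (x2 - a)) (Rmin (b - y1) (y2 - b)))).
    pose proof (Rmin_r d (Rmin (Rmin (a - x1) (x2 - a)) (Rmin (b - y1) (y2 - b)))).
    pose proof (Rmin_l (Rmin (a - x1) (x2 - a)) (Rmin (b - y1) (y2 - b))).
    pose proof (Rmin_r (Rmin (a - x1) (x2 - a)) (Rmin (b - y1) (y2 - b))).
    pose proof (Rmin_l (a - x1) (x2 - a)). pose proof (Rmin_r (a - x1) (x2 - a)).
    pose proof (Rmin_l (b - y1) (y2 - b)). pose proof (Rmin_r (b - y1) (y2 - b)). lra. }
  clearbody m.
  assert (K : forall s, 0 < s < m / 2 -> Cmod (J F x1 x2 y1 y2) <= 16 * s * M).
  { intros s Hs.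
    assert (HB : forall x1' x2' y1' y2', x1 <= x1' -> x2' <= x2 -> y1 <= y1' -> y2' <= y2 -> bcont F x1' x2' y1' y2').
    { intros. intros z [Hz _]; apply HC; unfold inrect in *; lra. }
    rewrite (J_splitx F x1 (a - s) x2), (J_splitx F (a - s) (a + s) x2),
      (J_splity F (a - s) (a + s) y1 (b - s) y2), (J_splity F (a - s) (a + s) (b - s) (b + s) y2);
      try lra; try (apply HB; lra).
    rewrite (goursat F x1 (a - s)), (goursat F (a + s) x2), (goursat F (a - s) (a + s) y1),
      (goursat F (a - s) (a + s) (b + s)); try lra;
      try (intros z Hz; unfold inrect in *; apply HD; [lra|intros ->; simpl in Hz; lra]).
    replace (0 + (0 + (J F (a - s) (a + s) (b - s) (b + s) + 0) + 0))%C with (J F (a - s) (a + s) (b - s) (b + s)) by ring.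
    eapply Rle_trans; [apply J_bound with (M := M); try lra; try (apply HB; lra)|right; ring].
    intros z [Hz _]. unfold inrect in Hz.
    eapply Rle_trans; [apply (Cmod_diff_le (F z) (F (a, b)))|].
    unfold M. apply Rplus_le_compat_l. left; apply H1.
    eapply Rle_lt_trans; [apply Cmod_le_re_im|]. simpl.
    assert (Rabs (fst z + - a) <= s) by (apply Rabs_le; lra).
    assert (Rabs (snd z + - b) <= s) by (apply Rabs_le; lra). lra. }
  apply Cmod_eq_0. apply Rle_antisym; [|apply Cmod_ge_0].
  apply Rnot_lt_le; intro N. set (j := Cmod (J F x1 x2 y1 y2)) in *. clearbody j. clear HC HD H1. clearbody M.
  set (s := Rmin (m / 4) (j / (32 * M))).
  assert (0 < j / (32 * M)) by (apply Rdiv_lt_0_compat; lra).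
  assert (s <= m / 4) by apply Rmin_l. assert (s <= j / (32 * M)) by apply Rmin_r.
  assert (0 < s) by (apply Rmin_pos; lra).
  specialize (K s ltac:(lra)).
  assert (s * M <= j / (32 * M) * M) by (apply Rmult_le_compat_r; lra).
  replace (j / (32 * M) * M) with (j / 32) in H3 by (field; lra). lra.
Qed.

Lemma rect_bounded F x1 x2 y1 y2 : x1 < x2 -> y1 < y2 ->
  (forall z, inrect x1 x2 y1 y2 z -> Ccont F z) ->
  exists M, 0 < M /\ forall z, inrect x1 x2 y1 y2 z -> Cmod (F z) <= M.
Proof.
  intros Hx Hy HC.
  pose proof (rect_bisection (fun x y a b => exists M, forall z, inrect x (x + a) y (y + b) z -> Cmod (F z) <= M)
      x1 y1 (x2 - x1) (y2 - y1)) as T.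
  cbv beta in T. replace (x1 + (x2 - x1)) with x2 in T by ring. replace (y1 + (y2 - y1)) with y2 in T by ring.
  destruct T as [M HM]; try lra.
  - intros x y a b Ha Hb _ [M1 H1] [M2 H2] [M3 H3] [M4 H4].
    exists (Rmax (Rmax M1 M2) (Rmax M3 M4)). intros z Hz.
    pose proof (Rmax_l (Rmax M1 M2) (Rmax M3 M4)). pose proof (Rmax_r (Rmax M1 M2) (Rmax M3 M4)).
    pose proof (Rmax_l M1 M2). pose proof (Rmax_r M1 M2). pose proof (Rmax_l M3 M4). pose proof (Rmax_r M3 M4).
    unfold inrect in *.
    destruct (Rle_dec (fst z) (x + a/2)), (Rle_dec (snd z) (y + b/2)).
    + specialize (H1 z ltac:(lra)); lra.
    + specialize (H3 z ltac:(lra)); lra.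
    + specialize (H2 z ltac:(lra)); lra.
    + specialize (H4 z ltac:(lra)); lra.
  - intros u v Hu Hv. destruct (HC (u, v) ltac:(unfold inrect; simpl; lra) 1 ltac:(lra)) as [d [Hd H1]].
    exists (d/2); split; [lra|]. intros x y a b Ha Hb _ Hxu Hyv.
    exists (Cmod (F (u, v)) + 1). intros z Hz; unfold inrect in Hz.
    eapply Rle_trans; [apply (Cmod_diff_le (F z) (F (u, v)))|]. apply Rplus_le_compat_l. left; apply H1.
    eapply Rle_lt_trans; [apply Cmod_le_re_im|]. simpl.
    assert (Rabs (fst z + - u) <= a) by (apply Rabs_le; lra).
    assert (Rabs (snd z + - v) <= b) by (apply Rabs_le; lra). lra.
  - exists (Rmax M 1); split; [eapply Rlt_le_trans; [apply Rlt_0_1|apply Rmax_r]|].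
    intros z Hz; eapply Rle_trans; [apply HM; auto|apply Rmax_l].
Qed.

Lemma Ccont_kernel a w : w <> a -> Ccont (fun w => / (w - a))%C w.
Proof.
  intros H. apply Ccont_inv; [apply Ccont_minus; [apply Ccont_id|apply Ccont_const]|].
  intro E; apply H, Ceq_minus; auto.
Qed.

(** The quotient [q] of [f] at [a] is continuous at [a] and differentiable elsewhere, so it
    integrates to 0; what is left is f(a)/(w - a). *)
Theorem cauchy_formula f (a : C) x1 x2 y1 y2 : x1 < fst a < x2 -> y1 < snd a < y2 ->
  (forall z, inrect x1 x2 y1 y2 z -> exists l, cder f z l) ->
  J (fun w => f w * / (w - a))%C x1 x2 y1 y2 = (tpi * f a)%C.
Proof.
  intros Hx Hy H.
  destruct (H a ltac:(unfold inrect; simpl; lra)) as [l [q [Hq [Hl Hf]]]].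
  assert (Hd : forall z, inrect x1 x2 y1 y2 z -> z <> a -> exists l, cder q z l).
  { intros z Hz N. destruct (H z Hz) as [l' Hl'].
    assert (Hza : (z - a)%C <> 0) by (intro E; apply N, Ceq_minus; auto).
    eexists. apply cder_ext with (f := fun w => ((f w - f a) / (w - a))%C) (r := Cmod (z - a)).
    - apply Cmod_gt_0; auto.
    - intros w Hw. rewrite (Hf w). field. intro E. assert (w = a) by (apply Ceq_minus; auto). subst w.
      rewrite Cmod_minus_sym in Hw; lra.
    - apply cder_div; [apply cder_minus; [apply Hl'|apply cder_const]
        |apply cder_minus; [apply cder_id|apply cder_const]|auto]. }
  assert (Hc : forall z, inrect x1 x2 y1 y2 z -> Ccont q z).
  { intros z Hz. destruct (Ceq_dec z a) as [->|N]; auto. destruct (Hd z Hz N); eapply cder_cont; eauto. }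
  assert (Hba : forall z, onb x1 x2 y1 y2 z -> z <> a).
  { intros z Hz ->. unfold onb, inrect in Hz. lra. }
  rewrite (J_ext _ (fun w => q w + f a * / (w - a))%C); try lra.
  - rewrite J_plus; try lra.
    + rewrite J_scal; try lra. rewrite J_winding by auto. rewrite (goursat_punct q a); auto. ring.
      intros z Hz; apply Ccont_kernel; auto.
    + intros z [Hz _]; auto.
    + intros z Hz. apply Ccont_mult; [apply Ccont_const|apply Ccont_kernel; auto].
  - intros z Hz. rewrite (Hf z). field. intro E. apply (Hba z Hz), Ceq_minus; auto.
Qed.

(** Closed balls of the sup norm, used in place of discs because the Cauchy integrals run over
    rectangles and the cells of the grid are squares. *)
Definition insq (a : C) t (z : C) := inrect (fst a - t) (fst a + t) (snd a - t) (snd a + t) z.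
Definition onsq (a : C) t (z : C) := onb (fst a - t) (fst a + t) (snd a - t) (snd a + t) z.
Definition Jsq (F : C -> C) (a : C) t := J F (fst a - t) (fst a + t) (snd a - t) (snd a + t).

Lemma insq_mod a t z : insq a t z -> Cmod (z - a) <= 2 * t.
Proof.
  unfold insq, inrect; intros H. eapply Rle_trans; [apply Cmod_le_re_im|]. simpl.
  assert (Rabs (fst z + - fst a) <= t) by (apply Rabs_le; lra).
  assert (Rabs (snd z + - snd a) <= t) by (apply Rabs_le; lra). lra.
Qed.

Lemma mod_insq a t z : Cmod (z - a) <= t -> insq a t z.
Proof.
  intros H. pose proof (re_le_Cmod (z - a)) as A. pose proof (im_le_Cmod (z - a)) as B. simpl in *.
  assert (A' : Rabs (fst z + - fst a) <= t) by lra. assert (B' : Rabs (snd z + - snd a) <= t) by lra.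
  apply Rabs_le_between in A', B'. unfold insq, inrect; lra.
Qed.

Lemma insq_refl a t : 0 <= t -> insq a t a.
Proof. unfold insq, inrect; lra. Qed.

Lemma insq_mono a s t z : s <= t -> insq a s z -> insq a t z.
Proof. unfold insq, inrect; lra. Qed.

Lemma insq_trans a b s t z : insq a s b -> insq b t z -> insq a (s + t) z.
Proof. unfold insq, inrect; lra. Qed.

Lemma insq_sym a b s : insq a s b -> insq b s a.
Proof. unfold insq, inrect; lra. Qed.

Lemma onsq_insq a t z : onsq a t z -> insq a t z.
Proof. intros [H _]; auto. Qed.

Lemma onsq_far a s t z w : insq a s z -> onsq a t w -> t - s <= Cmod (w - z).
Proof.
  unfold onsq, insq, onb, inrect; intros H [_ K].
  pose proof (re_le_Cmod (w - z)) as A. pose proof (im_le_Cmod (w - z)) as B. simpl in *.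
  pose proof (Rle_abs (fst w + - fst z)). pose proof (Rle_abs (- (fst w + - fst z))).
  pose proof (Rle_abs (snd w + - snd z)). pose proof (Rle_abs (- (snd w + - snd z))).
  rewrite Rabs_Ropp in *. lra.
Qed.

Lemma onsq_kernel a s t z w : s < t -> insq a s z -> onsq a t w ->
  Cmod (/ (w - z)) <= / (t - s) /\ (w - z)%C <> 0.
Proof.
  intros Hs Hz Hw. pose proof (onsq_far _ _ _ _ _ Hz Hw).
  assert ((w - z)%C <> 0) by (apply Cmod_gt_0; lra). split; auto.
  rewrite Cmod_inv by auto. apply Rinv_le_contravar; lra.
Qed.

Lemma cauchy_formula_sq f (a : C) t z : 0 < t -> (forall z, insq a t z -> exists l, cder f z l) ->
  insq a (t/2) z -> Jsq (fun w => f w * / (w - z))%C a t = (tpi * f z)%C.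
Proof.
  intros Ht H [H1 H2]. unfold Jsq. apply cauchy_formula; [lra|lra|exact H].
Qed.

Lemma Jsq_bound F a t M : 0 <= t -> (forall z, onsq a t z -> Ccont F z) ->
  (forall z, onsq a t z -> Cmod (F z) <= M) -> Cmod (Jsq F a t) <= 16 * t * M.
Proof.
  intros Ht HC HM. unfold Jsq.
  replace (16 * t * M) with (4 * ((fst a + t - (fst a - t)) + (snd a + t - (snd a - t))) * M) by ring.
  apply J_bound; auto; lra.
Qed.

(** A lossy maximum principle. On the half-size square the kernel is at most 2/t, so 2 PI |f z| <=
    16 t (2 S / t) = 32 S, which is more than is needed for the factor 16. *)
Lemma sq_bound f a t S z : 0 < t -> (forall z, insq a t z -> exists l, cder f z l) ->
  (forall z, onsq a t z -> Cmod (f z) <= S) -> insq a (t/2) z -> Cmod (f z) <= 16 * S.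
Proof.
  intros Ht H HS Hz.
  assert (E : Jsq (fun w => f w * / (w - z))%C a t = (tpi * f z)%C).
  { apply cauchy_formula_sq; auto. }
  assert (HS0 : 0 <= S).
  { eapply Rle_trans; [apply Cmod_ge_0|apply (HS (fst a + t, snd a))]. unfold onsq, onb, inrect; simpl; lra. }
  assert (K : Cmod (tpi * f z) <= 16 * t * (S * / (t / 2))).
  { rewrite <- E. apply Jsq_bound; [lra| |].
    - intros w Hw. destruct (onsq_kernel a (t/2) t z w ltac:(lra) Hz Hw).
      apply Ccont_mult; [destruct (H w (onsq_insq _ _ _ Hw)); eapply cder_cont; eauto|].
      apply Ccont_kernel. intro E1; subst; apply H1; ring.
    - intros w Hw. destruct (onsq_kernel a (t/2) t z w ltac:(lra) Hz Hw).
      replace (t - t/2) with (t/2) in H0 by field.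
      rewrite Cmod_mult. apply Rmult_le_compat; try apply Cmod_ge_0; auto. }
  rewrite Cmod_mult, Cmod_tpi in K. replace (16 * t * (S * / (t / 2))) with (32 * S) in K by (field; lra).
  pose proof PI_gt_3. pose proof (Cmod_ge_0 (f z)). nra.
Qed.

(** The identity 1/(w-z) - 1/(w-a) = (z-a)/((w-a)(w-z)), integrated against [k]: increments of
    Cauchy integrals are again Cauchy integrals. *)
Lemma cauchy_type_quot k a t z : 0 < t -> (forall z, onsq a t z -> Ccont k z) -> insq a (t/2) z ->
  (Jsq (fun w => k w * / (w - z)) a t - Jsq (fun w => k w * / (w - a)) a t)%C =
  ((z - a) * Jsq (fun w => k w * / (w - a) * / (w - z)) a t)%C.
Proof.
  intros Ht Hk Hz.
  assert (Ha : insq a (t/2) a) by (apply insq_refl; lra).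
  assert (C1 : forall z, insq a (t/2) z -> forall w, onsq a t w -> Ccont (fun w => / (w - z))%C w).
  { intros z' Hz' w Hw. destruct (onsq_kernel a (t/2) t z' w ltac:(lra) Hz' Hw) as [_ N].
    apply Ccont_kernel. intro E; subst; apply N; ring. }
  unfold Jsq.
  rewrite <- J_scal; try lra.
  2:{ intros w Hw. repeat apply Ccont_mult; auto; apply C1; auto. }
  replace (J (fun w => k w * / (w - z))%C (fst a - t) (fst a + t) (snd a - t) (snd a + t)) with
    (J (fun w => k w * / (w - a) + (z - a) * (k w * / (w - a) * / (w - z)))%C (fst a - t) (fst a + t) (snd a - t) (snd a + t)).
  - rewrite J_plus; try lra. ring.
    + intros w Hw. apply Ccont_mult; auto; apply C1; auto.
    + intros w Hw. apply Ccont_mult; [apply Ccont_const|]. repeat apply Ccont_mult; auto; apply C1; auto.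
  - apply J_ext; try lra. intros w Hw.
    destruct (onsq_kernel a (t/2) t z w ltac:(lra) Hz Hw) as [_ N].
    destruct (onsq_kernel a (t/2) t a w ltac:(lra) Ha Hw) as [_ N'].
    field; auto.
Qed.

Lemma cauchy_type_cont k a t M : 0 < t -> (forall z, onsq a t z -> Ccont k z) ->
  (forall z, onsq a t z -> Cmod (k z) <= M) ->
  Ccont (fun z => Jsq (fun w => k w * / (w - z))%C a t) a.
Proof.
  intros Ht Hk HM e He.
  assert (HM0 : 0 <= M).
  { eapply Rle_trans; [apply Cmod_ge_0|apply (HM (fst a + t, snd a))]. unfold onsq, onb, inrect; simpl; lra. }
  assert (Ha : insq a (t/2) a) by (apply insq_refl; lra).
  set (B := 16 * t * (M * / (t/2) * / (t/2)) + 1).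
  assert (HB : 0 < B).
  { unfold B. assert (0 <= 16 * t * (M * / (t/2) * / (t/2))); [|lra].
    assert (0 < / (t/2)) by (apply Rinv_0_lt_compat; lra).
    repeat apply Rmult_le_pos; lra. }
  exists (Rmin (t/2) (e / B)); split; [apply Rmin_pos; [lra|apply Rdiv_lt_0_compat; auto]|].
  intros z Hz. pose proof (Rmin_l (t/2) (e/B)). pose proof (Rmin_r (t/2) (e/B)).
  assert (Hz' : insq a (t/2) z) by (apply mod_insq; lra).
  rewrite cauchy_type_quot; auto. rewrite Cmod_mult.
  assert (Cmod (Jsq (fun w => k w * / (w - a) * / (w - z))%C a t) <= B).
  { apply Rle_trans with (16 * t * (M * / (t/2) * / (t/2))); [|unfold B; lra].
    apply Jsq_bound; [lra| |].
    - intros w Hw. destruct (onsq_kernel a (t/2) t z w ltac:(lra) Hz' Hw) as [_ N].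
      destruct (onsq_kernel a (t/2) t a w ltac:(lra) Ha Hw) as [_ N'].
      repeat apply Ccont_mult; auto; apply Ccont_kernel; intro E; subst; [apply N'|apply N]; ring.
    - intros w Hw. destruct (onsq_kernel a (t/2) t z w ltac:(lra) Hz' Hw) as [N _].
      destruct (onsq_kernel a (t/2) t a w ltac:(lra) Ha Hw) as [N' _].
      replace (t - t/2) with (t/2) in * by field.
      rewrite !Cmod_mult. apply Rmult_le_compat; try apply Cmod_ge_0; auto.
      apply Rmult_le_pos; apply Cmod_ge_0.
      apply Rmult_le_compat; try apply Cmod_ge_0; auto. }
  apply Rle_lt_trans with (Cmod (z - a) * B).
  { apply Rmult_le_compat_l; [apply Cmod_ge_0|auto]. }
  apply Rmult_lt_reg_r with (/ B); [apply Rinv_0_lt_compat; auto|].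
  rewrite Rmult_assoc, Rinv_r, Rmult_1_r by lra. unfold Rdiv in *; lra.
Qed.

(** The difference quotient at the centre is the Cauchy integral with density k(w)/(w - a), so its
    continuity is [cauchy_type_cont] applied to that density. *)
Lemma cauchy_type_cder k a t M : 0 < t -> (forall z, onsq a t z -> Ccont k z) ->
  (forall z, onsq a t z -> Cmod (k z) <= M) ->
  exists l, cder (fun z => Jsq (fun w => k w * / (w - z))%C a t) a l.
Proof.
  intros Ht Hk HM.
  assert (HM0 : 0 <= M).
  { eapply Rle_trans; [apply Cmod_ge_0|apply (HM (fst a + t, snd a))]. unfold onsq, onb, inrect; simpl; lra. }
  assert (Ha : insq a (t/2) a) by (apply insq_refl; lra).
  eexists. apply cder_local with (r := t/2) (q := fun z => Jsq (fun w => k w * / (w - a) * / (w - z))%C a t).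
  - lra.
  - apply (cauchy_type_cont (fun w => k w * / (w - a))%C a t (M * / (t/2))); auto.
    + intros w Hw. destruct (onsq_kernel a (t/2) t a w ltac:(lra) Ha Hw) as [_ N'].
      apply Ccont_mult; auto; apply Ccont_kernel; intro E; subst; apply N'; ring.
    + intros w Hw. destruct (onsq_kernel a (t/2) t a w ltac:(lra) Ha Hw) as [N' _].
      replace (t - t/2) with (t/2) in * by field.
      rewrite !Cmod_mult. apply Rmult_le_compat; try apply Cmod_ge_0; auto.
  - reflexivity.
  - intros w Hw. rewrite <- cauchy_type_quot; auto. ring. apply mod_insq; lra.
Qed.

Lemma opn_insq U a : opn U -> U a -> exists t, 0 < t /\ forall z, insq a t z -> U z.
Proof.
  intros HU Ha. destruct (HU a Ha) as [r [Hr H]]. exists (r/4); split; [lra|].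
  intros z Hz; apply H. apply insq_mod in Hz. lra.
Qed.

(* Off [a], [psi] is the difference quotient; at [a] differentiability comes from writing it as a Cauchy integral. *)
Theorem divide U f a : opn U -> hol U f -> U a ->
  exists psi, hol U psi /\ (forall z, f z = (f a + (z - a) * psi z)%C).
Proof.
  intros HU Hf Ha. destruct (opn_insq U a HU Ha) as [t [Ht Hsq]].
  set (K := fun z => (/ tpi * Jsq (fun w => f w * / (w - a) * / (w - z))%C a t)%C).
  exists (fun z => if excluded_middle_informative (z = a) then K a else ((f z - f a) / (z - a))%C).
  assert (Haa : insq a (t/2) a) by (apply insq_refl; lra).
  assert (Hfc : forall w, onsq a t w -> Ccont f w).
  { intros w Hw; apply (hol_cont U); auto; apply Hsq, onsq_insq; auto. }
  assert (EK : forall z, Cmod (z - a) < t/2 -> z <> a -> K z = ((f z - f a) / (z - a))%C).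
  { intros z Hz N.
    assert (Hz' : insq a (t/2) z) by (apply mod_insq; lra).
    assert (N' : (z - a)%C <> 0) by (intro E; apply N, Ceq_minus; auto).
    assert (E1 : Jsq (fun w => f w * / (w - z))%C a t = (tpi * f z)%C).
    { apply cauchy_formula_sq; auto. }
    assert (E2 : Jsq (fun w => f w * / (w - a))%C a t = (tpi * f a)%C).
    { apply cauchy_formula_sq; auto. }
    pose proof (cauchy_type_quot f a t z Ht Hfc Hz') as Q. rewrite E1, E2 in Q.
    unfold K. pose proof tpi_nz.
    replace (Jsq (fun w => f w * / (w - a) * / (w - z))%C a t) with
      ((z - a) * Jsq (fun w => f w * / (w - a) * / (w - z))%C a t * / (z - a))%C by (field; auto).
    rewrite <- Q. field; auto. }
  split.
  - intros z Hz. destruct (Ceq_dec z a) as [->|N].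
    + destruct (rect_bounded f (fst a - t) (fst a + t) (snd a - t) (snd a + t)) as [M [HM0 HM]]; try lra.
      { intros z' Hz'; apply (hol_cont U); auto. }
      destruct (cauchy_type_cder (fun w => f w * / (w - a))%C a t (M * / (t/2))) as [l Hl]; auto.
      { intros w Hw. destruct (onsq_kernel a (t/2) t a w ltac:(lra) Haa Hw) as [_ N'].
        apply Ccont_mult; auto; apply Ccont_kernel; intro E; subst; apply N'; ring. }
      { intros w Hw. destruct (onsq_kernel a (t/2) t a w ltac:(lra) Haa Hw) as [N' _].
        replace (t - t/2) with (t/2) in * by field.
        rewrite !Cmod_mult. apply Rmult_le_compat; try apply Cmod_ge_0; auto. apply HM, onsq_insq; auto. }
      eexists. eapply cder_ext with (f := K) (r := t/2); [lra| |].
      * intros w Hw. destruct excluded_middle_informative as [->|N]; auto.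
      * apply cder_mult; [apply cder_const|apply Hl].
    + destruct (Hf z Hz) as [l Hl].
      assert (N' : (z - a)%C <> 0) by (intro E; apply N, Ceq_minus; auto).
      eexists. eapply cder_ext with (f := fun z => ((f z - f a) / (z - a))%C) (r := Cmod (z - a)).
      * apply Cmod_gt_0; auto.
      * intros w Hw. destruct excluded_middle_informative as [->|]; auto.
        rewrite Cmod_minus_sym in Hw; lra.
      * apply cder_div; [apply cder_minus; [eauto|apply cder_const]
        |apply cder_minus; [apply cder_id|apply cder_const]|auto].
  - intros z. destruct excluded_middle_informative as [->|N]; [ring|].
    field. intro E; apply N, Ceq_minus; auto.
Qed.

Lemma cder_divide f psi a : Ccont psi a -> (forall z, f z = (f a + (z - a) * psi z)%C) -> cder f a (psi a).
Proof. intros H E. exists psi; auto. Qed.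

(** The derivative at [a] is the value there of the quotient [psi], which is at most 2 S / t on the
    boundary of the square; [sq_bound] contributes the factor 16. *)
Lemma cauchy_estimate f a t S l : 0 < t -> opn (fun z => Cmod (z - a) < 4 * t) ->
  hol (fun z => Cmod (z - a) < 4 * t) f -> (forall z, Cmod (z - a) < 4 * t -> Cmod (f z) <= S) ->
  cder f a l -> Cmod l <= 32 * S / t.
Proof.
  intros Ht HU Hf HS Hl.
  destruct (divide _ f a HU Hf) as [psi [Hp E]]; [rewrite Cmod_refl; lra|].
  assert (Hpa : Ccont psi a) by (apply (hol_cont _ _ _ Hp); rewrite Cmod_refl; lra).
  rewrite (cder_unique _ _ _ _ Hl (cder_divide _ _ _ Hpa E)).
  replace (32 * S / t) with (16 * (2 * S / t)) by (field; lra).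
  apply (sq_bound psi a t); auto.
  - intros z Hz; apply Hp. apply insq_mod in Hz. lra.
  - intros z Hz.
    assert (Hza : Cmod (z - a) < 4 * t) by (apply onsq_insq, insq_mod in Hz; lra).
    destruct (onsq_kernel a 0 t a z Ht (insq_refl a 0 (Rle_refl 0)) Hz) as [A N].
    rewrite Rminus_0_r in A.
    replace (psi z) with ((f z - f a) * / (z - a))%C by (rewrite (E z); field; auto).
    rewrite Cmod_mult. unfold Rdiv. apply Rmult_le_compat; try apply Cmod_ge_0; auto.
    unfold Cminus; eapply Rle_trans; [apply Cmod_triangle|]. rewrite Cmod_opp.
    pose proof (HS z Hza). pose proof (HS a ltac:(rewrite Cmod_refl; lra)). lra.
  - apply insq_refl; lra.
Qed.

(** A total function: where [f] is not differentiable, the value is arbitrary. *)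
Definition deriv (f : C -> C) (z : C) : C :=
  epsilon (inhabits (RtoC 0)) (fun l => cder f z l).

Lemma deriv_spec f z l : cder f z l -> cder f z (deriv f z).
Proof. intros H. unfold deriv. apply epsilon_spec. exists l; auto. Qed.

Lemma deriv_eq f z l : cder f z l -> deriv f z = l.
Proof. intros H. eapply cder_unique; [eapply deriv_spec; eauto|eauto]. Qed.

(* With [f z = f a + (z-a) psi z] one has [f' z = psi z + (z-a) psi' z]; expanding [psi] the same way shows
   that [psi'] is continuous at [a], which is all that differentiability of [f'] at [a] requires. *)
Theorem hol_deriv U f : opn U -> hol U f -> hol U (deriv f).
Proof.
  intros HU Hf a Ha.
  assert (D : forall g, hol U g -> exists psi, hol U psi /\ (forall z, g z = (g a + (z - a) * psi z)%C) /\
    forall z, U z -> deriv g z = (psi z + (z - a) * deriv psi z)%C).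
  { intros g Hg. destruct (divide U g a HU Hg Ha) as [psi [Hp E]]. exists psi; repeat split; auto.
    intros z Hz. apply deriv_eq. destruct (Hp z Hz) as [l Hl].
    rewrite (deriv_eq _ _ _ Hl).
    apply cder_ext with (f := fun z => (g a + (z - a) * psi z)%C) (r := 1); [lra|intros; rewrite <- E; auto|].
    replace (psi z + (z - a) * l)%C with (0 + ((1 - 0) * psi z + (z - a) * l))%C by ring.
    apply cder_plus; [apply cder_const|]. apply (cder_mult (fun w => w - a)%C psi z (1 - 0)%C l); auto.
    apply (cder_minus (fun w => w)); [apply cder_id|apply cder_const]. }
  destruct (D f Hf) as [p1 [Hp1 [E1 D1]]]. destruct (D p1 Hp1) as [p2 [Hp2 [E2 D2]]].
  destruct (D p2 Hp2) as [p3 [Hp3 [E3 D3]]].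
  destruct (HU a Ha) as [r [Hr HUr]].
  assert (Hr4 : forall z, Cmod (z - a) < r -> U z) by auto.
  assert (Hbd : exists M, 0 < M /\ forall z, Cmod (z - a) < r / 8 -> Cmod (deriv p2 z) <= M).
  { destruct (rect_bounded p2 (fst a - r/4) (fst a + r/4) (snd a - r/4) (snd a + r/4)) as [M [HM0 HM]]; try lra.
    { intros z Hz. apply (hol_cont U); auto. apply Hr4. assert (insq a (r/4) z) by auto.
      apply insq_mod in H. lra. }
    exists (32 * M / (r / 32)); split; [apply Rdiv_lt_0_compat; lra|].
    intros z Hz. apply (cauchy_estimate p2 z (r/32) M); [lra|apply opn_disc| | |].
    - intros w Hw. apply Hp2, Hr4. pose proof (Cmod_tri w z a). lra.
    - intros w Hw. apply HM. apply (mod_insq a (r/4)). pose proof (Cmod_tri w z a). lra.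
    - destruct (Hp2 z) as [l Hl]; [apply Hr4; lra|]. eapply deriv_spec; eauto. }
  assert (Cp1 : Ccont (deriv p1) a).
  { destruct Hbd as [M [HM0 HM]].
    apply Ccont_ext with (f := fun z => (p2 z + (z - a) * deriv p2 z)%C) (r := r).
    { auto. } { intros w Hw; rewrite D2; auto. }
    apply Ccont_plus; [apply (hol_cont U); auto|].
    intros e He. exists (Rmin (r/8) (e / M)); split; [apply Rmin_pos; [lra|apply Rdiv_lt_0_compat; auto]|].
    intros w Hw. pose proof (Rmin_l (r/8) (e/M)). pose proof (Rmin_r (r/8) (e/M)).
    replace ((w - a) * deriv p2 w - (a - a) * deriv p2 a)%C with ((w - a) * deriv p2 w)%C by ring.
    rewrite Cmod_mult. apply Rle_lt_trans with (Cmod (w - a) * M).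
    - apply Rmult_le_compat_l; [apply Cmod_ge_0|apply HM; lra].
    - apply Rmult_lt_reg_r with (/ M); [apply Rinv_0_lt_compat; auto|].
      rewrite Rmult_assoc, Rinv_r, Rmult_1_r by lra. unfold Rdiv in *; lra. }
  eexists. apply cder_local with (r := r) (q := fun z => (p2 z + deriv p1 z)%C); auto.
  - apply Ccont_plus; auto. apply (hol_cont U); auto.
  - intros w Hw. rewrite (D1 w (Hr4 w Hw)), (D1 a Ha). rewrite (E2 w). ring.
Qed.

(** * Bounded holomorphic functions and their zeros *)

Fixpoint sep (s : R) (l : list C) : Prop :=
  match l with
  | nil => True
  | z :: l' => (forall w, In w l' -> s <= Cmod (w - z)) /\ sep s l'
  end.

(* Dividing [phi - phi z1] by [z - z1] gains a factor 6/15 between the two squares, of which the bound [2 S] for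
   the difference costs 2. *)
Lemma interp n : forall kap rho s S, 0 < kap -> 0 < rho -> 0 < s -> 0 < S ->
  exists eta, 0 < eta /\ forall a U phi l, opn U -> hol U phi -> (forall z, insq a (16 * rho) z -> U z) ->
    (forall z, onsq a (16 * rho) z -> Cmod (phi z) <= S) ->
    length l = n -> sep s l -> (forall z, In z l -> insq a rho z /\ Cmod (phi z) <= eta) ->
    forall z, insq a (2 * rho) z -> Cmod (phi z) <= kap + 16 * S * (4/5)^n.
Proof.
  induction n; intros kap rho s S Hk Hr Hs HS.
  - exists 1; split; [lra|]. intros a U phi l HU Hp Hsub Hb _ _ _ z Hz. simpl.
    assert (Cmod (phi z) <= 16 * S); [|lra].
    apply (sq_bound phi a (16 * rho)); auto; [lra|].
    eapply insq_mono; [|apply Hz]; lra.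
  - destruct (IHn (kap / (12 * rho)) rho s (2 * S / (15 * rho))) as [eta' [He' IH]]; auto;
    try (apply Rdiv_lt_0_compat; lra).
    set (eta := Rmin S (Rmin (kap / 2) (eta' * s / 2))).
    assert (He : 0 < eta).
    { unfold eta; repeat apply Rmin_pos; try lra. assert (0 < eta' * s) by (apply Rmult_lt_0_compat; auto). lra. }
    assert (E1 : eta <= S) by apply Rmin_l.
    assert (E2 : eta <= kap / 2) by (eapply Rle_trans; [apply Rmin_r|apply Rmin_l]).
    assert (E3 : eta <= eta' * s / 2) by (eapply Rle_trans; [apply Rmin_r|apply Rmin_r]).
    clearbody eta. exists eta; split; auto.
    intros a U phi l HU Hp Hsub Hb Hl Hsep Hz z Hzz.
    destruct l as [|z1 l]; [discriminate|]. simpl in Hl, Hsep. injection Hl as Hl. destruct Hsep as [Hs1 Hs2].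
    destruct (Hz z1 (or_introl eq_refl)) as [Hi1 Hphi1].
    destruct (divide U phi z1 HU Hp) as [psi [Hpsi E]].
    { apply Hsub. eapply insq_mono; [|apply Hi1]; lra. }
    assert (Eq : forall w, w <> z1 -> psi w = ((phi w - phi z1) * / (w - z1))%C).
    { intros w N. rewrite (E w). field. intro T; apply N, Ceq_minus; auto. }
    assert (K : Cmod (psi z) <= kap / (12 * rho) + 16 * (2 * S / (15 * rho)) * (4/5)^n).
    { apply (IH a U psi l); auto.
      - intros w Hw. destruct (onsq_kernel a rho (16 * rho) z1 w ltac:(lra) Hi1 Hw) as [A N].
        rewrite Eq by (intro T; apply N; rewrite T; ring).
        rewrite Cmod_mult. unfold Rdiv. replace (16 * rho - rho) with (15 * rho) in A by ring.
        apply Rmult_le_compat; try apply Cmod_ge_0; auto.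
        unfold Cminus; eapply Rle_trans; [apply Cmod_triangle|]. rewrite Cmod_opp.
        pose proof (Hb w Hw). lra.
      - intros w Hw. destruct (Hz w (or_intror Hw)) as [Hiw Hphiw]. split; auto.
        pose proof (Hs1 w Hw) as Hd.
        assert (N : (w - z1)%C <> 0) by (apply Cmod_gt_0; lra).
        rewrite Eq by (intro T; apply N; rewrite T; ring).
        rewrite Cmod_mult, Cmod_inv by auto.
        apply Rmult_le_reg_r with (Cmod (w - z1)); [lra|].
        rewrite Rmult_assoc, Rinv_l, Rmult_1_r by lra.
        apply Rle_trans with (eta' * s); [|apply Rmult_le_compat_l; lra].
        unfold Cminus; eapply Rle_trans; [apply Cmod_triangle|]. rewrite Cmod_opp. lra. }
    rewrite (E z).
    eapply Rle_trans; [apply Cmod_triangle|]. rewrite Cmod_mult.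
    assert (D : Cmod (z - z1) <= 6 * rho).
    { replace (6 * rho) with (2 * (rho + 2 * rho)) by ring. apply insq_mod.
      apply insq_trans with a; auto. apply insq_sym; auto. }
    assert (Cmod (z - z1) * Cmod (psi z) <= 6 * rho * (kap / (12 * rho) + 16 * (2 * S / (15 * rho)) * (4/5)^n)).
    { apply Rmult_le_compat; try apply Cmod_ge_0; auto. }
    replace (6 * rho * (kap / (12 * rho) + 16 * (2 * S / (15 * rho)) * (4/5)^n)) with
      (kap / 2 + 16 * S * (4/5)^(Datatypes.S n)) in H by (simpl; field; lra).
    lra.
Qed.

Lemma pow_small A q kap : 0 < A -> 0 < q < 1 -> 0 < kap -> exists n, A * q ^ n < kap.
Proof.
  intros HA Hq Hk. destruct (pow_lt_1_zero q ltac:(rewrite Rabs_pos_eq; lra) (kap / A)) as [n Hn].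
  { apply Rdiv_lt_0_compat; auto. }
  exists n. specialize (Hn n (Nat.le_refl n)). rewrite Rabs_pos_eq in Hn by (apply pow_le; lra).
  apply Rmult_lt_compat_l with (r := A) in Hn; auto.
  replace (A * (kap / A)) with kap in Hn by (field; lra). auto.
Qed.

(** Points on the boundaries of concentric squares of half-sides s, 2 s, ..., n s are automatically
    separated by [s]. *)
Lemma nested_points (Q : C -> Prop) a eps n : 0 < eps ->
  (forall t, 0 < t <= eps -> exists z, onsq a t z /\ Q z) ->
  exists l, length l = n /\ sep (eps / (INR n + 1)) l /\ forall z, In z l -> insq a eps z /\ Q z.
Proof.
  intros He H. set (s := eps / (INR n + 1)).
  assert (Hn : 0 < INR n + 1) by (pose proof (pos_INR n); lra).
  assert (Hs : 0 < s) by (apply Rdiv_lt_0_compat; auto).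
  assert (Hs' : s * (INR n + 1) = eps) by (unfold s; field; lra).
  assert (K : forall k, (k <= n)%nat -> exists l, length l = k /\ sep s l /\ forall z, In z l -> insq a (INR k * s) z /\ Q z).
  { induction k; intros Hk.
    - exists nil; simpl; repeat split; tauto.
    - destruct IHk as [l [Hl [Hsep Hz]]]; [lia|].
      assert (INR (S k) <= INR n + 1) by (apply le_INR in Hk; lra).
      assert (0 < INR (S k)) by (apply lt_0_INR; lia).
      destruct (H (INR (S k) * s)) as [z [Hon HQ]].
      { split; [apply Rmult_lt_0_compat; auto|]. rewrite <- Hs', Rmult_comm. apply Rmult_le_compat_l; lra. }
      exists (z :: l). simpl length. split; [lia|]. split.
      + split; auto. intros w Hw. destruct (Hz w Hw) as [Hw1 _].
        pose proof (onsq_far _ _ _ _ _ Hw1 Hon) as F. rewrite Cmod_minus_sym.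
        rewrite S_INR in F. lra.
      + intros w [<-|Hw]; [split; auto; apply onsq_insq; auto|].
        destruct (Hz w Hw) as [Hw1 Hw2]. split; auto. eapply insq_mono; [|apply Hw1].
        rewrite S_INR. lra. }
  destruct (K n (Nat.le_refl n)) as [l [H1 [H2 H3]]]. exists l; split; [|split]; auto.
  intros z Hz. destruct (H3 z Hz) as [H4 H5]; split; auto. eapply insq_mono; [|apply H4]. lra.
Qed.

(* [interp] applied to one point on each of many concentric squares. *)
Lemma small_on_squares kap rho eps S : 0 < kap -> 0 < eps <= rho -> 0 < S ->
  exists eta, 0 < eta /\ forall a U phi, opn U -> hol U phi -> (forall z, insq a (16 * rho) z -> U z) ->
    (forall z, onsq a (16 * rho) z -> Cmod (phi z) <= S) ->
    (forall t, 0 < t <= eps -> exists z, onsq a t z /\ Cmod (phi z) <= eta) ->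
    forall z, insq a (2 * rho) z -> Cmod (phi z) < kap.
Proof.
  intros Hk He HS.
  destruct (pow_small (16 * S) (4/5) (kap/2)) as [n Hn]; try lra.
  assert (Hn1 : 0 < INR n + 1) by (pose proof (pos_INR n); lra).
  destruct (interp n (kap/2) rho (eps / (INR n + 1)) S) as [eta [Heta H]]; try lra.
  { apply Rdiv_lt_0_compat; lra. }
  exists eta; split; auto. intros a U phi HU Hp Hs Hb Hex z Hz.
  destruct (nested_points (fun z => Cmod (phi z) <= eta) a eps n) as [l [L1 [L2 L3]]]; [lra|auto|].
  eapply Rle_lt_trans; [apply (H a U phi l); auto|lra].
  intros w Hw; destruct (L3 w Hw); split; auto. eapply insq_mono; [|eauto]; lra.
Qed.

Lemma onsq_point a t : 0 <= t -> onsq a t (fst a + t, snd a).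
Proof. unfold onsq, onb, inrect; simpl; intros; lra. Qed.

(** A quantitative identity theorem: being tiny on a square forces smallness on the square of twice
    the size. Iterated in [tame_far], it carries smallness over any distance. *)
Lemma smallness_propagates kap rho S : 0 < kap -> 0 < rho -> 0 < S ->
  exists eta, 0 < eta /\ forall a U phi, opn U -> hol U phi -> (forall z, insq a (16 * rho) z -> U z) ->
    (forall z, onsq a (16 * rho) z -> Cmod (phi z) <= S) ->
    (forall z, insq a rho z -> Cmod (phi z) <= eta) ->
    forall z, insq a (2 * rho) z -> Cmod (phi z) < kap.
Proof.
  intros Hk Hr HS. destruct (small_on_squares kap rho rho S) as [eta [He H]]; auto; [lra|].
  exists eta; split; auto. intros a U phi HU Hp Hs Hb Hin z Hz.
  apply (H a U phi); auto. intros t Ht. exists (fst a + t, snd a).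
  assert (onsq a t (fst a + t, snd a)) by (apply onsq_point; lra).
  split; auto. apply Hin. apply onsq_insq in H0. eapply insq_mono; [|apply H0]; lra.
Qed.

(* If [phi] had no zero but a tiny value at [a], the Cauchy bound for [1/phi] would give a tiny value on every small square around [a]. *)
Lemma zero_free_lower_bound c rho eps S : 0 < c -> 0 < eps <= rho -> 0 < S ->
  exists eta, 0 < eta /\ forall a U phi, opn U -> hol U phi -> (forall z, insq a (16 * rho) z -> U z) ->
    (forall z, onsq a (16 * rho) z -> Cmod (phi z) <= S) ->
    (forall z, insq a eps z -> phi z <> 0) ->
    (exists z, insq a (2 * rho) z /\ c <= Cmod (phi z)) -> eta <= Cmod (phi a).
Proof.
  intros Hc He HS. destruct (small_on_squares c rho eps S) as [eta [Het H]]; auto.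
  (* The 17 beats the factor 16 lost in [sq_bound], so that the estimate of 1/phi at the centre
     contradicts itself. *)
  exists (eta / 17); split; [lra|]. intros a U phi HU Hp Hs Hb Hz [z0 [Hz0 Hc0]].
  apply Rnot_lt_le; intro N.
  assert (Cmod (phi z0) < c); [|lra].
  apply (H a U phi); auto. intros t Ht. apply NNPP; intro N1.
  assert (Hin : forall z, insq a t z -> insq a eps z) by (intros; eapply insq_mono; [|eauto]; lra).
  assert (A : 0 < Cmod (phi a)) by (apply Cmod_gt_0, Hz, insq_refl; lra).
  assert (K : Cmod (/ phi a) <= 16 * / (17 * Cmod (phi a))).
  { apply (sq_bound (fun z => / phi z)%C a t); try lra.
    - intros z Hzt. destruct (Hp z) as [l Hl].
      { apply Hs. eapply insq_mono; [|apply Hzt]; lra. }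
      eexists; apply cder_inv; eauto.
    - intros z Hzt. rewrite Cmod_inv by (apply Hz, Hin, onsq_insq; auto).
      apply Rinv_le_contravar; [lra|]. apply Rnot_lt_le; intro N2. apply N1. exists z; split; auto. lra.
    - apply insq_refl; lra. }
  rewrite Cmod_inv in K by (apply Cmod_gt_0; auto).
  apply Rmult_le_compat_r with (r := Cmod (phi a)) in K; [|lra].
  rewrite Rinv_l in K by lra. replace (16 * / (17 * Cmod (phi a)) * Cmod (phi a)) with (16 / 17) in K by (field; lra). lra.
Qed.

(** The monic polynomial with prescribed zeros; [lmult] is its degree. *)
Fixpoint lprod (l : list (C * nat)) (z : C) : C :=
  match l with nil => RtoC 1 | (a, n) :: l' => ((z - a) ^ n * lprod l' z)%C end.

Fixpoint lmult (l : list (C * nat)) : nat :=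
  match l with nil => O | (_, n) :: l' => (n + lmult l')%nat end.

(** The zeros are divided out one at a time. At the other listed points the local form survives,
    because the factor already removed is invertible near them. *)
Lemma factor_zeros U l : opn U -> forall phi, hol U phi -> NoDup (map fst l) ->
  (forall a n, In (a, n) l -> U a /\ exists r h, 0 < r /\ hol (fun z => Cmod (z - a) < r) h /\
     forall z, Cmod (z - a) < r -> phi z = ((z - a) ^ n * h z)%C) ->
  exists psi, hol U psi /\ forall z, U z -> phi z = (lprod l z * psi z)%C.
Proof.
  intros HU. induction l as [|[a n] l IH]; intros phi Hp Hnd H.
  - exists phi; split; auto. intros; simpl; ring.
  - destruct (H a n (or_introl eq_refl)) as [Ha [r [h [Hr [Hh E]]]]].
    simpl in Hnd. inversion Hnd as [|? ? Hni Hnd']; subst.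
    set (psi := fun z => if excluded_middle_informative (z = a) then h a else (phi z / (z - a) ^ n)%C).
    assert (Nz : forall z, z <> a -> ((z - a) ^ n)%C <> 0).
    { intros z N. apply Cpow_nz. intro T; apply N, Ceq_minus; auto. }
    assert (Hpsi : hol U psi).
    { intros z Hz. destruct (Ceq_dec z a) as [->|N].
      - destruct (Hh a) as [l0 Hl0]; [rewrite Cmod_refl; auto|]. exists l0.
        apply cder_ext with (f := h) (r := r); auto.
        intros w Hw. unfold psi. destruct excluded_middle_informative as [->|N]; auto.
        rewrite (E w Hw). field. auto.
      - destruct (Hp z Hz) as [l0 Hl0].
        assert (Hd : hol (fun w => w <> a) (fun w => / (w - a) ^ n)%C).
        { apply hol_inv; auto. apply hol_pow. apply hol_minus; [apply hol_id|apply hol_const]. }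
        destruct (Hd z N) as [l1 Hl1].
        eexists. apply cder_ext with (f := fun w => (phi w * / (w - a) ^ n)%C) (r := Cmod (z - a)).
        + apply Cmod_gt_0. intro T; apply N, Ceq_minus; auto.
        + intros w Hw. unfold psi. destruct excluded_middle_informative as [->|]; auto.
          rewrite Cmod_minus_sym in Hw; lra.
        + apply cder_mult; eauto. }
    assert (Epsi : forall z, Cmod (z - a) < r \/ z <> a -> phi z = ((z - a) ^ n * psi z)%C).
    { intros z Hz. unfold psi. destruct excluded_middle_informative as [->|N].
      - destruct Hz as [Hz|]; [auto|tauto].
      - field. auto. }
    destruct (IH psi Hpsi Hnd') as [ps [Hps Eps]].
    { intros b m Hb. destruct (H b m (or_intror Hb)) as [Hub [rb [hb [Hrb [Hhb Eb]]]]]. split; auto.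
      assert (Nab : b <> a).
      { intros ->. apply Hni. apply in_map_iff. exists (a, m); auto. }
      assert (Hab : 0 < Cmod (b - a)) by (apply Cmod_gt_0; intro T; apply Nab, Ceq_minus; auto).
      assert (Hnb : forall z, Cmod (z - b) < Rmin rb (Cmod (b - a)) -> Cmod (z - b) < rb /\ z <> a).
      { intros z Hz. pose proof (Rmin_l rb (Cmod (b - a))). pose proof (Rmin_r rb (Cmod (b - a))).
        split; [lra|]. intros ->. rewrite Cmod_minus_sym in Hz; lra. }
      exists (Rmin rb (Cmod (b - a))), (fun z => (hb z / (z - a) ^ n)%C). split; [apply Rmin_pos; auto|]. split.
      - apply hol_div.
        + eapply hol_sub; [|apply Hhb]. intros z Hz; apply Hnb; auto.
        + apply hol_pow. apply hol_minus; [apply hol_id|apply hol_const].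
        + intros z Hz. apply Nz. apply Hnb; auto.
      - intros z Hz. destruct (Hnb z Hz) as [Hz1 Hz2]. unfold psi.
        destruct excluded_middle_informative; [tauto|]. rewrite (Eb z Hz1). field. auto. }
    exists ps; split; auto. intros z Hz. simpl. rewrite Epsi, Eps; auto. ring.
    destruct (Ceq_dec z a) as [->|]; auto. left. rewrite Cmod_refl; auto.
Qed.

Lemma lprod_upper l B z : 0 <= B -> (forall a n, In (a, n) l -> Cmod (z - a) <= B) ->
  Cmod (lprod l z) <= B ^ lmult l.
Proof.
  intros HB. induction l as [|[a n] l IH]; intros H; simpl; [rewrite Cmod_1; lra|].
  rewrite Cmod_mult, Cmod_pow, pow_add.
  apply Rmult_le_compat; try apply Cmod_ge_0; [apply pow_le, Cmod_ge_0| |].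
  - apply pow_incr. split; [apply Cmod_ge_0|apply (H a n); simpl; auto].
  - apply IH. intros b m Hb; apply (H b m); simpl; auto.
Qed.

Lemma lprod_lower l B z : 0 <= B -> (forall a n, In (a, n) l -> B <= Cmod (z - a)) ->
  B ^ lmult l <= Cmod (lprod l z).
Proof.
  intros HB. induction l as [|[a n] l IH]; intros H; simpl; [rewrite Cmod_1; lra|].
  rewrite Cmod_mult, Cmod_pow, pow_add.
  apply Rmult_le_compat; try (apply pow_le; auto).
  - apply pow_incr. split; [auto|apply (H a n); simpl; auto].
  - apply IH. intros b m Hb; apply (H b m); simpl; auto.
Qed.

(** A count in the spirit of Jensen. After division by the polynomial of degree [m], which is at
    least (15 rho)^m on the outer square and at most (6 rho)^m at the point where [phi] is large,
    one gets c <= 16 S (2/5)^m. The bound on [m] does not depend on the scale [rho]. *)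
Lemma zero_count c S : 0 < c -> 0 < S -> exists N, forall rho a U phi l, 0 < rho ->
  opn U -> hol U phi -> (forall z, insq a (16 * rho) z -> U z) ->
  (forall z, onsq a (16 * rho) z -> Cmod (phi z) <= S) ->
  (exists z, insq a (2 * rho) z /\ c <= Cmod (phi z)) -> NoDup (map fst l) ->
  (forall b n, In (b, n) l -> insq a rho b /\ exists r h, 0 < r /\ hol (fun z => Cmod (z - b) < r) h /\
     forall z, Cmod (z - b) < r -> phi z = ((z - b) ^ n * h z)%C) -> (lmult l <= N)%nat.
Proof.
  intros Hc HS. destruct (pow_small (16 * S) (2/5) c) as [N HN]; try lra.
  exists N. intros rho a U phi l Hr HU Hp Hs Hb [z0 [Hz0 Hc0]] Hnd H.
  destruct (le_lt_dec (lmult l) N) as [|Hlt]; auto. exfalso.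
  destruct (factor_zeros U l HU phi Hp Hnd) as [psi [Hpsi E]].
  { intros b n Hbn. destruct (H b n Hbn). split; auto. apply Hs. eapply insq_mono; [|eauto]; lra. }
  set (m := lmult l) in *.
  assert (P0 : 0 < (15 * rho) ^ m) by (apply pow_lt; lra).
  assert (K : Cmod (psi z0) <= 16 * (S / (15 * rho) ^ m)).
  { apply (sq_bound psi a (16 * rho)); [lra|auto| |eapply insq_mono; [|apply Hz0]; lra].
    intros z Hz.
    assert (L : (15 * rho) ^ m <= Cmod (lprod l z)).
    { apply lprod_lower; [lra|]. intros b n Hbn. destruct (H b n Hbn) as [Hb1 _].
      pose proof (onsq_far _ _ _ _ _ Hb1 Hz). lra. }
    specialize (Hb z Hz). rewrite (E z) in Hb by (apply Hs, onsq_insq; auto). rewrite Cmod_mult in Hb.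
    apply Rmult_le_reg_r with ((15 * rho) ^ m); auto. unfold Rdiv. rewrite Rmult_assoc, Rinv_l, Rmult_1_r by lra.
    pose proof (Cmod_ge_0 (psi z)). nra. }
  assert (Up : Cmod (lprod l z0) <= (6 * rho) ^ m).
  { apply lprod_upper; [lra|]. intros b n Hbn. destruct (H b n Hbn) as [Hb1 _].
    replace (6 * rho) with (2 * (rho + 2 * rho)) by ring. apply insq_mod.
    apply insq_trans with a; auto. apply insq_sym; auto. }
  assert (F : Cmod (phi z0) <= (6 * rho) ^ m * (16 * (S / (15 * rho) ^ m))).
  { rewrite (E z0) by (apply Hs; eapply insq_mono; [|apply Hz0]; lra). rewrite Cmod_mult.
    apply Rmult_le_compat; auto; apply Cmod_ge_0. }
  assert (G : (6 * rho) ^ m = (2/5) ^ m * (15 * rho) ^ m).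
  { rewrite <- Rpow_mult_distr. f_equal. field. }
  rewrite G in F. replace ((2/5) ^ m * (15 * rho) ^ m * (16 * (S / (15 * rho) ^ m))) with (16 * S * (2/5)^m) in F by (field; lra).
  assert ((2/5)^m <= (2/5)^N).
  { replace m with (N + (m - N))%nat by lia. rewrite pow_add.
    assert (0 < (2/5)^N) by (apply pow_lt; lra).
    assert ((2/5)^(m-N) <= 1) by (rewrite <- (pow1 (m - N)); apply pow_incr; lra). nra. }
  assert (16 * S * (2/5)^m <= 16 * S * (2/5)^N) by (apply Rmult_le_compat_l; lra). lra.
Qed.

(** * From the definitions of the statement to [Cmod], [opn] and [hol] *)

Lemma Cnorm_Cmod (z : C) : Cnorm z = Cmod z.
Proof. unfold Cnorm, Cmod. f_equal. ring. Qed.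

Lemma Defs_Cinv_eq (z : C) : Defs.Cinv z = (/ z)%C.
Proof. unfold Defs.Cinv, Complex.Cinv. simpl. rewrite !Rmult_1_r. reflexivity. Qed.

Lemma Defs_Cpow_eq (z : C) n : Defs.Cpow z n = (z ^ n)%C.
Proof. induction n; [reflexivity|]. change (Defs.Cmul z (Defs.Cpow z n) = (z * z ^ n)%C). rewrite IHn. reflexivity. Qed.

Lemma opn_open_set (U : C -> Prop) : Defs.open_set U <-> opn U.
Proof.
  split; intros H z Hz; destruct (H z Hz) as [r [Hr K]]; exists r; split; auto; intros w Hw; apply K.
  - rewrite Cnorm_Cmod; auto.
  - rewrite <- Cnorm_Cmod; auto.
Qed.

Lemma hol_of_holomorphic_on (U : C -> Prop) (g : C -> C) : holomorphic_on U g -> hol U g.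
Proof.
  intros [HU Hg] z Hz. destruct (Hg z Hz) as [l Hl]. exists l.
  destruct (HU z Hz) as [r [Hr HUr]].
  set (q := fun w => if excluded_middle_informative (w = z) then l else ((g w - g z) / (w - z))%C).
  exists q. split; [|split].
  - intros e He. destruct (Hl (e/2)) as [d [Hd K]]; [lra|].
    exists (Rmin d r); split; [apply Rmin_pos; auto|]. intros w Hw.
    pose proof (Rmin_l d r). pose proof (Rmin_r d r). unfold q.
    destruct (excluded_middle_informative (z = z)); [|tauto].
    destruct excluded_middle_informative as [->|N]; [rewrite Cmod_refl; auto|].
    assert (N' : (w - z)%C <> 0) by (intro T; apply N, Ceq_minus; auto).
    assert (P : 0 < Cmod (w - z)) by (apply Cmod_gt_0; auto).
    specialize (K (w - z)%C). rewrite !Cnorm_Cmod in K.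
    replace (Cadd z (w - z)%C) with w in K by (change (w = z + (w - z))%C; ring).
    specialize (K ltac:(lra)).
    assert (Uw : U w) by (apply HUr; rewrite Cnorm_Cmod; change (Cmod (w - z) < r); lra).
    specialize (K Uw).
    change (Cmod ((g w - g z) - l * (w - z))%C <= e/2 * Cmod (w - z)) in K.
    replace ((g w - g z) / (w - z) - l)%C with (((g w - g z) - l * (w - z)) / (w - z))%C by (field; auto).
    rewrite Cmod_div by auto. apply Rmult_lt_reg_r with (Cmod (w - z)); auto.
    unfold Rdiv. rewrite Rmult_assoc, Rinv_l by lra. nra.
  - unfold q. destruct (excluded_middle_informative (z = z)); tauto.
  - intros w. unfold q. destruct excluded_middle_informative as [->|N]; [ring|].
    field. intro T; apply N, Ceq_minus; auto.
Qed.

(** * The chordal metric *)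

(* Stereographic projection to the unit sphere of [R^3], in which [rhoS] is the Euclidean distance. *)
Definition stereo (u : option C) : C * R :=
  match u with
  | Some z => let D := 1 + (fst z * fst z + snd z * snd z) in
      ((2 * fst z / D, 2 * snd z / D), (fst z * fst z + snd z * snd z - 1) / D)
  | None => (RtoC 0, 1)
  end.

(** The Euclidean distance in three dimensions, nested in this way so that its triangle inequality
    follows from two applications of the one for [Cmod]. *)
Definition norm3 (p q : C * R) : R := Cmod (Cmod (fst p - fst q), snd p - snd q).

Lemma Cmod_sqr z : Cmod z * Cmod z = fst z * fst z + snd z * snd z.
Proof. unfold Cmod. rewrite sqrt_sqrt; [ring|]. nra. Qed.

Lemma norm3_sqr p q : norm3 p q * norm3 p q =
  (fst (fst p) - fst (fst q)) * (fst (fst p) - fst (fst q)) +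
  (snd (fst p) - snd (fst q)) * (snd (fst p) - snd (fst q)) + (snd p - snd q) * (snd p - snd q).
Proof. unfold norm3. rewrite Cmod_sqr. simpl. rewrite Cmod_sqr. simpl. unfold Rminus; ring. Qed.

Lemma norm3_tri p q r : norm3 p r <= norm3 p q + norm3 q r.
Proof.
  unfold norm3.
  set (s1 := Cmod (fst p - fst q)). set (s2 := Cmod (fst q - fst r)).
  apply Rle_trans with (Cmod (s1 + s2, snd p - snd r)).
  - unfold Cmod at 1 3. apply sqrt_le_1_alt. simpl.
    apply Rplus_le_compat_r. rewrite !Rmult_1_r.
    pose proof (Cmod_tri (fst p) (fst q) (fst r)). pose proof (Cmod_ge_0 (fst p - fst r)).
    fold s1 s2 in H. apply Rmult_le_compat; auto.
  - replace (s1 + s2, snd p - snd r) with ((s1, (snd p - snd q)%R) + (s2, (snd q - snd r)%R))%C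
      by (apply injective_projections; simpl; ring).
    apply Cmod_triangle.
Qed.

Lemma sqr_eq_nonneg a b : 0 <= a -> 0 <= b -> a * a = b * b -> a = b.
Proof. intros; apply Rsqr_inj; auto. Qed.

Lemma rhoS_norm3 (u v : option C) : rhoS u v = norm3 (stereo u) (stereo v).
Proof.
  assert (E : forall z : C, Cnorm z ^ 2 = fst z * fst z + snd z * snd z).
  { intros z. rewrite Cnorm_Cmod, <- Cmod_sqr. ring. }
  assert (P : forall z : C, 0 < 1 + (fst z * fst z + snd z * snd z)) by (intros z; nra).
  destruct u as [z|], v as [w|]; unfold rhoS.
  - apply sqr_eq_nonneg; [|apply Cmod_ge_0|].
    + unfold Rdiv. apply Rmult_le_pos; [pose proof (Cmod_ge_0 (Csub z w)); rewrite Cnorm_Cmod; lra|].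
      left; apply Rinv_0_lt_compat, sqrt_lt_R0. rewrite !E. apply Rmult_lt_0_compat; apply P.
    + rewrite norm3_sqr, !E.
      set (Q := (1 + (fst z * fst z + snd z * snd z)) * (1 + (fst w * fst w + snd w * snd w))).
      assert (HQ : 0 < Q) by (apply Rmult_lt_0_compat; apply P).
      replace (2 * Cnorm (Csub z w) / sqrt Q * (2 * Cnorm (Csub z w) / sqrt Q)) with
        (4 * (Cnorm (Csub z w) ^ 2) / (sqrt Q * sqrt Q)) by (field; apply Rgt_not_eq, sqrt_lt_R0; auto).
      rewrite sqrt_sqrt, E by lra. unfold Q. simpl.
      pose proof (P z). pose proof (P w). field. split; lra.
  - apply sqr_eq_nonneg; [|apply Cmod_ge_0|].
    + unfold Rdiv. apply Rmult_le_pos; [lra|]. left; apply Rinv_0_lt_compat, sqrt_lt_R0. rewrite !E. apply P.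
    + rewrite norm3_sqr, !E. pose proof (P z).
      replace (2 / sqrt (1 + (fst z * fst z + snd z * snd z)) * (2 / sqrt (1 + (fst z * fst z + snd z * snd z)))) with
       (4 / (sqrt (1 + (fst z * fst z + snd z * snd z)) * sqrt (1 + (fst z * fst z + snd z * snd z))))
        by (field; apply Rgt_not_eq, sqrt_lt_R0; auto).
      rewrite sqrt_sqrt by lra. simpl. field. lra.
  - apply sqr_eq_nonneg; [|apply Cmod_ge_0|].
    + unfold Rdiv. apply Rmult_le_pos; [lra|]. left; apply Rinv_0_lt_compat, sqrt_lt_R0. rewrite !E. apply P.
    + rewrite norm3_sqr, !E. pose proof (P w).
      replace (2 / sqrt (1 + (fst w * fst w + snd w * snd w)) * (2 / sqrt (1 + (fst w * fst w + snd w * snd w)))) with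
       (4 / (sqrt (1 + (fst w * fst w + snd w * snd w)) * sqrt (1 + (fst w * fst w + snd w * snd w))))
        by (field; apply Rgt_not_eq, sqrt_lt_R0; auto).
      rewrite sqrt_sqrt by lra. simpl. field. lra.
  - apply sqr_eq_nonneg; [lra|apply Cmod_ge_0|]. rewrite norm3_sqr. simpl. ring.
Qed.

Lemma rhoS_tri (u v w : option C) : rhoS u w <= rhoS u v + rhoS v w.
Proof. rewrite !rhoS_norm3. apply norm3_tri. Qed.

Definition oinv (u : option C) : option C :=
  match u with
  | None => Some (RtoC 0)
  | Some v => if Ceq_dec v 0 then None else Some (/ v)%C
  end.

(** Inversion is the half turn of the sphere about its first axis, hence an isometry of [rhoS]. *)
Lemma stereo_oinv u : stereo (oinv u) = ((fst (fst (stereo u)), - snd (fst (stereo u))), - snd (stereo u)).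
Proof.
  destruct u as [[x y]|]; simpl.
  - destruct Ceq_dec as [E|N]; simpl.
    + injection E as -> ->. unfold RtoC. apply injective_projections; simpl; [apply injective_projections; simpl|]; field.
    + assert (0 < x * x + y * y).
      { destruct (Req_dec x 0) as [->|]; [|nra]. destruct (Req_dec y 0) as [->|]; [|nra]. tauto. }
      rewrite !Rmult_1_r.
      apply injective_projections; simpl; [apply injective_projections; simpl|]; field; split; nra.
  - apply injective_projections; simpl; [apply injective_projections; simpl|]; field.
Qed.

Lemma rhoS_oinv (u v : option C) : rhoS (oinv u) (oinv v) = rhoS u v.
Proof.
  rewrite !rhoS_norm3, !stereo_oinv. apply sqr_eq_nonneg; try apply Cmod_ge_0.
  rewrite !norm3_sqr. simpl. ring.
Qed.

(** Heights on the sphere decide: modulus at most 1 means height at most 0, modulus above 2 means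
    height at least 3/5, and the chordal distance dominates the difference of heights. *)
Lemma rhoS_near_small (z : C) (v : option C) : Cmod z <= 1 -> rhoS (Some z) v < 1/2 -> exists w, v = Some w /\ Cmod w <= 2.
Proof.
  intros Hz H. rewrite rhoS_norm3 in H.
  assert (K : snd (stereo v) - snd (stereo (Some z)) < 1/2).
  { eapply Rle_lt_trans; [|apply H]. unfold norm3.
    pose proof (im_le_Cmod (Cmod (fst (stereo (Some z)) - fst (stereo v)), snd (stereo (Some z)) - snd (stereo v))) as T.
    simpl snd in T. eapply Rle_trans; [|apply T]. rewrite Rabs_minus_sym. apply Rle_abs. }
  assert (Z : snd (stereo (Some z)) <= 0).
  { simpl. pose proof (Cmod_ge_0 z). rewrite <- Cmod_sqr.
    apply Rmult_le_reg_r with (1 + Cmod z * Cmod z); [nra|]. unfold Rdiv. rewrite Rmult_assoc, Rinv_l by nra. nra. }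
  destruct v as [w|]; [|simpl in K, Z; lra]. exists w; split; auto.
  apply Rnot_lt_le; intro N. assert (3/5 <= snd (stereo (Some w))); [|lra].
  simpl. rewrite <- Cmod_sqr. apply Rmult_le_reg_r with (1 + Cmod w * Cmod w); [nra|].
  unfold Rdiv at 2. rewrite Rmult_assoc, Rinv_l by nra. nra.
Qed.

Lemma rhoS_le (z w : C) : rhoS (Some z) (Some w) <= 2 * Cmod (z - w).
Proof.
  simpl. rewrite !Cnorm_Cmod. change (Csub z w) with (z - w)%C.
  pose proof (Cmod_ge_0 (z - w)). unfold Rdiv. rewrite <- (Rmult_1_r (2 * Cmod (z - w))) at 2.
  apply Rmult_le_compat_l; [lra|]. rewrite <- Rinv_1. apply Rinv_le_contravar; [lra|].
  rewrite <- sqrt_1 at 1. apply sqrt_le_1_alt.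
  pose proof (pow2_ge_0 (Cmod z)). pose proof (pow2_ge_0 (Cmod w)). nra.
Qed.

(** * Local form of a meromorphic function *)

Definition zpow (z : C) (n : Z) : C :=
  if (0 <=? n)%Z then (z ^ Z.to_nat n)%C else (/ z ^ Z.to_nat (- n))%C.

(** One formula for the three cases of [order_at], with [h] zero-free on the whole disc. The value
    at [a] is stated apart because at a pole the product is a meaningless finite number. *)
Definition locform (f : C -> option C) (a : C) (n : Z) : Prop :=
  exists r h, 0 < r /\ hol (fun z => Cmod (z - a) < r) h /\
    (forall z, Cmod (z - a) < r -> h z <> 0) /\
    (forall z, Cmod (z - a) < r -> z <> a -> f z = Some (zpow (z - a) n * h z)%C) /\
    f a = if (n <? 0)%Z then None else Some (zpow (a - a) n * h a)%C.

Lemma zpow_nz (z : C) n : z <> 0 -> zpow z n <> 0.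
Proof.
  intros H. unfold zpow. destruct (0 <=? n)%Z; [apply Cpow_nz; auto|].
  intro E. assert (T := Cinv_r (z ^ Z.to_nat (- n)) (Cpow_nz _ _ H)). rewrite E in T.
  apply C1_nz. rewrite <- T. ring.
Qed.

Lemma zpow_opp (z : C) n : z <> 0 -> zpow z (- n) = (/ zpow z n)%C.
Proof.
  intros H. unfold zpow. destruct (Z.leb_spec 0 n), (Z.leb_spec 0 (- n)); try lia.
  - replace n with 0%Z by lia. simpl. field.
  - rewrite Z.opp_involutive. auto.
  - field. apply Cpow_nz; auto.
Qed.

Lemma zpow_0_pos n : (0 < n)%Z -> zpow 0 n = 0.
Proof.
  intros H. unfold zpow. destruct (Z.leb_spec 0 n); [|lia].
  destruct (Z.to_nat n) eqn:E; [lia|]. rewrite Cpow_S. ring.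
Qed.

Lemma Csub_self (a : C) : (a - a)%C = 0.
Proof. ring. Qed.

(** The symmetry under which poles become zeros; every later statement about poles is obtained by
    applying it to one about zeros. *)
Lemma locform_oinv f a n : locform f a n -> locform (fun z => oinv (f z)) a (- n).
Proof.
  intros [r [h [Hr [Hh [Hn [Hf Ha]]]]]]. exists r, (fun z => / h z)%C.
  split; [auto|split; [apply hol_inv; auto|split; [|split]]].
  - intros z Hz E. assert (T := Cinv_r (h z) (Hn z Hz)). rewrite E in T. apply C1_nz. rewrite <- T. ring.
  - intros z Hz N. rewrite (Hf z Hz N). unfold oinv.
    assert (N' : (z - a)%C <> 0) by (intro E; apply N, Ceq_minus; auto).
    assert (P := zpow_nz _ n N'). specialize (Hn z Hz).
    destruct Ceq_dec as [E|_]; [exfalso; revert E; apply Cmult_neq_0; auto|].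
    rewrite zpow_opp by auto. f_equal. field. auto.
  - assert (Hna : h a <> 0) by (apply Hn; rewrite Cmod_refl; auto).
    rewrite Ha, Csub_self. destruct (Z.ltb_spec n 0), (Z.ltb_spec (- n) 0); try lia; simpl.
    + rewrite zpow_0_pos by lia. f_equal. ring.
    + rewrite zpow_0_pos by lia. rewrite Cmult_0_l. destruct Ceq_dec; tauto.
    + replace n with 0%Z by lia. unfold zpow; simpl. rewrite !Cmult_1_l.
      destruct Ceq_dec; tauto.
Qed.

Lemma Ccont_zpow_pos a n w : (0 <= n)%Z -> Ccont (fun z => zpow (z - a) n) w.
Proof.
  intros Hn. apply Ccont_ext with (f := fun z => ((z - a) ^ Z.to_nat n)%C) (r := 1); [lra| |].
  - intros z _. unfold zpow. destruct (Z.leb_spec 0 n); [auto|lia].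
  - apply Ccont_pow. apply Ccont_minus; [apply Ccont_id|apply Ccont_const].
Qed.

Lemma locform_rhoS_cont f a n : locform f a n -> forall e, 0 < e -> exists d, 0 < d /\
  forall w, Cmod (w - a) < d -> rhoS (f a) (f w) < e.
Proof.
  assert (K : forall f n, (0 <= n)%Z -> locform f a n -> forall e, 0 < e -> exists d, 0 < d /\
    forall w, Cmod (w - a) < d -> rhoS (f a) (f w) < e).
  { clear f n. intros f n Hn [r [h [Hr [Hh [Hnz [Hf Ha]]]]]] e He.
    destruct (Z.ltb_spec n 0); [lia|].
    assert (Hc : Ccont (fun z => zpow (z - a) n * h z)%C a).
    { apply Ccont_mult; [apply (Ccont_zpow_pos a n a Hn)|]. apply (hol_cont _ _ _ Hh). rewrite Cmod_refl; auto. }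
    destruct (Hc (e/2)) as [d [Hd Hc']]; [lra|].
    exists (Rmin d r); split; [apply Rmin_pos; auto|]. intros w Hw.
    pose proof (Rmin_l d r). pose proof (Rmin_r d r).
    assert (Fw : f w = Some (zpow (w - a) n * h w)%C).
    { destruct (Ceq_dec w a) as [->|N]; [auto|]. apply Hf; auto; lra. }
    rewrite Fw, Ha. eapply Rle_lt_trans; [apply rhoS_le|]. rewrite Cmod_minus_sym.
    specialize (Hc' w ltac:(lra)). cbv beta in Hc'. lra. }
  intros H. destruct (Z.le_gt_cases 0 n); [eapply K; eauto|].
  intros e He. destruct (K (fun z => oinv (f z)) (- n)%Z) with (e := e) as [d [Hd Hw]]; auto; [lia|apply locform_oinv; auto|].
  exists d; split; auto. intros w Hwd. rewrite <- rhoS_oinv. auto.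
Qed.

Lemma hol_disc_nz (a : C) r h : 0 < r -> hol (fun z => Cmod (z - a) < r) h -> h a <> 0 ->
  exists s, 0 < s <= r /\ forall z, Cmod (z - a) < s -> h z <> 0.
Proof.
  intros Hr Hh Ha. destruct (Ccont_nz h a) as [d [Hd H]]; auto.
  { apply (hol_cont _ _ _ Hh). rewrite Cmod_refl; auto. }
  exists (Rmin d r). split; [split; [apply Rmin_pos; auto|apply Rmin_r]|].
  intros z Hz. pose proof (Rmin_l d r). apply Cmod_gt_0. specialize (H z ltac:(lra)).
  pose proof (Cmod_ge_0 (h a)). lra.
Qed.

Lemma holomorphic_disc_hol (a : C) r (h : C -> C) : holomorphic_on (Defs.disc a r) h -> hol (fun z => Cmod (z - a) < r) h.
Proof.
  intros H. apply hol_of_holomorphic_on in H. eapply hol_sub; [|apply H].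
  intros z Hz. unfold Defs.disc. rewrite Cnorm_Cmod. auto.
Qed.

Lemma disc_iff (a z : C) r : Defs.disc a r z <-> Cmod (z - a) < r.
Proof. unfold Defs.disc. rewrite Cnorm_Cmod. reflexivity. Qed.

Lemma order_at_locform (f : C -> option C) (a : C) n : meromorphic f -> order_at f a n -> locform f a n.
Proof.
  intros [_ [M2 _]] [[Hn [r [h [Hr [Hh [Ha Hf]]]]]]|[[Hn [r [h [Hr [Hh [Ha Hf]]]]]]|[-> [H0 HN]]]].
  - apply holomorphic_disc_hol in Hh. destruct (hol_disc_nz a r h Hr Hh Ha) as [s [Hs Hnz]].
    assert (Hf' : forall z, Cmod (z - a) < s -> f z = Some (zpow (z - a) n * h z)%C).
    { intros z Hz. rewrite Hf by (apply disc_iff; lra). unfold zpow. destruct (Z.leb_spec 0 n); [|lia].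
      rewrite Defs_Cpow_eq. reflexivity. }
    exists s, h. split; [lra|]. split; [eapply hol_sub; [|apply Hh]; intros; simpl in *; lra|]. split; [auto|].
    split; [auto|]. destruct (Z.ltb_spec n 0); [lia|]. apply Hf'. rewrite Cmod_refl; lra.
  - apply holomorphic_disc_hol in Hh. destruct (hol_disc_nz a r h Hr Hh Ha) as [s [Hs Hnz]].
    assert (Hf' : forall z, Cmod (z - a) < s -> z <> a -> f z = Some (zpow (z - a) n * h z)%C).
    { intros z Hz N. rewrite Hf by (auto; apply disc_iff; lra). unfold zpow. destruct (Z.leb_spec 0 n); [lia|].
      unfold Defs.Cdiv. rewrite Defs_Cinv_eq, Defs_Cpow_eq. f_equal.
      change (h z * / (z - a) ^ Z.to_nat (- n) = / (z - a) ^ Z.to_nat (- n) * h z)%C. ring. }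
    exists s, h. split; [lra|]. split; [eapply hol_sub; [|apply Hh]; intros; simpl in *; lra|]. split; [auto|].
    split; [auto|]. destruct (Z.ltb_spec n 0); [|lia].
    (* For negative order, [order_at] is silent about the point itself. A finite value there would
       make [f] holomorphic near [a], and then [h a] would vanish by continuity. *)
    destruct (f a) as [v|] eqn:Ev; auto. exfalso.
    destruct (M2 a) as [r1 [g [Hr1 [Hg Hfg]]]]; [congruence|]. apply holomorphic_disc_hol in Hg.
    apply Ha. change (h a = RtoC 0).
    replace (RtoC 0) with ((a - a) ^ Z.to_nat (- n) * g a)%C.
    2:{ rewrite Csub_self. destruct (Z.to_nat (- n)) eqn:E; [lia|]. rewrite Cpow_S. ring. }
    apply (Ccont_eq_off h (fun z => (z - a) ^ Z.to_nat (- n) * g z)%C).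
    + apply (hol_cont _ _ _ Hh). rewrite Cmod_refl; auto.
    + apply Ccont_mult; [apply Ccont_pow; apply Ccont_minus; [apply Ccont_id|apply Ccont_const]|].
      apply (hol_cont _ _ _ Hg). rewrite Cmod_refl; auto.
    + exists (Rmin s r1). split; [apply Rmin_pos; lra|]. intros w N Hw.
      pose proof (Rmin_l s r1). pose proof (Rmin_r s r1).
      assert (E := Hf' w ltac:(lra) N). rewrite Hfg in E by (apply disc_iff; lra). injection E as E. rewrite E.
      unfold zpow. destruct (Z.leb_spec 0 n); [lia|].
      pose (hw := (h w : C)). change (h w) with hw. clearbody hw. field. apply Cpow_nz. intro T; apply N, Ceq_minus; auto.
  - destruct (M2 a HN) as [r [g [Hr [Hg Hfg]]]]. apply holomorphic_disc_hol in Hg.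
    assert (Ha : g a <> RtoC 0).
    { intro E. apply H0. rewrite Hfg, E; auto. apply disc_iff. rewrite Cmod_refl; auto. }
    destruct (hol_disc_nz a r g Hr Hg Ha) as [s [Hs Hnz]].
    assert (Hf' : forall z, Cmod (z - a) < s -> f z = Some (zpow (z - a) 0 * g z)%C).
    { intros z Hz. rewrite Hfg by (apply disc_iff; lra). unfold zpow; simpl. f_equal.
      symmetry. apply Cmult_1_l. }
    exists s, g. split; [lra|]. split; [eapply hol_sub; [|apply Hg]; intros; simpl in *; lra|]. split; [auto|].
    split; [auto|]. simpl. apply Hf'. rewrite Cmod_refl; lra.
Qed.

(** The part of [N1] that the estimates use. Excluding the limit 0 for the inverted function
    excludes the limit infinity for [f]; the 1/2 is the threshold of [rhoS_near_small]. *)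
Definition tame (f : C -> option C) (nu : C -> Z) : Prop :=
  (forall a, locform f a (nu a)) /\
  (exists d, 0 < d /\ forall z w, Cmod (w - z) < d -> rhoS (f z) (f w) < 1/2) /\
  (forall h : nat -> C, ~ unif_conv_compacta (translates f h) (fun _ => Some (RtoC 0))).

(** Otherwise there are pairs of points at distance tending to 0 whose values stay 1/2 apart.
    Translating by the first point of each pair, a Cauchy subsequence is compared with one fixed
    member, which is continuous at its base point: three distances of 1/10 contradict 1/2, and no
    limit function is needed. *)
Lemma normal_equicont (f : C -> option C) (nu : C -> Z) : normal_fn f -> (forall a, locform f a (nu a)) ->
  exists d, 0 < d /\ forall z w, Cmod (w - z) < d -> rhoS (f z) (f w) < 1/2.
Proof.
  intros [_ Hn] Hl. apply NNPP; intro N.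
  assert (K : forall n, exists p : C * C, Cmod (snd p - fst p) < / (INR n + 1) /\ 1/2 <= rhoS (f (fst p)) (f (snd p))).
  { intros n. apply NNPP; intro N1. apply N. exists (/ (INR n + 1)). split.
    { apply Rinv_0_lt_compat. pose proof (pos_INR n); lra. }
    intros z w Hzw. apply Rnot_le_lt; intro Hge. apply N1. exists (z, w); simpl; auto. }
  set (p := fun n => proj1_sig (constructive_indefinite_description _ (K n))).
  assert (Hp : forall n, Cmod (snd (p n) - fst (p n)) < / (INR n + 1) /\ 1/2 <= rhoS (f (fst (p n))) (f (snd (p n)))).
  { intros n; unfold p; destruct constructive_indefinite_description; auto. }
  destruct (Hn (fun n => fst (p n))) as [phi [Hphi HC]].
  destruct (HC 1 (1/10)) as [N0 HN0]; try lra.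
  destruct (locform_rhoS_cont f _ _ (Hl (fst (p (phi N0)))) (1/10)) as [d [Hd Hcont]]; [lra|].
  assert (Hge : forall n, (n <= phi n)%nat) by (induction n; [lia|specialize (Hphi n); lia]).
  destruct (archimed_cor1 (Rmin d 1)) as [m [Hm1 Hm2]]; [apply Rmin_pos; lra|].
  set (n := (N0 + m)%nat).
  destruct (Hp (phi n)) as [H1 H2].
  assert (Hsm : Cmod (snd (p (phi n)) - fst (p (phi n))) < Rmin d 1).
  { eapply Rlt_trans; [apply H1|]. eapply Rle_lt_trans; [|apply Hm1].
    apply Rinv_le_contravar; [apply lt_0_INR; auto|].
    assert (INR m <= INR (phi n)) by (apply le_INR; specialize (Hge n); unfold n in *; lia). lra. }
  pose proof (Rmin_l d 1). pose proof (Rmin_r d 1).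
  set (u := (snd (p (phi n)) - fst (p (phi n)))%C) in *.
  assert (A1 := HN0 n N0 ltac:(unfold n; lia) ltac:(lia) (RtoC 0) ltac:(rewrite Cnorm_Cmod, Cmod_0; lra)).
  assert (A2 := HN0 N0 n ltac:(lia) ltac:(unfold n; lia) u ltac:(rewrite Cnorm_Cmod; lra)).
  unfold translates in A1, A2.
  replace (Cadd (RtoC 0) (fst (p (phi n)))) with (fst (p (phi n))) in A1 by (change (fst (p (phi n)) = 0 + fst (p (phi n)))%C; ring).
  replace (Cadd (RtoC 0) (fst (p (phi N0)))) with (fst (p (phi N0))) in A1 by (change (fst (p (phi N0)) = 0 + fst (p (phi N0)))%C; ring).
  replace (Cadd u (fst (p (phi n)))) with (snd (p (phi n))) in A2 by (change (snd (p (phi n)) = u + fst (p (phi n)))%C; unfold u; ring).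
  assert (A3 := Hcont (Cadd u (fst (p (phi N0))))).
  replace (Cadd u (fst (p (phi N0))) - fst (p (phi N0)))%C with u in A3
    by (change (u = (u + fst (p (phi N0))) - fst (p (phi N0)))%C; ring).
  specialize (A3 ltac:(lra)).
  pose proof (rhoS_tri (f (fst (p (phi n)))) (f (fst (p (phi N0)))) (f (snd (p (phi n))))).
  pose proof (rhoS_tri (f (fst (p (phi N0)))) (f (Cadd u (fst (p (phi N0))))) (f (snd (p (phi n))))).
  lra.
Qed.

Lemma N1_tame (f : C -> option C) (nu : C -> Z) : N1 f -> is_divisor f nu ->
  tame f nu /\ tame (fun z => oinv (f z)) (fun z => (- nu z)%Z).
Proof.
  intros [Hnf HN] Hd.
  assert (Hl : forall a, locform f a (nu a)) by (intros a; apply order_at_locform; [apply Hnf|apply Hd]).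
  destruct (normal_equicont f nu Hnf Hl) as [d [Hd0 Heq]].
  split; (split; [|split]).
  - auto.
  - exists d; auto.
  - intros h H. apply (HN h _ H). exists (Some (RtoC 0)); auto.
  - intros a; apply locform_oinv; auto.
  - exists d; split; auto. intros z w Hw. rewrite rhoS_oinv; auto.
  - intros h H. apply (HN h (fun _ => None)); [|exists None; auto].
    intros R e HR He. destruct (H R e HR He) as [N HNn]. exists N. intros n Hn z Hz.
    specialize (HNn n Hn z Hz). unfold translates in *. rewrite <- rhoS_oinv. simpl oinv at 2. auto.
Qed.

(** * Uniform bounds for the divisor and the logarithmic derivative *)

(** The default value at poles never enters an estimate: the bounds are taken only at points where
    [f] is finite. *)
Definition valf (f : C -> option C) (z : C) : C := match f z with Some v => v | None => RtoC 0 end.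

Definition small_at (f : C -> option C) (a : C) (B : R) : Prop := exists v, f a = Some v /\ Cmod v <= B.

Lemma hol_valf_at f nu z v : (forall a, locform f a (nu a)) -> f z = Some v ->
  (0 <= nu z)%Z /\ exists r h, 0 < r /\ hol (fun w => Cmod (w - z) < r) h /\ (forall w, Cmod (w - z) < r -> h w <> 0) /\
    forall w, Cmod (w - z) < r -> valf f w = ((w - z) ^ Z.to_nat (nu z) * h w)%C.
Proof.
  intros Hl Hv. destruct (Hl z) as [r [h [Hr [Hh [Hn [Hf Ha]]]]]].
  assert (Hnu : (0 <= nu z)%Z).
  { destruct (Z.ltb_spec (nu z) 0); [congruence|auto]. }
  split; auto. exists r, h. repeat split; auto. intros w Hw.
  destruct (Z.ltb_spec (nu z) 0); [lia|].
  assert (E : f w = Some (zpow (w - z) (nu z) * h w)%C) by (destruct (Ceq_dec w z) as [->|N]; auto).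
  unfold valf. rewrite E. unfold zpow. destruct (Z.leb_spec 0 (nu z)); [auto|lia].
Qed.

Lemma hol_valf f nu U : (forall a, locform f a (nu a)) -> (forall z, U z -> exists v, f z = Some v) -> hol U (valf f).
Proof.
  intros Hl HU z Hz. destruct (HU z Hz) as [v Hv].
  destruct (hol_valf_at f nu z v Hl Hv) as [_ [r [h [Hr [Hh [_ E]]]]]].
  destruct (Hh z) as [l Hlz]; [rewrite Cmod_refl; auto|].
  destruct (hol_pow (fun w => Cmod (w - z) < r) (fun w => w - z)%C (Z.to_nat (nu z))
     (hol_minus _ _ _ (hol_id _) (hol_const _ _)) z) as [m Hm]; [rewrite Cmod_refl; auto|].
  eexists. eapply cder_ext with (f := fun w => ((w - z) ^ Z.to_nat (nu z) * h w)%C) (r := r); auto.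
  - intros w Hw; rewrite E; auto.
  - apply cder_mult; eauto.
Qed.

(** Equicontinuity spreads a value of modulus at most 1 to the bound 2 on a disc of fixed radius, so
    there are no poles there. At every point, [f] or its inverse satisfies the hypothesis. *)
Lemma tame_disc f nu d a : (forall a, locform f a (nu a)) ->
  (forall z w, Cmod (w - z) < d -> rhoS (f z) (f w) < 1/2) -> small_at f a 1 ->
  (forall z, Cmod (z - a) < d -> small_at f z 2) /\ hol (fun z => Cmod (z - a) < d) (valf f) /\
  (forall z, Cmod (z - a) < d -> Cmod (valf f z) <= 2).
Proof.
  intros Hl He [v [Hv Hv1]].
  assert (K : forall z, Cmod (z - a) < d -> small_at f z 2).
  { intros z Hz. specialize (He a z Hz). rewrite Hv in He. apply rhoS_near_small in He; auto. }
  split; auto. split.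
  - apply hol_valf with nu; auto. intros z Hz. destruct (K z Hz) as [w [Hw _]]; eauto.
  - intros z Hz. destruct (K z Hz) as [w [Hw Hw2]]. unfold valf; rewrite Hw; auto.
Qed.

(** The condition 32 rho < d places the square of half-side 16 rho, on which the interpolation
    bounds need a holomorphic function, inside the disc of [tame_disc]. *)
Lemma disc_insq rho d a z t : 0 < rho -> 32 * rho < d -> t <= 16 * rho -> insq a t z -> Cmod (z - a) < d.
Proof. intros Hr Hd Ht Hz. apply insq_mod in Hz. lra. Qed.

Lemma small_valf f a B : small_at f a B -> Cmod (valf f a) <= B.
Proof. intros [v [Hv H]]. unfold valf; rewrite Hv; auto. Qed.

Lemma Cadd_sub (z w : C) : (Cadd z w - w)%C = z.
Proof. change ((z + w - w)%C = z). ring. Qed.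

Section Tame.
Variables (f : C -> option C) (nu : C -> Z) (d rho : R).
Hypothesis Hl : forall a, locform f a (nu a).
Hypothesis He : forall z w, Cmod (w - z) < d -> rhoS (f z) (f w) < 1/2.
Hypothesis Ht : forall h : nat -> C, ~ unif_conv_compacta (translates f h) (fun _ => Some (RtoC 0)).
Hypothesis Hr : 0 < rho.
Hypothesis Hd : 32 * rho < d.

Lemma tame_step kap : 0 < kap -> exists eta, 0 < eta /\ forall a, (forall z, insq a rho z -> small_at f z eta) ->
  forall z, insq a (2 * rho) z -> small_at f z kap.
Proof.
  intros Hk. destruct (smallness_propagates kap rho 2) as [eta [Het H]]; auto; [lra|].
  exists (Rmin eta 1). split; [apply Rmin_pos; lra|]. intros a Ha z Hz.
  pose proof (Rmin_l eta 1). pose proof (Rmin_r eta 1).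
  destruct (tame_disc f nu d a Hl He) as [K1 [K2 K3]].
  { destruct (Ha a) as [v [Hv Hv1]]; [apply insq_refl; lra|]. exists v; split; auto; lra. }
  assert (Hin : forall z, insq a (16 * rho) z -> Cmod (z - a) < d)
    by (intros; apply (disc_insq rho d a z0 (16 * rho)); auto; lra).
  destruct (K1 z) as [v [Hv _]]; [apply Hin; eapply insq_mono; [|apply Hz]; lra|].
  exists v; split; auto.
  assert (T : Cmod (valf f z) < kap); [|unfold valf in T; rewrite Hv in T; lra].
  apply (H a (fun z => Cmod (z - a) < d) (valf f)); auto.
  - apply opn_disc.
  - intros w Hw; apply K3, Hin, onsq_insq; auto.
  - intros w Hw. eapply Rle_trans; [apply small_valf, Ha; auto|auto].
Qed.

(** Squares of fixed size are chained, because the bound 2 for [f] is available only near points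
    where [f] is already known to be small and must be renewed by [tame_step] at each new centre. *)
Lemma tame_far k : forall kap, 0 < kap -> exists eta, 0 < eta /\ forall a, (forall z, insq a rho z -> small_at f z eta) ->
  forall z, insq a ((INR k + 1) * rho) z -> small_at f z kap.
Proof.
  induction k; intros kap Hk.
  - exists kap; split; auto. intros a Ha z Hz. apply Ha. simpl in Hz. rewrite Rplus_0_l, Rmult_1_l in Hz. auto.
  - destruct (tame_step kap Hk) as [e1 [He1 H1]]. destruct (IHk e1 He1) as [e2 [He2 H2]].
    exists e2; split; auto. intros a Ha z Hz.
    (* The fraction puts [b] on the segment from [a] to [z] so that the square of half-side [rho]
       around [b] lies in the region already reached, while [z] is within 2 rho of [b]. *)
    set (th := INR k / (INR k + 2)). pose proof (pos_INR k) as P.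
    assert (Hth : th * (INR k + 2) = INR k) by (unfold th; field; lra).
    assert (Hth0 : 0 <= th) by (unfold th, Rdiv; apply Rmult_le_pos; [lra|left; apply Rinv_0_lt_compat; lra]).
    assert (Hth1 : th <= 1) by nra.
    set (b := (fst a + th * (fst z - fst a), snd a + th * (snd z - snd a))).
    rewrite S_INR in Hz.
    assert (Hb : insq a (INR k * rho) b).
    { unfold insq, inrect in *. unfold b; cbn [fst snd].
      replace (INR k * rho) with (th * ((INR k + 1 + 1) * rho)) by (rewrite <- Hth at 2; ring).
      set (T := (INR k + 1 + 1) * rho) in *.
      repeat split; nra. }
    apply (H1 b).
    + intros w Hw. apply (H2 a); auto. replace ((INR k + 1) * rho) with (INR k * rho + rho) by ring.
      eapply insq_trans; eauto.
    + unfold insq, inrect in *. unfold b; cbn [fst snd].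
      assert (E : 2 * rho = (1 - th) * ((INR k + 1 + 1) * rho)).
      { replace ((1 - th) * ((INR k + 1 + 1) * rho)) with ((INR k + 2) * rho - th * (INR k + 2) * rho) by ring.
        rewrite Hth. ring. }
      rewrite E. set (T := (INR k + 1 + 1) * rho) in *. repeat split; nra.
Qed.

(** If [f] were at most 1/(n+1) on squares around some centres a_n, the translates by a_n would tend
    to 0 on every compact set by [tame_far]. It is here that the excluded constant limits are
    used. *)
Lemma tame_nontrivial : exists c, 0 < c /\ forall a, small_at f a 1 -> exists z, insq a (2 * rho) z /\ c <= Cmod (valf f z).
Proof.
  apply NNPP; intro N.
  assert (K : forall n : nat, exists a, forall z, insq a rho z -> small_at f z (/ (INR n + 1))).
  { intros n. apply NNPP; intro N1. apply N. exists (/ (INR n + 1)).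
    split; [apply Rinv_0_lt_compat; pose proof (pos_INR n); lra|].
    intros a Ha. apply NNPP; intro N2. apply N1. exists a. intros z Hz.
    destruct (tame_disc f nu d a Hl He Ha) as [K1 _].
    destruct (K1 z) as [v [Hv _]].
    { apply (disc_insq rho d a z rho); auto; lra. }
    exists v; split; auto. apply Rnot_lt_le; intro N3. apply N2. exists z; split.
    - eapply insq_mono; [|apply Hz]; lra.
    - unfold valf; rewrite Hv; lra. }
  set (h := fun n => proj1_sig (constructive_indefinite_description _ (K n))).
  assert (Hh : forall n z, insq (h n) rho z -> small_at f z (/ (INR n + 1))).
  { intros n; unfold h; destruct constructive_indefinite_description; auto. }
  apply (Ht h). intros R0 e HR0 Hee.
  destruct (INR_unbounded (R0 / rho)) as [k Hk].
  destruct (tame_far k (e/4)) as [eta [Het H]]; [lra|].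
  destruct (archimed_cor1 eta Het) as [N0 [HN0 HN0']].
  exists N0. intros n Hn z Hz. rewrite Cnorm_Cmod in Hz.
  assert (S : small_at f (Cadd z (h n)) (e/4)).
  { apply (H (h n)).
    - intros w Hw. destruct (Hh n w Hw) as [v [Hv Hv1]]. exists v; split; auto.
      eapply Rle_trans; [apply Hv1|]. left. eapply Rle_lt_trans; [|apply HN0].
      apply le_INR in Hn. assert (0 < INR N0) by (apply lt_0_INR; auto). apply Rinv_le_contravar; lra.
    - apply mod_insq. replace (Cadd z (h n) - h n)%C with (z : C) by (symmetry; apply Cadd_sub).
      assert (R0 / rho * rho = R0) by (field; lra). nra. }
  unfold translates. destruct S as [v [Hv Hv1]]. rewrite Hv.
  eapply Rle_lt_trans; [apply rhoS_le|]. replace (v - RtoC 0)%C with v by ring. lra.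
Qed.

Fixpoint nsum (l : list C) : nat := match l with nil => O | b :: l' => (Z.abs_nat (nu b) + nsum l')%nat end.

(** On the disc of [tame_disc] there are no poles, so all orders are nonnegative and absolute values
    of orders are multiplicities of zeros, as [zero_count] requires. *)
Lemma tame_count : exists N, forall a, small_at f a 1 -> forall l, NoDup l ->
  (forall b, In b l -> insq a rho b) -> (nsum l <= N)%nat.
Proof.
  destruct tame_nontrivial as [c [Hc Hnt]].
  destruct (zero_count c 2) as [N HN]; try lra. exists N. intros a Ha l Hnd Hin.
  destruct (tame_disc f nu d a Hl He Ha) as [K1 [K2 K3]].
  replace (nsum l) with (lmult (map (fun b => (b, Z.abs_nat (nu b))) l)).
  2:{ clear. induction l; simpl; auto. }
  assert (Hin16 : forall t z, t <= 16 * rho -> insq a t z -> Cmod (z - a) < d)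
    by (intros; eapply (disc_insq rho d); eauto).
  apply (HN rho a (fun z => Cmod (z - a) < d) (valf f)); auto.
  - apply opn_disc.
  - intros z Hz; eapply Hin16; eauto; lra.
  - intros z Hz; apply K3. apply onsq_insq in Hz. eapply Hin16; eauto; lra.
  - rewrite map_map. simpl. rewrite map_id. auto.
  - intros b n Hb. apply in_map_iff in Hb. destruct Hb as [b' [E Hb']]. injection E as -> <-.
    split; auto. destruct (K1 b) as [v [Hv _]]; [eapply Hin16; [|eauto]; lra|].
    destruct (hol_valf_at f nu b v Hl Hv) as [Hp [r [h [Hr' [Hh [_ E]]]]]].
    exists r, h. repeat split; auto. intros z Hz. rewrite E by auto. do 2 f_equal. lia.
Qed.

Definition logderiv (z : C) : C := (deriv (valf f) z / valf f z)%C.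

(** The Cauchy estimate bounds the numerator, and [zero_free_lower_bound] bounds the denominator
    from below since no divisor point is near. *)
Lemma tame_logderiv_bound eps : 0 < eps -> exists B, 0 < B /\ forall w, small_at f w 1 ->
  (forall b, insq w eps b -> nu b = 0%Z) -> Cmod (logderiv w) <= B.
Proof.
  intros Heps. destruct tame_nontrivial as [c [Hc Hnt]].
  set (e := Rmin eps rho). assert (E0 : 0 < e) by (apply Rmin_pos; auto).
  assert (E1 : e <= eps) by apply Rmin_l. assert (E2 : e <= rho) by apply Rmin_r.
  destruct (zero_free_lower_bound c rho e 2) as [eta [Het HL]]; try lra.
  exists (32 * 2 / (d / 4) / eta). split.
  { unfold Rdiv. repeat apply Rmult_lt_0_compat; try apply Rinv_0_lt_compat; lra. }
  intros w Hw Hz. destruct (tame_disc f nu d w Hl He Hw) as [K1 [K2 K3]].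
  assert (Hin16 : forall t z, t <= 16 * rho -> insq w t z -> Cmod (z - w) < d)
    by (intros; eapply (disc_insq rho d); eauto).
  assert (Hlow : eta <= Cmod (valf f w)).
  { apply (HL w (fun z => Cmod (z - w) < d) (valf f)); auto.
    - apply opn_disc.
    - intros z Hzz; eapply Hin16; eauto; lra.
    - intros z Hzz; apply K3. apply onsq_insq in Hzz. eapply Hin16; eauto; lra.
    - intros z Hzz. destruct (K1 z) as [v [Hv _]]; [eapply Hin16; [|eauto]; lra|].
      destruct (hol_valf_at f nu z v Hl Hv) as [_ [r [h [Hr' [Hh [Hn E]]]]]].
      rewrite E by (rewrite Cmod_refl; auto). rewrite Hz by (eapply insq_mono; [|eauto]; lra).
      simpl. rewrite Cmult_1_l. apply Hn. rewrite Cmod_refl; auto. }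
  assert (Hder : Cmod (deriv (valf f) w) <= 32 * 2 / (d / 4)).
  { apply (cauchy_estimate (valf f) w (d/4) 2); [lra|apply opn_disc| | |].
    - eapply hol_sub; [|apply K2]. intros; simpl in *; lra.
    - intros z Hzz; apply K3; lra.
    - destruct (K2 w) as [l0 Hl0]; [rewrite Cmod_refl; lra|]. eapply deriv_spec; eauto. }
  unfold logderiv. assert (valf f w <> 0) by (apply Cmod_gt_0; lra).
  rewrite Cmod_div by auto. unfold Rdiv at 1 2. apply Rmult_le_compat; auto; try apply Cmod_ge_0.
  - left; apply Rinv_0_lt_compat; lra.
  - apply Rinv_le_contravar; auto.
Qed.

End Tame.

(** * Principal parts of the logarithmic derivative *)

Lemma cder_pow_shift (a w : C) n : w <> a -> cder (fun z => (z - a) ^ n)%C w (INR n * (w - a) ^ n / (w - a))%C.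
Proof.
  intros N. assert (N' : (w - a)%C <> 0) by (intro E; apply N, Ceq_minus; auto).
  induction n.
  - replace (INR 0 * (w - a) ^ 0 / (w - a))%C with (RtoC 0) by (simpl; field; auto).
    exact (cder_const 1 w).
  - apply cder_ext with (f := fun z => ((z - a) * (z - a) ^ n)%C) (r := 1); [lra|intros; rewrite Cpow_S; auto|].
    replace (INR (S n) * (w - a) ^ S n / (w - a))%C with ((1 - 0) * (w - a) ^ n + (w - a) * (INR n * (w - a) ^ n / (w - a)))%C.
    + apply (cder_mult (fun z => z - a)%C (fun z => (z - a) ^ n)%C w (1 - 0)%C); auto.
      apply (cder_minus (fun w => w)); [apply cder_id|apply cder_const].
    + rewrite S_INR, RtoC_plus, Cpow_S. field. auto.
Qed.

Lemma cder_zpow_shift (a w : C) n : w <> a -> cder (fun z => zpow (z - a) n)%C w (IZR n * zpow (w - a) n / (w - a))%C.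
Proof.
  intros N. assert (N' : (w - a)%C <> 0) by (intro E; apply N, Ceq_minus; auto).
  unfold zpow. destruct (Z.leb_spec 0 n).
  - replace (IZR n) with (INR (Z.to_nat n)) by (rewrite INR_IZR_INZ, Z2Nat.id; auto). apply cder_pow_shift; auto.
  - replace (IZR n) with (- INR (Z.to_nat (- n))) by (rewrite INR_IZR_INZ, <- opp_IZR; f_equal; lia). rewrite RtoC_opp.
    set (m := Z.to_nat (- n)).
    assert (P : ((w - a) ^ m)%C <> 0) by (apply Cpow_nz; auto).
    replace (- INR m * / (w - a) ^ m / (w - a))%C with
     (- (INR m * (w - a) ^ m / (w - a)) / ((w - a) ^ m * (w - a) ^ m))%C by (field; auto).
    apply (cder_inv (fun z => (z - a) ^ m)%C); auto. apply cder_pow_shift; auto.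
Qed.

Lemma deriv_ext f g z r : 0 < r -> hol (fun w => Cmod (w - z) < r) g ->
  (forall w, Cmod (w - z) < r -> f w = g w) -> deriv f z = deriv g z.
Proof.
  intros Hr Hg E. destruct (Hg z) as [l Hl]; [rewrite Cmod_refl; auto|].
  rewrite (deriv_eq _ _ _ Hl). apply deriv_eq. apply cder_ext with (f := g) (r := r); auto.
  intros; symmetry; auto.
Qed.

(** From f = (z - a)^n h one gets f'/f = n/(z - a) + h'/h. The alternative [n = 0] makes the formula
    valid at the centre too when [a] is not in the divisor. *)
Lemma logderiv_local f a n : locform f a n ->
  exists r H, 0 < r /\ hol (fun z => Cmod (z - a) < r) H /\
   forall w, Cmod (w - a) < r -> w <> a \/ n = 0%Z -> logderiv f w = (IZR n * / (w - a) + H w)%C.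
Proof.
  intros [r [h [Hr [Hh [Hn [Hf Ha]]]]]]. exists r, (fun z => deriv h z / h z)%C.
  split; auto. split.
  { apply hol_div; auto. apply hol_deriv; auto. apply opn_disc. }
  intros w Hw Hc. unfold logderiv.
  assert (Hdh : cder h w (deriv h w)) by (destruct (Hh w Hw) as [l Hl]; eapply deriv_spec; eauto).
  destruct (Ceq_dec w a) as [->|N].
  - destruct Hc as [|E]; [tauto|]. subst n.
    assert (E : forall z, Cmod (z - a) < r -> valf f z = h z).
    { intros z Hz. unfold valf. destruct (Ceq_dec z a) as [->|N].
      - rewrite Ha. unfold zpow; simpl. ring.
      - rewrite Hf; auto. unfold zpow; simpl. ring. }
    rewrite (deriv_ext (valf f) h a r); auto. rewrite E by auto. rewrite Cmult_0_l. ring.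
  - assert (N' : (w - a)%C <> 0) by (intro E; apply N, Ceq_minus; auto).
    pose proof (zpow_nz _ n N') as P. pose proof (Hn w Hw) as Q.
    assert (D : cder (valf f) w ((IZR n * zpow (w - a) n / (w - a)) * h w + zpow (w - a) n * deriv h w)%C).
    { apply cder_ext with (f := fun z => (zpow (z - a) n * h z)%C) (r := Rmin (r - Cmod (w - a)) (Cmod (w - a))).
      - apply Rmin_pos; [lra|apply Cmod_gt_0; auto].
      - intros z Hz. pose proof (Rmin_l (r - Cmod (w - a)) (Cmod (w - a))). pose proof (Rmin_r (r - Cmod (w - a)) (Cmod (w - a))).
        pose proof (Cmod_tri z w a). unfold valf. rewrite Hf; auto; [lra|].
        intros ->. rewrite Cmod_minus_sym in Hz. lra.
      - apply (cder_mult (fun z => zpow (z - a) n)); auto. apply cder_zpow_shift; auto. }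
    rewrite (deriv_eq _ _ _ D). unfold valf. rewrite Hf by auto. field. auto.
Qed.

Lemma logderiv_oinv f n w : locform f w n -> n = 0%Z -> logderiv (fun z => oinv (f z)) w = (- logderiv f w)%C.
Proof.
  intros [r [h [Hr [Hh [Hn [Hf Ha]]]]]] ->. unfold logderiv.
  assert (E : forall z, Cmod (z - w) < r -> f z = Some (h z)).
  { intros z Hz. destruct (Ceq_dec z w) as [->|N].
    - rewrite Ha. unfold zpow; simpl. f_equal; ring.
    - rewrite Hf; auto. unfold zpow; simpl. f_equal; ring. }
  assert (E1 : forall z, Cmod (z - w) < r -> valf f z = h z) by (intros; unfold valf; rewrite E; auto).
  assert (E2 : forall z, Cmod (z - w) < r -> valf (fun z => oinv (f z)) z = (/ h z)%C).
  { intros z Hz; unfold valf; rewrite E by auto. simpl. specialize (Hn z Hz). destruct Ceq_dec; tauto. }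
  assert (W : Cmod (w - w) < r) by (rewrite Cmod_refl; auto).
  rewrite E1, E2 by auto.
  rewrite (deriv_ext (valf f) h w r), (deriv_ext (valf (fun z => oinv (f z))) (fun z => / h z)%C w r); auto.
  2:{ apply hol_inv; auto. }
  destruct (Hh w W) as [l Hl]. specialize (Hn w W).
  rewrite (deriv_eq _ _ _ Hl), (deriv_eq _ _ _ (cder_inv _ _ _ Hl Hn)). field; auto.
Qed.

Lemma small_or_inv u : (exists v, u = Some v /\ Cmod v <= 1) \/ (exists v, oinv u = Some v /\ Cmod v <= 1).
Proof.
  destruct u as [v|].
  - destruct (Rle_dec (Cmod v) 1); [left; eauto|]. right. simpl.
    destruct Ceq_dec as [->|N]; [rewrite Cmod_0 in n; lra|]. eexists; split; eauto.
    rewrite Cmod_inv by auto. rewrite <- Rinv_1. apply Rinv_le_contravar; lra.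
  - right. simpl. eexists; split; eauto. rewrite Cmod_0; lra.
Qed.

(** All that the contour argument needs to know; [L] stands for f'/f and [f] itself no longer
    occurs. *)
Definition regular (nu : C -> Z) (L : C -> C) (rho : R) (N : nat) : Prop :=
  0 < rho /\
  (forall a l, NoDup l -> (forall b, In b l -> insq a rho b) -> (nsum nu l <= N)%nat) /\
  (forall eps, 0 < eps -> exists B, 0 < B /\ forall w, (forall b, insq w eps b -> nu b = 0%Z) -> Cmod (L w) <= B) /\
  (forall a, exists r H, 0 < r /\ hol (fun z => Cmod (z - a) < r) H /\
     forall w, Cmod (w - a) < r -> w <> a \/ nu a = 0%Z -> L w = (IZR (nu a) * / (w - a) + H w)%C).

Lemma nsum_opp nu l : nsum (fun z => (- nu z)%Z) l = nsum nu l.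
Proof. induction l; simpl; auto. rewrite IHl. f_equal. lia. Qed.

Theorem N1_regular (f : Cx -> option Cx) (nu : Cx -> Z) : N1 f -> is_divisor f nu ->
  exists rho N, regular nu (logderiv f) rho N.
Proof.
  intros HN Hdiv. destruct (N1_tame f nu HN Hdiv) as [[T1 [[d1 [Hd1 T2]] T3]] [S1 [[d2 [Hd2 S2]] S3]]].
  (* Dividing by 33 gives the strict inequality 32 rho < d for [f] and for its inverse. *)
  set (rho := Rmin d1 d2 / 33).
  assert (Hm : 0 < Rmin d1 d2) by (apply Rmin_pos; auto).
  pose proof (Rmin_l d1 d2). pose proof (Rmin_r d1 d2).
  assert (Hr : 0 < rho) by (unfold rho; lra).
  assert (R1 : 32 * rho < d1) by (unfold rho; lra). assert (R2 : 32 * rho < d2) by (unfold rho; lra).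
  destruct (tame_count f nu d1 rho T1 T2 T3 Hr R1) as [N1 H1].
  destruct (tame_count _ _ d2 rho S1 S2 S3 Hr R2) as [N2 H2].
  exists rho, (Nat.max N1 N2). split; [auto|split; [|split]].
  - intros a l Hnd Hin. destruct (small_or_inv (f a)) as [Ha|Ha].
    + specialize (H1 a Ha l Hnd Hin). lia.
    + specialize (H2 a Ha l Hnd Hin). rewrite nsum_opp in H2. lia.
  - intros eps He.
    destruct (tame_logderiv_bound f nu d1 rho T1 T2 T3 Hr R1 eps He) as [B1 [HB1 K1]].
    destruct (tame_logderiv_bound _ _ d2 rho S1 S2 S3 Hr R2 eps He) as [B2 [HB2 K2]].
    (* At each point [f] or its inverse has modulus at most 1, and the two logarithmic derivatives
       differ only in sign; the sum covers both cases. *)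
    exists (B1 + B2). split; [lra|]. intros w Hw. destruct (small_or_inv (f w)) as [Ha|Ha].
    + specialize (K1 w Ha Hw). lra.
    + specialize (K2 w Ha ltac:(intros b Hb; simpl; rewrite Hw; auto)).
      rewrite (logderiv_oinv f (nu w) w (T1 w)) in K2; [rewrite Cmod_opp in K2; lra|]. apply Hw, insq_refl; lra.
  - intros a. apply logderiv_local, T1.
Qed.

(** * Finite sums and residues in a rectangle *)

Fixpoint csumL {X} (l : list X) (f : X -> C) : C :=
  match l with nil => RtoC 0 | x :: l' => (f x + csumL l' f)%C end.
Fixpoint rsumL {X} (l : list X) (f : X -> R) : R :=
  match l with nil => 0 | x :: l' => f x + rsumL l' f end.

Lemma csumL_ext {X} (l : list X) f g : (forall x, In x l -> f x = g x) -> csumL l f = csumL l g.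
Proof. induction l; simpl; auto. intros H. rewrite H, IHl; auto. Qed.
Lemma csumL_plus {X} (l : list X) f g : csumL l (fun x => f x + g x)%C = (csumL l f + csumL l g)%C.
Proof. induction l; simpl; [ring|]. rewrite IHl; ring. Qed.
Lemma csumL_scal {X} (l : list X) c f : csumL l (fun x => c * f x)%C = (c * csumL l f)%C.
Proof. induction l; simpl; [ring|]. rewrite IHl; ring. Qed.
Lemma csumL_minus {X} (l : list X) f g : csumL l (fun x => f x - g x)%C = (csumL l f - csumL l g)%C.
Proof. induction l; simpl; [ring|]. rewrite IHl; ring. Qed.
Lemma csumL_0 {X} (l : list X) : csumL l (fun _ => RtoC 0) = 0.
Proof. induction l; simpl; [auto|]. rewrite IHl; ring. Qed.
Lemma csumL_swap {X Y} (l : list X) (m : list Y) f :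
  csumL l (fun x => csumL m (fun y => f x y)) = csumL m (fun y => csumL l (fun x => f x y)).
Proof.
  induction l; simpl; [symmetry; apply csumL_0|]. rewrite IHl, csumL_plus. auto.
Qed.
Lemma csumL_app {X} (l m : list X) f : csumL (l ++ m) f = (csumL l f + csumL m f)%C.
Proof. induction l; simpl; [ring|]. rewrite IHl; ring. Qed.
Lemma csumL_map {X Y} (h : X -> Y) l f : csumL (map h l) f = csumL l (fun x => f (h x)).
Proof. induction l; simpl; auto. rewrite IHl; auto. Qed.
Lemma csumL_prod {X Y} (l : list X) (m : list Y) f :
  csumL (list_prod l m) f = csumL l (fun x => csumL m (fun y => f (x, y))).
Proof. induction l; simpl; auto. rewrite csumL_app, csumL_map, IHl. auto. Qed.
Lemma Cmod_csumL {X} (l : list X) f : Cmod (csumL l f) <= rsumL l (fun x => Cmod (f x)).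
Proof.
  induction l; simpl; [rewrite Cmod_0; lra|]. eapply Rle_trans; [apply Cmod_triangle|]. lra.
Qed.
Lemma csumL_R {X} (l : list X) f : csumL l (fun x => RtoC (f x)) = RtoC (rsumL l f).
Proof. induction l; simpl; auto. rewrite IHl, RtoC_plus; auto. Qed.

Lemma rsumL_le {X} (l : list X) f g : (forall x, In x l -> f x <= g x) -> rsumL l f <= rsumL l g.
Proof.
  induction l; simpl; [lra|]. intros H. pose proof (H a (or_introl eq_refl)).
  specialize (IHl (fun x Hx => H x (or_intror Hx))). lra.
Qed.
Lemma rsumL_ext {X} (l : list X) f g : (forall x, In x l -> f x = g x) -> rsumL l f = rsumL l g.
Proof. induction l; simpl; auto. intros H. rewrite H, IHl; auto. Qed.
Lemma rsumL_plus {X} (l : list X) f g : rsumL l (fun x => f x + g x) = rsumL l f + rsumL l g.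
Proof. induction l; simpl; [ring|]. rewrite IHl; ring. Qed.
Lemma rsumL_scal {X} (l : list X) c f : rsumL l (fun x => c * f x) = c * rsumL l f.
Proof. induction l; simpl; [ring|]. rewrite IHl; ring. Qed.
Lemma rsumL_0 {X} (l : list X) : rsumL l (fun _ => 0) = 0.
Proof. induction l; simpl; lra. Qed.
Lemma rsumL_swap {X Y} (l : list X) (m : list Y) f :
  rsumL l (fun x => rsumL m (fun y => f x y)) = rsumL m (fun y => rsumL l (fun x => f x y)).
Proof. induction l; simpl; [symmetry; apply rsumL_0|]. rewrite IHl, rsumL_plus. auto. Qed.
Lemma rsumL_nonneg {X} (l : list X) f : (forall x, In x l -> 0 <= f x) -> 0 <= rsumL l f.
Proof. intros H. rewrite <- (rsumL_0 l). apply rsumL_le; auto. Qed.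

Definition zr (T : nat) : list Z := map (fun k => Z.of_nat k - Z.of_nat T)%Z (seq 0 (2 * T + 1)).
Definition box (T : nat) : list (Z * Z) := list_prod (zr T) (zr T).

Lemma in_zr T i : In i (zr T) <-> (- Z.of_nat T <= i <= Z.of_nat T)%Z.
Proof.
  unfold zr. rewrite in_map_iff. split.
  - intros [k [<- Hk]]. apply in_seq in Hk. lia.
  - intros H. exists (Z.to_nat (i + Z.of_nat T)). rewrite in_seq. lia.
Qed.

Lemma NoDup_zr T : NoDup (zr T).
Proof. apply Injective_map_NoDup; [intros x y; lia|apply seq_NoDup]. Qed.

Lemma in_box T p : In p (box T) <-> (- Z.of_nat T <= fst p <= Z.of_nat T)%Z /\ (- Z.of_nat T <= snd p <= Z.of_nat T)%Z.
Proof. destruct p as [i j]. unfold box. rewrite in_prod_iff, !in_zr. reflexivity. Qed.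

Lemma NoDup_list_prod' {X Y} (l : list X) (m : list Y) : NoDup l -> NoDup m -> NoDup (list_prod l m).
Proof.
  intros Hl Hm. induction Hl as [|x l Hx Hl IH]; simpl; [constructor|].
  apply NoDup_app; auto.
  - apply Injective_map_NoDup; auto. intros a b E; injection E; auto.
  - intros [a b] H1 H2. apply in_map_iff in H1. destruct H1 as [y [E _]]. injection E as -> ->.
    apply in_prod_iff in H2. tauto.
Qed.

Lemma NoDup_box T : NoDup (box T).
Proof. apply NoDup_list_prod'; apply NoDup_zr. Qed.

Lemma csumL_seq_shift f n : forall s c, csumL (map (fun k => Z.of_nat k - c)%Z (seq s n)) (fun i => f (i + 1)%Z) =
  (csumL (map (fun k => Z.of_nat k - c)%Z (seq s n)) f + f (Z.of_nat (s + n) - c)%Z - f (Z.of_nat s - c)%Z)%C.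
Proof.
  induction n; intros s c; simpl.
  - rewrite Nat.add_0_r. ring.
  - rewrite IHn. replace (Z.of_nat s - c + 1)%Z with (Z.of_nat (S s) - c)%Z by lia.
    replace (S s + n)%nat with (s + S n)%nat by lia. ring.
Qed.

Lemma csumL_zr_shift f T : f (Z.of_nat T + 1)%Z = RtoC 0 -> f (- Z.of_nat T)%Z = RtoC 0 ->
  csumL (zr T) (fun i => f (i + 1)%Z) = csumL (zr T) f.
Proof.
  intros H1 H2. unfold zr. rewrite csumL_seq_shift.
  replace (Z.of_nat (0 + (2 * T + 1)) - Z.of_nat T)%Z with (Z.of_nat T + 1)%Z by lia.
  replace (Z.of_nat 0 - Z.of_nat T)%Z with (- Z.of_nat T)%Z by lia. rewrite H1, H2. ring.
Qed.

(** Summation by parts in the plane: every edge is shared by two cells with opposite signs and so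
    collects the difference of [chi] across it. As [chi] vanishes on the outermost layer of the box
    and beyond, there are no boundary terms. *)
Lemma abel_box T (chi H V : Z * Z -> C) :
  (forall p, ~ In p (box (T - 1)) -> chi p = 0) -> (1 <= T)%nat ->
  csumL (box T) (fun p => chi p * (H p + V (fst p + 1, snd p)%Z - H (fst p, snd p + 1)%Z - V p))%C =
  csumL (box T) (fun p => (chi p - chi (fst p, snd p - 1)%Z) * H p + (chi (fst p - 1, snd p)%Z - chi p) * V p)%C.
Proof.
  intros Hchi HT.
  assert (Z0 : forall i j, (Z.abs i >= Z.of_nat T \/ Z.abs j >= Z.of_nat T)%Z -> chi (i, j) = RtoC 0).
  { intros i j Hij. apply Hchi. rewrite in_box. simpl. lia. }
  rewrite (csumL_ext _ _ (fun p => (chi p * H p - chi p * H (fst p, snd p + 1)%Z) + (chi p * V (fst p + 1, snd p)%Z - chi p * V p))%C)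
    by (intros; ring).
  rewrite (csumL_ext _ (fun p => (chi p - _) * H p + _)%C (fun p => (chi p * H p - chi (fst p, snd p - 1)%Z * H p) + (chi (fst p - 1, snd p)%Z * V p - chi p * V p))%C)
    by (intros; ring).
  rewrite !csumL_plus, !csumL_minus.
  replace (csumL (box T) (fun p => chi p * H (fst p, snd p + 1)%Z)%C) with (csumL (box T) (fun p => chi (fst p, snd p - 1)%Z * H p)%C).
  replace (csumL (box T) (fun p => chi p * V (fst p + 1, snd p)%Z)%C) with (csumL (box T) (fun p => chi (fst p - 1, snd p)%Z * V p)%C).
  reflexivity.
  - unfold box. rewrite !csumL_prod, (csumL_swap (zr T)), (csumL_swap (zr T) (zr T) (fun x y => chi (x, y) * V (fst (x, y) + 1, snd (x, y))%Z)%C).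
    apply csumL_ext. intros j _. cbn [fst snd].
    rewrite <- (csumL_zr_shift (fun i => chi (i - 1, j)%Z * V (i, j))%C).
    + apply csumL_ext. intros i _. replace (i + 1 - 1)%Z with i by ring. reflexivity.
    + rewrite Z0; [ring|lia].
    + rewrite Z0; [ring|lia].
  - unfold box. rewrite !csumL_prod. apply csumL_ext. intros i _. cbn [fst snd].
    rewrite <- (csumL_zr_shift (fun j => chi (i, j - 1)%Z * H (i, j))%C).
    + apply csumL_ext. intros j _. replace (j + 1 - 1)%Z with j by ring. reflexivity.
    + rewrite Z0; [ring|lia].
    + rewrite Z0; [ring|lia].
Qed.

Lemma rsumL_box_shift T (G : Z * Z -> R) : (1 <= T)%nat -> (forall p, ~ In p (box (T - 1)) -> G p = 0) ->
  rsumL (box T) (fun p => G (fst p, snd p - 1)%Z) = rsumL (box T) G /\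
  rsumL (box T) (fun p => G (fst p - 1, snd p)%Z) = rsumL (box T) G.
Proof.
  intros HT HG.
  assert (Z0 : forall i j, (Z.abs i >= Z.of_nat T \/ Z.abs j >= Z.of_nat T)%Z -> G (i, j) = 0).
  { intros i j Hij. apply HG. rewrite in_box. simpl. lia. }
  split; apply RtoC_inj; rewrite <- !csumL_R; unfold box; rewrite !csumL_prod.
  - apply csumL_ext; intros i _; cbn [fst snd].
    rewrite <- (csumL_zr_shift (fun j => RtoC (G (i, j - 1)%Z))).
    + apply csumL_ext. intros j _. replace (j + 1 - 1)%Z with j by ring. reflexivity.
    + rewrite Z0; [auto|lia].
    + rewrite Z0; [auto|lia].
  - rewrite (csumL_swap (zr T)), (csumL_swap (zr T) (zr T) (fun x y => RtoC (G (x, y)))).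
    apply csumL_ext; intros j _; cbn [fst snd].
    rewrite <- (csumL_zr_shift (fun i => RtoC (G (i - 1, j)%Z))).
    + apply csumL_ext. intros i _. replace (i + 1 - 1)%Z with i by ring. reflexivity.
    + rewrite Z0; [auto|lia].
    + rewrite Z0; [auto|lia].
Qed.

Lemma csumL_indicator {X} (dec : forall x y : X, {x = y} + {x <> y}) (l : list X) (x : X) (f : X -> C) : NoDup l ->
  csumL l (fun y => if dec x y then f y else RtoC 0) = if in_dec dec x l then f x else RtoC 0.
Proof.
  induction 1 as [|y l Hy Hl IH]; simpl; auto. rewrite IH.
  destruct (dec x y) as [->|N].
  - destruct (dec y y); [|congruence]. destruct (in_dec dec y l); [tauto|]. ring.
  - destruct (dec y x); [congruence|]. destruct (in_dec dec x l); ring.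
Qed.

Lemma rsumL_indicator {X} (dec : forall x y : X, {x = y} + {x <> y}) (l : list X) (x : X) (f : X -> R) : NoDup l ->
  rsumL l (fun y => if dec x y then f y else 0) = if in_dec dec x l then f x else 0.
Proof.
  induction 1 as [|y l Hy Hl IH]; simpl; auto. rewrite IH.
  destruct (dec x y) as [->|N].
  - destruct (dec y y); [|congruence]. destruct (in_dec dec y l); [tauto|]. ring.
  - destruct (dec y x); [congruence|]. destruct (in_dec dec x l); ring.
Qed.

Definition ifP {X} (P : Prop) (a b : X) : X := if excluded_middle_informative P then a else b.

Lemma hol_at_sub (F : C -> C) (b w : C) r h : hol (fun z => Cmod (z - b) < r) h -> Cmod (w - b) < r ->
  (forall z, Cmod (z - w) < r - Cmod (w - b) -> F z = h z) -> exists l, cder F w l.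
Proof.
  intros Hh Hw E. destruct (Hh w Hw) as [l Hl]. exists l.
  apply cder_ext with (f := h) (r := r - Cmod (w - b)); auto; [lra|]. intros; symmetry; auto.
Qed.

Lemma J_kernel_outside (b : C) x1 x2 y1 y2 : x1 < x2 -> y1 < y2 -> ~ inrect x1 x2 y1 y2 b ->
  J (fun w => / (w - b))%C x1 x2 y1 y2 = 0.
Proof.
  intros Hx Hy N. apply goursat; auto. intros z Hz.
  assert (z <> b) by (intros ->; auto).
  eexists. apply cder_inv; [apply cder_minus; [apply cder_id|apply cder_const]|].
  intro E; apply H, Ceq_minus; auto.
Qed.

(** Residue theorem for simple poles, by subtracting one polar part at a time and redefining the
    function at the pole. Listed points outside [A] are allowed; they lie outside the rectangle and
    contribute 0. *)
Lemma residue_rect (A : C -> Prop) (c : C -> C) x1 x2 y1 y2 : x1 < x2 -> y1 < y2 ->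
  (forall z, inrect x1 x2 y1 y2 z -> A z) ->
  forall (Ls : list C) F, NoDup Ls -> (forall b, In b Ls -> ~ onb x1 x2 y1 y2 b) ->
  (forall b, A b -> exists r h, 0 < r /\ hol (fun z => Cmod (z - b) < r) h /\
     forall w, Cmod (w - b) < r -> w <> b \/ ~ In b Ls -> F w = (ifP (In b Ls) (c b) 0 * / (w - b) + h w)%C) ->
  J F x1 x2 y1 y2 = (tpi * csumL Ls (fun b => ifP (inrect x1 x2 y1 y2 b) (c b) (RtoC 0)))%C.
Proof.
  intros Hx Hy HA Ls. induction Ls as [|b Ls IH]; intros F Hnd Hon HF.
  - simpl. rewrite goursat; auto; [ring|]. intros z Hz. destruct (HF z (HA z Hz)) as [r [h [Hr [Hh E]]]].
    apply (hol_at_sub F z z r h); auto; [rewrite Cmod_refl; auto|]. intros w Hw. rewrite Cmod_refl, Rminus_0_r in Hw.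
    rewrite E; auto. unfold ifP. destruct excluded_middle_informative; [tauto|]. ring.
  - inversion Hnd as [|? ? Hb Hnd']; subst. cbn [csumL].
    destruct (classic (A b)) as [Hab|Hab].
    + destruct (HF b Hab) as [rb [hb [Hrb [Hhb Eb]]]].
      unfold ifP in Eb at 1. destruct excluded_middle_informative as [_|n]; [|exfalso; apply n; simpl; auto].
      set (F1 := fun w => if excluded_middle_informative (w = b) then hb b else (F w - c b * / (w - b))%C).
      assert (F1b : forall w, Cmod (w - b) < rb -> F1 w = hb w).
      { intros w Hw. unfold F1. destruct excluded_middle_informative as [->|N]; auto. rewrite Eb by auto. ring. }
      assert (J1 : J F1 x1 x2 y1 y2 = (tpi * csumL Ls (fun b => ifP (inrect x1 x2 y1 y2 b) (c b) (RtoC 0)))%C).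
      { apply IH; auto; [intros; apply Hon; simpl; auto|].
        intros a Ha. destruct (Ceq_dec a b) as [->|N].
        - exists rb, hb. repeat split; auto. intros w Hw _. unfold ifP.
          destruct excluded_middle_informative; [tauto|]. rewrite F1b; auto. ring.
        - destruct (HF a Ha) as [r [h [Hr [Hh E]]]].
          assert (Pab : 0 < Cmod (a - b)) by (apply Cmod_gt_0; intro T; apply N, Ceq_minus; auto).
          exists (Rmin r (Cmod (a - b))), (fun w => h w - c b * / (w - b))%C.
          assert (Hnb : forall w, Cmod (w - a) < Rmin r (Cmod (a - b)) -> Cmod (w - a) < r /\ w <> b).
          { intros w Hw. pose proof (Rmin_l r (Cmod (a - b))). pose proof (Rmin_r r (Cmod (a - b))).
            split; [lra|]. intros ->. rewrite Cmod_minus_sym in Hw; lra. }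
          split; [apply Rmin_pos; auto|]. split.
          + apply hol_minus; [eapply hol_sub; [|apply Hh]; intros w Hw; apply Hnb; auto|].
            apply hol_mult; [apply hol_const|]. apply hol_inv; [apply hol_minus; [apply hol_id|apply hol_const]|].
            intros w Hw. apply Hnb in Hw. intro T; apply Hw, Ceq_minus; auto.
          + intros w Hw Hc. destruct (Hnb w Hw) as [Hw1 Hw2]. unfold F1.
            destruct excluded_middle_informative; [tauto|]. rewrite E; auto.
            * replace (ifP (In a (b :: Ls)) (c a) 0) with (ifP (In a Ls) (c a) 0); [ring|].
              unfold ifP. simpl. repeat destruct excluded_middle_informative; auto; exfalso; intuition congruence.
            * destruct Hc as [|Hc]; auto. right. simpl. intros [|]; [congruence|tauto]. }
      assert (Cb : bcont (fun w => c b * / (w - b))%C x1 x2 y1 y2).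
      { intros z Hz. apply Ccont_mult; [apply Ccont_const|apply Ccont_kernel]. intros ->. apply (Hon b); simpl; auto. }
      assert (C1 : bcont F1 x1 x2 y1 y2).
      { intros z Hz. assert (N : z <> b) by (intros ->; apply (Hon b); simpl; auto).
        assert (Nz : ~ In z (b :: Ls)) by (intro T; apply (Hon z); auto).
        destruct (HF z (HA z (proj1 Hz))) as [r [h [Hr [Hh E]]]].
        apply Ccont_ext with (f := fun w => (h w - c b * / (w - b))%C) (r := Rmin r (Cmod (z - b))).
        - apply Rmin_pos; auto. apply Cmod_gt_0; intro T; apply N, Ceq_minus; auto.
        - intros w Hw. pose proof (Rmin_l r (Cmod (z - b))). pose proof (Rmin_r r (Cmod (z - b))).
          unfold F1. destruct excluded_middle_informative as [->|]; [rewrite Cmod_minus_sym in Hw; lra|].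
          rewrite E; [|lra|auto]. unfold ifP. destruct excluded_middle_informative; [tauto|]. ring.
        - apply Ccont_minus; [apply (hol_cont _ _ _ Hh); rewrite Cmod_refl; auto|apply Cb; auto]. }
      rewrite (J_ext F (fun w => F1 w + c b * / (w - b))%C); try lra.
      2:{ intros z Hz. unfold F1. destruct excluded_middle_informative as [->|]; [|ring]. exfalso; apply (Hon b); simpl; auto. }
      rewrite J_plus; auto; try lra. rewrite J1. rewrite J_scal; try lra.
      2:{ intros z Hz. apply Ccont_kernel. intros ->. apply (Hon b); simpl; auto. }
      unfold ifP at 2. destruct excluded_middle_informative as [Hin|Hout].
      * rewrite J_winding; [ring| |]; assert (T := Hon b (or_introl eq_refl)); unfold onb, inrect in *;
        split; apply Rnot_le_lt; intro; apply T; split; auto; lra.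
      * rewrite J_kernel_outside; auto. ring.
    + rewrite (IH F); auto.
      * unfold ifP at 2. destruct excluded_middle_informative as [Hin|]; [exfalso; auto|]. ring.
      * intros; apply Hon; simpl; auto.
      * intros a Ha. assert (N : a <> b) by (intros ->; auto).
        destruct (HF a Ha) as [r [h [Hr [Hh E]]]]. exists r, h. repeat split; auto. intros w Hw Hc. rewrite E; auto.
        -- replace (ifP (In a (b :: Ls)) (c a) 0) with (ifP (In a Ls) (c a) 0); [ring|].
           unfold ifP. simpl. repeat destruct excluded_middle_informative; auto; exfalso; intuition congruence.
        -- destruct Hc as [|Hc]; auto. right. simpl. intros [|]; [congruence|tauto].
Qed.

(** * The grid *)

(** Chebyshev distance of indices: closed cells touch exactly when it is at most 1. *)
Definition cd (p q : Z * Z) : Z := Z.max (Z.abs (fst p - fst q)) (Z.abs (snd p - snd q)).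

Lemma ZZ_dec (p q : Z * Z) : {p = q} + {p <> q}.
Proof. decide equality; apply Z.eq_dec. Qed.

Section Grid.
Variables (e u v : R).
Hypothesis He : 0 < e.

Definition gx (i : Z) : R := u + IZR i * e.
Definition gy (j : Z) : R := v + IZR j * e.
Definition cell (p : Z * Z) (z : C) : Prop :=
  inrect (gx (fst p)) (gx (fst p + 1)) (gy (snd p)) (gy (snd p + 1)) z.
Definition cof (z : C) : Z * Z := (Int_part ((fst z - u) / e), Int_part ((snd z - v) / e)).

Lemma floor_ge c a x : c + IZR a * e <= x -> (a <= Int_part ((x - c) / e))%Z.
Proof.
  intros H. destruct (base_Int_part ((x - c) / e)) as [_ H2].
  assert (IZR a <= (x - c) / e).
  { apply Rmult_le_reg_r with e; auto. unfold Rdiv. rewrite Rmult_assoc, Rinv_l by lra. lra. }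
  assert (IZR a < IZR (Int_part ((x - c) / e) + 1)) by (rewrite plus_IZR; lra).
  apply lt_IZR in H1. lia.
Qed.

Lemma floor_lt c a x : x < c + IZR a * e -> (Int_part ((x - c) / e) < a)%Z.
Proof.
  intros H. destruct (base_Int_part ((x - c) / e)) as [H1 _].
  assert ((x - c) / e < IZR a).
  { apply Rmult_lt_reg_r with e; auto. unfold Rdiv. rewrite Rmult_assoc, Rinv_l by lra. lra. }
  apply lt_IZR. lra.
Qed.

Lemma floor_spec c x : c + IZR (Int_part ((x - c) / e)) * e <= x < c + IZR (Int_part ((x - c) / e) + 1) * e.
Proof.
  destruct (base_Int_part ((x - c) / e)) as [H1 H2]. rewrite plus_IZR.
  assert (E : (x - c) / e * e = x - c) by (field; lra).
  set (t := (x - c) / e) in *. set (k := IZR (Int_part t)) in *. split; nra.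
Qed.

Lemma gx_1 i : gx (i + 1) = gx i + e.
Proof. unfold gx. rewrite plus_IZR. ring. Qed.
Lemma gy_1 j : gy (j + 1) = gy j + e.
Proof. unfold gy. rewrite plus_IZR. ring. Qed.
Lemma gx_k i k : gx (i + k) = gx i + IZR k * e.
Proof. unfold gx. rewrite plus_IZR. ring. Qed.
Lemma gy_k j k : gy (j + k) = gy j + IZR k * e.
Proof. unfold gy. rewrite plus_IZR. ring. Qed.

Lemma cell_cof z : cell (cof z) z.
Proof.
  unfold cell, inrect, cof, gx, gy; cbn [fst snd].
  pose proof (floor_spec u (fst z)). pose proof (floor_spec v (snd z)). lra.
Qed.

Lemma cof_near p z b k : (0 <= k)%Z -> cell p z -> Rabs (fst b - fst z) < IZR k * e -> Rabs (snd b - snd z) < IZR k * e ->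
  (cd p (cof b) <= k)%Z.
Proof.
  intros Hk [Hx Hy] H1 H2. apply Rabs_lt_between in H1, H2.
  assert (A1 : (fst p + - k <= fst (cof b))%Z).
  { apply floor_ge. fold (gx (fst p + - k)). rewrite gx_k, opp_IZR. lra. }
  assert (A2 : (fst (cof b) < fst p + 1 + k)%Z).
  { apply floor_lt. fold (gx (fst p + 1 + k)). rewrite gx_k. lra. }
  assert (A3 : (snd p + - k <= snd (cof b))%Z).
  { apply floor_ge. fold (gy (snd p + - k)). rewrite gy_k, opp_IZR. lra. }
  assert (A4 : (snd (cof b) < snd p + 1 + k)%Z).
  { apply floor_lt. fold (gy (snd p + 1 + k)). rewrite gy_k. lra. }
  unfold cd. lia.
Qed.

Lemma cof_insq p b k : (cd p (cof b) <= k)%Z -> insq (gx (fst p), gy (snd p)) (IZR (k + 1) * e) b.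
Proof.
  intros H. unfold cd in H. destruct (cell_cof b) as [Hx Hy].
  set (i := fst (cof b)) in *. set (j := snd (cof b)) in *.
  assert (A1 : IZR (fst p) - IZR k <= IZR i <= IZR (fst p) + IZR k).
  { rewrite <- minus_IZR, <- plus_IZR. split; apply IZR_le; lia. }
  assert (A2 : IZR (snd p) - IZR k <= IZR j <= IZR (snd p) + IZR k).
  { rewrite <- minus_IZR, <- plus_IZR. split; apply IZR_le; lia. }
  rewrite gx_1 in Hx. rewrite gy_1 in Hy. unfold gx, gy in Hx, Hy.
  unfold insq, inrect, gx, gy; cbn [fst snd]. rewrite plus_IZR. nra.
Qed.

Variables (nu : C -> Z) (Lm : C -> C) (rho : R) (N : nat) (B : R).
Hypothesis Hcount : forall a l, NoDup l -> (forall b, In b l -> insq a rho b) -> (nsum nu l <= N)%nat.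
Hypothesis HB : forall w, (forall b, insq w (e / 2) b -> nu b = 0%Z) -> Cmod (Lm w) <= B.
Hypothesis Hloc : forall a, exists r H, 0 < r /\ hol (fun z => Cmod (z - a) < r) H /\
     forall w, Cmod (w - a) < r -> w <> a \/ nu a = 0%Z -> Lm w = (IZR (nu a) * / (w - a) + H w)%C.
Hypothesis Hrho : (3 * INR N + 3) * e <= rho.

(** [A] is the open set where [g] is holomorphic and [A'] the set carrying the divisor sum; they
    differ for the annulus, which contains its outer circle. [G] majorizes [g] cell by cell near the
    boundary, and its sum plays the role of supremum times length. *)
Variables (A A' : C -> Prop) (g : C -> C) (Ls : list C) (G : Z * Z -> R) (T : nat).

(* Clusters reach at most [3 N + 2] cells beyond the deep ones (see [core_near_deep]); six more layers keep
   the neighbouring cells inside the domain. *)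
Definition margin : Z := (3 * Z.of_nat N + 8)%Z.
Definition deep (p : Z * Z) : Prop := forall q z, (cd p q <= margin)%Z -> cell q z -> A z.
Definition shallow (p : Z * Z) : Prop := ~ deep p /\ exists z, cell p z /\ A' z.
Definition bad (p : Z * Z) : Prop := exists a, nu a <> 0%Z /\ (cd p (cof a) <= 1)%Z.

(* The deep cells together with the clusters of bad cells attached to them: the boundary of this union
   keeps distance at least [e] from the divisor. *)
Inductive core : Z * Z -> Prop :=
| core_deep p : deep p -> core p
| core_step p q : bad p -> (cd p q <= 1)%Z -> core q -> core p.

Lemma cd_tri p q r : (cd p r <= cd p q + cd q r)%Z.
Proof. unfold cd; lia. Qed.
Lemma cd_sym p q : cd p q = cd q p.
Proof. unfold cd; lia. Qed.

(* A chain of bad cells from [q] to a deep cell meets every chess sphere around [p] that separates them. *)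
Lemma core_chain q : core q -> forall p s, (cd p q <= s)%Z -> (forall d, deep d -> (s < cd p d)%Z) ->
  exists b, bad b /\ cd p b = s.
Proof.
  induction 1 as [q Hq|q q' Hb Hqq Hq' IH]; intros p s Hs Hd.
  - specialize (Hd q Hq). lia.
  - destruct (Z.eq_dec (cd p q) s) as [E|E]; [exists q; auto|].
    apply IH; auto. pose proof (cd_tri p q q'). lia.
Qed.

Lemma nsum_ge_length l : (forall b, In b l -> nu b <> 0%Z) -> (length l <= nsum nu l)%nat.
Proof.
  induction l as [|b l IH]; simpl; intros H; [lia|]. pose proof (H b (or_introl eq_refl)).
  specialize (IH (fun x Hx => H x (or_intror Hx))). lia.
Qed.

Lemma INR_N_IZR : INR N = IZR (Z.of_nat N).
Proof. apply INR_IZR_INZ. Qed.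

(** A longer chain of bad cells would need [N + 1] distinct divisor points in a square of half-side
    at most [rho]. *)
Lemma core_near_deep p : core p -> exists d, deep d /\ (cd p d <= 3 * Z.of_nat N + 2)%Z.
Proof.
  intros HK. apply NNPP; intro Hno.
  assert (Hd : forall d, deep d -> (3 * Z.of_nat N + 2 < cd p d)%Z).
  { intros d Hd. apply Z.lt_nge; intro. apply Hno; eauto. }
  (* The chain meets the spheres of radii 0, 3, ..., 3 N around [p]. A divisor point next to the bad
     cell on the sphere of radius 3 n is at distance between 3 n - 1 and 3 n + 1, so different
     spheres give different points. *)
  assert (Hl : forall n, (n <= N + 1)%nat -> exists l, length l = n /\ NoDup l /\
    forall a, In a l -> nu a <> 0%Z /\ (cd p (cof a) <= 3 * (Z.of_nat n - 1) + 1)%Z).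
  { induction n; intros Hn.
    - exists nil; repeat split; auto; try constructor; simpl in *; tauto.
    - destruct IHn as [l [L1 [L2 L3]]]; [lia|].
      destruct (core_chain p HK p (3 * Z.of_nat n)%Z) as [b [[a [Ha1 Ha2]] Hb]].
      { unfold cd. lia. } { intros d Hdd; specialize (Hd d Hdd); lia. }
      pose proof (cd_tri p b (cof a)). pose proof (cd_tri p (cof a) b). rewrite (cd_sym (cof a)) in H0.
      exists (a :: l). split; [simpl; lia|]. split.
      + constructor; auto. intro Hin. destruct (L3 a Hin). lia.
      + intros a' [<-|Hin]; [split; auto; lia|]. destruct (L3 a' Hin); split; auto; lia. }
  destruct (Hl (N + 1)%nat (Nat.le_refl _)) as [l [L1 [L2 L3]]].
  assert (Hc : (nsum nu l <= N)%nat).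
  { apply (Hcount (gx (fst p), gy (snd p))); auto. intros b Hb. destruct (L3 b Hb) as [_ Hb2].
    eapply insq_mono; [|apply cof_insq; apply Hb2].
    replace (3 * (Z.of_nat (N + 1) - 1) + 1 + 1)%Z with (3 * Z.of_nat N + 2)%Z by lia.
    rewrite plus_IZR, mult_IZR, <- INR_N_IZR. pose proof (pos_INR N). nra. }
  pose proof (nsum_ge_length l (fun b Hb => proj1 (L3 b Hb))). lia.
Qed.

Lemma core_cell p q z : core p -> (cd p q <= 6)%Z -> cell q z -> A z.
Proof.
  intros HK Hq Hz. destruct (core_near_deep p HK) as [d [Hd Hdp]]. apply (Hd q); auto.
  pose proof (cd_tri d p q). rewrite (cd_sym d p) in H. unfold margin. lia.
Qed.

Hypothesis HA : opn A.
Hypothesis HAA : forall z, A z -> A' z.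
Hypothesis Hg : hol A g.
Hypothesis HLnd : NoDup Ls.
Hypothesis HL : forall b, In b Ls <-> A' b /\ nu b <> 0%Z.
Hypothesis Hgen : forall b i, In b Ls -> fst b <> gx i /\ snd b <> gy i.
Hypothesis HG0 : forall p, 0 <= G p.
Hypothesis HG1 : forall p, ~ shallow p -> G p = 0.
Hypothesis HGg : forall p z, shallow p -> cell p z -> A' z -> Cmod (g z) <= G p.
Hypothesis HT1 : (1 <= T)%nat.
Hypothesis HT : forall p z, cell p z -> A' z -> In p (box (T - 1)).

Definition integrand (w : C) : C := (g w * Lm w)%C.
Definition weight (b : C) : C := (IZR (nu b) * g b)%C.

Lemma cell_corner p : cell p (gx (fst p), gy (snd p)).
Proof. unfold cell, inrect; cbn [fst snd]. rewrite gx_1, gy_1. lra. Qed.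

(** No divisor point lies on a grid line, so it belongs to the closed cell exactly when [cof]
    assigns it to that cell, and every point is counted once. *)
Lemma cell_residue p : core p ->
  J integrand (gx (fst p)) (gx (fst p + 1)) (gy (snd p)) (gy (snd p + 1)) =
  (tpi * csumL Ls (fun b => ifP (cof b = p) (weight b) (RtoC 0)))%C.
Proof.
  intros HK. rewrite (residue_rect A weight _ _ _ _) with (Ls := Ls); auto.
  - f_equal. apply csumL_ext. intros b Hb.
    assert (E : inrect (gx (fst p)) (gx (fst p + 1)) (gy (snd p)) (gy (snd p + 1)) b <-> cof b = p).
    { split; [|intros <-; apply cell_cof]. intros [Hx Hy].
      destruct (Hgen b (fst p + 1)%Z Hb) as [N1 _]. destruct (Hgen b (snd p + 1)%Z Hb) as [_ N2].
      assert (A1 : (fst p <= fst (cof b))%Z) by (apply floor_ge, Hx).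
      assert (A2 : (fst (cof b) < fst p + 1)%Z) by (apply floor_lt; fold (gx (fst p + 1)); lra).
      assert (A3 : (snd p <= snd (cof b))%Z) by (apply floor_ge, Hy).
      assert (A4 : (snd (cof b) < snd p + 1)%Z) by (apply floor_lt; fold (gy (snd p + 1)); lra).
      apply injective_projections; lia. }
    unfold ifP. repeat destruct excluded_middle_informative; tauto.
  - rewrite gx_1; lra.
  - rewrite gy_1; lra.
  - intros z Hz. apply (core_cell p p z); auto. unfold cd; lia.
  - intros b Hb [_ Hon]. destruct (Hgen b (fst p) Hb). destruct (Hgen b (snd p) Hb).
    destruct (Hgen b (fst p + 1)%Z Hb). destruct (Hgen b (snd p + 1)%Z Hb). intuition.
  - intros b Hb. destruct (Hloc b) as [r [H [Hr [HH E]]]]. destruct (HA b Hb) as [r' [Hr' HAr]].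
    destruct (divide A g b HA Hg Hb) as [psi [Hpsi Ep]].
    pose proof (Rmin_l r r'). pose proof (Rmin_r r r').
    exists (Rmin r r'), (fun w => IZR (nu b) * psi w + g w * H w)%C. split; [apply Rmin_pos; auto|]. split.
    + apply hol_plus; apply hol_mult.
      * apply hol_const.
      * eapply hol_sub; [|apply Hpsi]. intros z Hz; apply HAr; lra.
      * eapply hol_sub; [|apply Hg]. intros z Hz; apply HAr; lra.
      * eapply hol_sub; [|apply HH]. intros z Hz; simpl in *; lra.
    + intros w Hw Hc. unfold integrand, weight.
      assert (Hin : ~ In b Ls -> nu b = 0%Z).
      { intros Hn. apply NNPP; intro Hn'. apply Hn, HL. auto. }
      rewrite E; [|lra|destruct Hc; auto].
      unfold ifP. destruct excluded_middle_informative as [Hi|Hi].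
      * destruct Hc as [Hc|]; [|tauto]. assert (w - b <> 0)%C by (intro Q; apply Hc, Ceq_minus; auto).
        rewrite (Ep w). field. auto.
      * rewrite (Hin Hi). ring.
Qed.

(** The core is closed under adding adjacent bad cells, so a neighbour [q] outside it is not bad.
    Hence no divisor point lies within e/2 of any point of [q], and [HB] applies there. *)
Lemma edge_ok p q : core p -> ~ core q -> (cd p q <= 1)%Z -> shallow q /\
  forall z, cell q z -> Ccont integrand z /\ Cmod (integrand z) <= B * G q.
Proof.
  intros HK HN Hpq.
  assert (HAq : forall z, cell q z -> A z) by (intros z Hz; apply (core_cell p q z); auto; lia).
  assert (Hs : shallow q).
  { split; [intro Hd; apply HN, core_deep; auto|]. exists (gx (fst q), gy (snd q)). split; [apply cell_corner|].
    apply HAA, HAq, cell_corner. }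
  split; auto. intros z Hz.
  assert (Hfree : forall b, insq z (e/2) b -> nu b = 0%Z).
  { intros b Hb. apply NNPP; intro Hn. apply HN. apply core_step with p; [|rewrite cd_sym; auto|auto].
    exists b; split; auto. apply (cof_near q z b 1); [lia|auto| |]; unfold insq, inrect in Hb; apply Rabs_lt_between; lra. }
  split.
  - unfold integrand. apply Ccont_mult; [apply (hol_cont A); auto|].
    destruct (Hloc z) as [r [H [Hr [HH E]]]].
    assert (Hz0 : nu z = 0%Z) by (apply Hfree, insq_refl; lra).
    apply Ccont_ext with (f := H) (r := r); auto.
    + intros w Hw. rewrite E; auto. rewrite Hz0. ring.
    + apply (hol_cont _ _ _ HH). rewrite Cmod_refl; auto.
  - unfold integrand. rewrite Cmod_mult, Rmult_comm. apply Rmult_le_compat; try apply Cmod_ge_0; auto.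
Qed.

(** Either cell may be the one outside the core, so the bound carries both values of [G]. *)
Lemma edge_pair p q : (cd p q <= 1)%Z -> 0 <= B -> (forall z, cell p z -> cell q z ->
    (core p <-> core q) \/ (Ccont integrand z /\ Cmod (integrand z) <= B * (G p + G q))).
Proof.
  intros Hpq HB0 z Hp Hq. destruct (classic (core p)) as [Kp|Kp], (classic (core q)) as [Kq|Kq]; try tauto.
  - right. destruct (edge_ok p q Kp Kq Hpq) as [_ H]. destruct (H z Hq). split; auto.
    pose proof (HG0 p). pose proof (HG0 q). nra.
  - right. rewrite cd_sym in Hpq. destruct (edge_ok q p Kq Kp Hpq) as [_ H]. destruct (H z Hp). split; auto.
    pose proof (HG0 p). pose proof (HG0 q). nra.
Qed.

(** * Summation over the boundary edges of the core *)

Definition chi (p : Z * Z) : C := ifP (core p) (RtoC 1) (RtoC 0).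
Definition hedge (p : Z * Z) : C := hint integrand (gx (fst p)) (gx (fst p + 1)) (gy (snd p)).
Definition vedge (p : Z * Z) : C := vint integrand (gx (fst p)) (gy (snd p)) (gy (snd p + 1)).

Lemma chi_diff p q : (core p <-> core q) -> (chi p - chi q)%C = 0.
Proof. intros H. unfold chi, ifP. repeat destruct excluded_middle_informative; try tauto; ring. Qed.

Lemma chi_diff_le p q : Cmod (chi p - chi q) <= 1.
Proof.
  unfold chi, ifP. repeat destruct excluded_middle_informative.
  - rewrite Cmod_refl; lra.
  - replace (1 - 0)%C with (RtoC 1) by ring. rewrite Cmod_1; lra.
  - replace (0 - 1)%C with (- RtoC 1)%C by ring. rewrite Cmod_opp, Cmod_1; lra.
  - rewrite Cmod_refl; lra.
Qed.

Lemma hedge_bound p : 0 <= B -> Cmod ((chi p - chi (fst p, snd p - 1)%Z) * hedge p) <= 2 * e * (B * (G p + G (fst p, snd p - 1)%Z)).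
Proof.
  intros HB0. set (q := (fst p, snd p - 1)%Z).
  assert (R0 : 0 <= 2 * e * (B * (G p + G q))).
  { pose proof (HG0 p). pose proof (HG0 q). repeat apply Rmult_le_pos; lra. }
  destruct (classic (core p <-> core q)) as [E|E]; [rewrite (chi_diff _ _ E), Cmult_0_l, Cmod_0; auto|].
  assert (P : forall x, gx (fst p) <= x <= gx (fst p + 1) -> Ccont integrand (x, gy (snd p)) /\ Cmod (integrand (x, gy (snd p))) <= B * (G p + G q)).
  { intros x Hx. destruct (edge_pair p q) with (z := (x, gy (snd p))); auto; try tauto.
    - unfold cd, q; cbn [fst snd]; lia.
    - unfold cell, inrect; cbn [fst snd]. rewrite gy_1; lra.
    - unfold cell, inrect, q; cbn [fst snd]. replace (snd p - 1 + 1)%Z with (snd p) by ring.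
      assert (gy (snd p) = gy (snd p - 1) + e) by (rewrite <- gy_1; f_equal; ring). lra. }
  rewrite Cmod_mult.
  assert (Cmod (hedge p) <= 2 * e * (B * (G p + G q))).
  { unfold hedge. replace (2 * e) with (2 * (gx (fst p + 1) - gx (fst p))) by (rewrite gx_1; ring).
    apply hint_bound; [rewrite gx_1; lra| |]; intros; apply P; auto. }
  pose proof (chi_diff_le p q). pose proof (Cmod_ge_0 (chi p - chi q)). pose proof (Cmod_ge_0 (hedge p)). nra.
Qed.

Lemma vedge_bound p : 0 <= B -> Cmod ((chi (fst p - 1, snd p)%Z - chi p) * vedge p) <= 2 * e * (B * (G p + G (fst p - 1, snd p)%Z)).
Proof.
  intros HB0. set (q := (fst p - 1, snd p)%Z).
  assert (R0 : 0 <= 2 * e * (B * (G p + G q))).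
  { pose proof (HG0 p). pose proof (HG0 q). repeat apply Rmult_le_pos; lra. }
  destruct (classic (core q <-> core p)) as [E|E]; [rewrite (chi_diff _ _ E), Cmult_0_l, Cmod_0; auto|].
  assert (P : forall y, gy (snd p) <= y <= gy (snd p + 1) -> Ccont integrand (gx (fst p), y) /\ Cmod (integrand (gx (fst p), y)) <= B * (G p + G q)).
  { intros y Hy. destruct (edge_pair p q) with (z := (gx (fst p), y)); auto; try tauto.
    - unfold cd, q; cbn [fst snd]; lia.
    - unfold cell, inrect; cbn [fst snd]. rewrite gx_1; lra.
    - unfold cell, inrect, q; cbn [fst snd]. replace (fst p - 1 + 1)%Z with (fst p) by ring.
      assert (gx (fst p) = gx (fst p - 1) + e) by (rewrite <- gx_1; f_equal; ring). lra. }
  rewrite Cmod_mult.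
  assert (Cmod (vedge p) <= 2 * e * (B * (G p + G q))).
  { unfold vedge. replace (2 * e) with (2 * (gy (snd p + 1) - gy (snd p))) by (rewrite gy_1; ring).
    apply vint_bound; [rewrite gy_1; lra| |]; intros; apply P; auto. }
  pose proof (chi_diff_le q p). pose proof (Cmod_ge_0 (chi q - chi p)). pose proof (Cmod_ge_0 (vedge p)). nra.
Qed.

Lemma box_le t s : (t <= s)%nat -> forall p, In p (box t) -> In p (box s).
Proof. intros H p. rewrite !in_box. lia. Qed.

Lemma chi_outside p : ~ In p (box (T - 1)) -> chi p = 0.
Proof.
  intros H. unfold chi, ifP. destruct excluded_middle_informative as [HK|]; auto.
  exfalso; apply H. apply (HT p _ (cell_corner p)). apply HAA. apply (core_cell p p); auto; [unfold cd; lia|apply cell_corner].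
Qed.

Lemma G_outside p : ~ In p (box (T - 1)) -> G p = 0.
Proof. intros H. apply HG1. intros [_ [z [Hz1 Hz2]]]. apply H, (HT p z); auto. Qed.

(** The sum over the core is the sum of all cell integrals weighted by [chi]; after [abel_box] only
    edges between core and complement survive. Horizontal and vertical edges cost 2 e B for each of
    their two cells, in total 8 e B times the sum of [G]. *)
Lemma csum_core_bound : 0 <= B -> Cmod (tpi * csumL Ls (fun b => weight b * chi (cof b)))%C <= 8 * e * B * rsumL (box T) G.
Proof.
  intros HB0.
  assert (E : (tpi * csumL Ls (fun b => weight b * chi (cof b)))%C =
    csumL (box T) (fun p => chi p * (hedge p + vedge (fst p + 1, snd p)%Z - hedge (fst p, snd p + 1)%Z - vedge p))%C).
  { transitivity (csumL (box T) (fun p => tpi * csumL Ls (fun b => chi p * ifP (cof b = p) (weight b) (RtoC 0))))%C.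
    - rewrite csumL_scal, csumL_swap. f_equal. apply csumL_ext. intros b Hb.
      rewrite (csumL_ext _ _ (fun p => if ZZ_dec (cof b) p then chi p * weight b else RtoC 0)%C).
      + rewrite csumL_indicator by apply NoDup_box. destruct in_dec as [Hi|Hi]; [ring|].
        rewrite chi_outside; [ring|]. intro; apply Hi. eapply box_le; [|eauto]; lia.
      + intros p _. unfold ifP. destruct excluded_middle_informative, ZZ_dec; try tauto; ring.
    - apply csumL_ext. intros p _. rewrite csumL_scal. unfold chi at 1 2, ifP at 1 3.
      destruct excluded_middle_informative as [HK|HK]; [|ring].
      pose proof (cell_residue p HK) as Q. unfold J in Q. unfold hedge, vedge; cbn [fst snd].
      rewrite Q. ring. }
  rewrite E, abel_box; auto; [|apply chi_outside].
  eapply Rle_trans; [apply Cmod_csumL|].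
  apply Rle_trans with (rsumL (box T) (fun p => (4 * e * B) * G p + (2 * e * B) * G (fst p, snd p - 1)%Z + (2 * e * B) * G (fst p - 1, snd p)%Z)).
  - apply rsumL_le. intros p _. eapply Rle_trans; [apply Cmod_triangle|].
    pose proof (hedge_bound p HB0). pose proof (vedge_bound p HB0). lra.
  - rewrite !rsumL_plus, !rsumL_scal. destruct (rsumL_box_shift T G HT1 G_outside) as [E1 E2]. rewrite E1, E2. lra.
Qed.

Lemma nsum_filter_sum p l :
  rsumL l (fun b => if ZZ_dec (cof b) p then INR (Z.abs_nat (nu b)) else 0) =
  INR (nsum nu (filter (fun b => if ZZ_dec (cof b) p then true else false) l)).
Proof.
  induction l; simpl; auto. destruct ZZ_dec; simpl; rewrite IHl; [rewrite plus_INR|]; ring.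
Qed.

(** A divisor point outside the core lies in a shallow cell, and a single cell carries total
    multiplicity at most [N]. *)
Lemma csum_rest_bound : Cmod (csumL Ls (fun b => weight b * (1 - chi (cof b))))%C <= INR N * rsumL (box T) G.
Proof.
  eapply Rle_trans; [apply Cmod_csumL|].
  apply Rle_trans with (rsumL Ls (fun b => rsumL (box T) (fun p => if ZZ_dec (cof b) p then INR (Z.abs_nat (nu b)) * G p else 0))).
  - apply rsumL_le. intros b Hb. rewrite rsumL_indicator by apply NoDup_box.
    apply HL in Hb. destruct Hb as [Hb1 Hb2].
    assert (Hib : In (cof b) (box T)) by (apply (box_le (T-1)); [lia|apply (HT _ b); auto; apply cell_cof]).
    destruct in_dec; [|tauto]. rewrite Cmod_mult. unfold weight. rewrite Cmod_mult, Cmod_R.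
    assert (Ea : Rabs (IZR (nu b)) = INR (Z.abs_nat (nu b))).
    { rewrite INR_IZR_INZ, Zabs2Nat.id_abs, abs_IZR. auto. }
    rewrite Ea. pose proof (pos_INR (Z.abs_nat (nu b))). pose proof (HG0 (cof b)).
    unfold chi, ifP. destruct excluded_middle_informative as [HK|HK].
    + replace (1 - 1)%C with (RtoC 0) by ring. rewrite Cmod_0, Rmult_0_r. apply Rmult_le_pos; auto.
    + replace (1 - 0)%C with (RtoC 1) by ring. rewrite Cmod_1, Rmult_1_r. apply Rmult_le_compat_l; auto.
      apply HGg; auto; [|apply cell_cof]. split; [intro; apply HK, core_deep; auto|]. exists b; split; auto. apply cell_cof.
  - rewrite rsumL_swap, <- rsumL_scal. apply rsumL_le. intros p _.
    rewrite (rsumL_ext _ _ (fun b => G p * (if ZZ_dec (cof b) p then INR (Z.abs_nat (nu b)) else 0))).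
    2:{ intros b _. destruct ZZ_dec; ring. }
    rewrite rsumL_scal, nsum_filter_sum, Rmult_comm. apply Rmult_le_compat_r; auto. apply le_INR.
    apply (Hcount (gx (fst p), gy (snd p))); [apply NoDup_filter; auto|].
    intros b Hb. apply filter_In in Hb. destruct Hb as [_ Hb]. destruct ZZ_dec as [E|]; [|discriminate].
    eapply insq_mono; [|apply (cof_insq p b 0)].
    + pose proof (pos_INR N). simpl. nra.
    + rewrite E. unfold cd; lia.
Qed.

Theorem grid_bound : 0 <= B -> Cmod (csumL Ls weight) <= (8 * e * B + INR N) * rsumL (box T) G.
Proof.
  intros HB0.
  assert (S0 : 0 <= rsumL (box T) G) by (apply rsumL_nonneg; auto).
  rewrite (csumL_ext _ weight (fun b => weight b * chi (cof b) + weight b * (1 - chi (cof b)))%C) by (intros; ring).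
  rewrite csumL_plus. eapply Rle_trans; [apply Cmod_triangle|].
  pose proof (csum_core_bound HB0) as H1. pose proof csum_rest_bound as H2.
  rewrite Cmod_mult, Cmod_tpi in H1. pose proof PI_gt_3.
  pose proof (Cmod_ge_0 (csumL Ls (fun b => weight b * chi (cof b))%C)). nra.
Qed.
End Grid.

(** * Boundaries of simply connected domains *)

(** The point is the exit position: the supremum of the times up to which the path has stayed in
    [E]. *)
Lemma path_crosses_boundary (E : C -> Prop) (gam : R -> C) : opn E -> cont_path gam -> E (gam 0) -> ~ E (gam 1) ->
  exists t, 0 <= t <= 1 /\ boundary E (gam t).
Proof.
  intros HE Hc H0 H1.
  set (P := fun t => 0 <= t <= 1 /\ forall s, 0 <= s <= t -> E (gam s)).
  destruct (completeness P) as [tau [U1 U2]].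
  { exists 1. intros t [Ht _]; lra. }
  { exists 0. split; [lra|]. intros s Hs. replace s with 0 by lra. auto. }
  assert (Ht0 : 0 <= tau) by (apply U1; split; [lra|]; intros s Hs; replace s with 0 by lra; auto).
  assert (Ht1 : tau <= 1) by (apply U2; intros t [Ht _]; lra).
  assert (Happ : forall d, 0 < d -> exists t, P t /\ tau - d < t).
  { intros d Hd. apply NNPP; intro Hn. assert (tau <= tau - d); [|lra].
    apply U2. intros t Hp. apply Rnot_lt_le; intro. apply Hn; eauto. }
  exists tau. split; [lra|]. split.
  - intro Hin. destruct (HE _ Hin) as [r [Hr HEr]].
    destruct (Hc tau ltac:(lra) r Hr) as [d [Hd Hcd]].
    destruct (Happ d Hd) as [t [[Ht HPt] Htd]].
    assert (Hall : forall s, 0 <= s <= 1 -> s < tau + d -> E (gam s)).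
    { intros s Hs Hsd. destruct (Rle_dec s t); [apply HPt; lra|]. apply HEr.
      rewrite <- Cnorm_Cmod. apply Hcd; auto. apply Rabs_lt_between; lra. }
    destruct (Rle_dec 1 (tau + d / 2)); [apply H1, Hall; lra|].
    assert (tau + d/2 <= tau); [|lra]. apply U1. split; [lra|]. intros s Hs; apply Hall; lra.
  - intros r Hr. destruct (Hc tau ltac:(lra) r Hr) as [d [Hd Hcd]].
    destruct (Happ d Hd) as [t [[Ht HPt] Htd]]. exists (gam t). split; [apply HPt; lra|].
    apply Hcd; auto. assert (t <= tau) by (apply U1; split; auto). apply Rabs_lt_between; lra.
Qed.

(** * Winding numbers by unit complex numbers *)

Definition Eu (x : R) : C := (cos x, sin x).

Lemma Eu_plus x y : Eu (x + y) = (Eu x * Eu y)%C.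
Proof. unfold Eu. rewrite cos_plus, sin_plus. apply injective_projections; simpl; ring. Qed.

Lemma Cmod_Eu x : Cmod (Eu x) = 1.
Proof. apply sqr_eq_nonneg; [apply Cmod_ge_0|lra|]. rewrite Cmod_sqr. unfold Eu; simpl. pose proof (sin2_cos2 x). unfold Rsqr in *; lra. Qed.

Lemma Cconj_unit z : Cmod z = 1 -> (z * Cconj z)%C = 1.
Proof.
  intros H. pose proof (Cmod_sqr z) as S. rewrite H in S.
  apply injective_projections; simpl; [|ring]. lra.
Qed.

Lemma Eu_atan z : Cmod z = 1 -> 0 < fst z -> Eu (atan (snd z / fst z)) = z.
Proof.
  intros H Hp. pose proof (Cmod_sqr z) as S. rewrite H in S. destruct z as [x y]; simpl in *.
  unfold Eu. rewrite cos_atan, sin_atan.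
  assert (E : sqrt (1 + Rsqr (y / x)) = / x).
  { apply sqr_eq_nonneg; [apply sqrt_pos|left; apply Rinv_0_lt_compat; auto|].
    rewrite sqrt_sqrt by (pose proof (Rle_0_sqr (y/x)); lra).
    unfold Rsqr. apply Rmult_eq_reg_r with (x * x); [|apply Rgt_not_eq; nra].
    replace ((1 + y / x * (y / x)) * (x * x)) with (x * x + y * y) by (field; lra). rewrite <- S. field. lra. }
  rewrite E. apply injective_projections; simpl; field; lra.
Qed.

Lemma unit_close_re z w : Cmod z = 1 -> Cmod w = 1 -> Cmod (z - w) < 1 -> 0 < fst (z * Cconj w)%C.
Proof.
  intros Hz Hw H. pose proof (Cmod_sqr z) as S1. pose proof (Cmod_sqr w) as S2. pose proof (Cmod_sqr (z - w)) as S3.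
  rewrite Hz in S1. rewrite Hw in S2. pose proof (Cmod_ge_0 (z - w)).
  destruct z as [x y], w as [p q]; simpl in *. nra.
Qed.

Section Winding.
Variable W : R -> R -> C.
Hypothesis Wc : forall s t eps, 0 < eps -> exists d, 0 < d /\ forall s' t', Rabs (s' - s) < d -> Rabs (t' - t) < d ->
  Cmod (W s' t' - W s t) < eps.
Hypothesis Wu : forall s t, Cmod (W s t) = 1.
Hypothesis Wl : forall s, W s 0 = W s 1.
Hypothesis W1 : forall t, 0 <= t <= 1 -> W 1 t = W 1 0.
Variable c0 : C.
Hypothesis W0 : forall t, 0 <= t <= 1 -> W 0 t = (c0 * Eu (2 * PI * t))%C.

Lemma W_unif : exists d, 0 < d /\ forall s t t', 0 <= s <= 1 -> 0 <= t <= 1 -> 0 <= t' <= 1 -> Rabs (t' - t) < d ->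
  Cmod (W s t' - W s t) < 1.
Proof.
  assert (H : forall k : C -> R, (forall z w, Rabs (k z - k w) <= Cmod (z - w)) -> exists d, 0 < d /\ forall s t t', 0 <= s <= 1 -> 0 <= t <= 1 -> 0 <= t' <= 1 ->
    Rabs (t' - t) < d -> Rabs (k (W s t') - k (W s t)) < 1/2).
  { intros k Hk. destruct (uniform_continuity_2d (fun s t => k (W s t)) 0 1 0 1) with (eps := mkposreal (1/2) ltac:(lra)) as [d Hd].
    - intros s t _ _ eps. destruct (Wc s t eps (cond_pos eps)) as [d [Hd H]]. exists (mkposreal d Hd).
      intros s' t' Hs Ht. eapply Rle_lt_trans; [apply Hk|]. apply H; auto.
    - exists d; split; [apply cond_pos|]. intros s t t' Hs Ht Ht' Hd'. apply Hd; auto. rewrite Rminus_diag, Rabs_R0. apply cond_pos. }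
  destruct (H fst) as [d1 [Hd1 H1]]; [intros z w; apply (re_le_Cmod (z - w))|].
  destruct (H snd) as [d2 [Hd2 H2]]; [intros z w; apply (im_le_Cmod (z - w))|].
  exists (Rmin d1 d2). split; [apply Rmin_pos; auto|]. intros s t t' Hs Ht Ht' Hd.
  pose proof (Rmin_l d1 d2). pose proof (Rmin_r d1 d2).
  eapply Rle_lt_trans; [apply Cmod_le_re_im|]. simpl.
  specialize (H1 s t t' Hs Ht Ht' ltac:(lra)). specialize (H2 s t t' Hs Ht Ht' ltac:(lra)).
  unfold Rminus in *. lra.
Qed.

Lemma continuity_of_comp (k : C -> R) s t : (forall z w, Rabs (k z - k w) <= Cmod (z - w)) -> continuity_pt (fun s => k (W s t)) s.
Proof.
  intros Hk. apply continuity_pt_locally. intros eps. destruct (Wc s t eps (cond_pos eps)) as [d [Hd H]].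
  exists (mkposreal d Hd). intros s' Hs'. eapply Rle_lt_trans; [apply Hk|]. apply H; [apply Hs'|].
  rewrite Rminus_diag, Rabs_R0. auto.
Qed.

(* [W] turns once around the circle at [s = 0] and not at all at [s = 1], while the total increment of its
   argument over a partition fine enough for all [s] is continuous in [s] and a multiple of [2 PI]. *)
Lemma winding_contradiction : False.
Proof.
  destruct W_unif as [d [Hd HU]].
  (* The mesh 1/n is below [d], so consecutive values are closer than 1 for every [s]; and n > 5
     makes the increments 2 PI/n smaller than PI/2, where [atan] inverts [tan]. *)
  destruct (archimed_cor1 (Rmin d (/ 5))) as [n [Hn1 Hn2]]; [apply Rmin_pos; lra|].
  pose proof (Rmin_l d (/ 5)). pose proof (Rmin_r d (/ 5)).
  assert (Hn0 : 0 < INR n) by (apply lt_0_INR; auto).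
  assert (Hn5 : 5 < INR n).
  { apply Rnot_le_lt; intro. assert (/ 5 <= / INR n) by (apply Rinv_le_contravar; lra). lra. }
  set (t := fun i => INR i / INR n).
  assert (Ht : forall i, (i <= n)%nat -> 0 <= t i <= 1).
  { intros i Hi. apply le_INR in Hi. pose proof (pos_INR i). unfold t, Rdiv. split.
    - apply Rmult_le_pos; [lra|left; apply Rinv_0_lt_compat; auto].
    - apply Rmult_le_reg_r with (INR n); auto. rewrite Rmult_assoc, Rinv_l; lra. }
  assert (Htd : forall i, t (S i) - t i = / INR n) by (intros i; unfold t; rewrite S_INR; field; lra).
  (* Quotients of consecutive values: unit numbers with positive real part, whose argument [atan]
     gives continuously in [s]. *)
  set (r := fun i s => (W s (t (S i)) * Cconj (W s (t i)))%C).
  assert (Hr1 : forall i s, Cmod (r i s) = 1).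
  { intros. unfold r. rewrite Cmod_mult, Wu. replace (Cmod (Cconj (W s (t i)))) with 1; [ring|].
    symmetry. apply sqr_eq_nonneg; [apply Cmod_ge_0|lra|]. pose proof (Cmod_sqr (W s (t i))) as S. rewrite Wu in S.
    rewrite Cmod_sqr. simpl. lra. }
  set (cl := fun x => Rmin (Rmax x 0) 1).
  assert (Hrp : forall i s, (i < n)%nat -> 0 <= s <= 1 -> 0 < fst (r i s)).
  { intros i s Hi Hs. apply unit_close_re; auto. apply HU; auto; try (apply Ht; lia).
    rewrite Htd, Rabs_pos_eq; [lra|]. left; apply Rinv_0_lt_compat; auto. }
  set (ar := fun i s => atan (snd (r i s) / fst (r i s))).
  set (Th := fix Th k s := match k with O => 0 | S k => Th k s + ar k s end).
  assert (HTh : forall k s, (k <= n)%nat -> 0 <= s <= 1 -> Eu (Th k s) = (W s (t k) * Cconj (W s 0))%C).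
  { induction k; intros s Hk Hs; simpl.
    - replace (t O) with 0 by (unfold t; simpl; field; lra). rewrite Cconj_unit; auto. unfold Eu. rewrite cos_0, sin_0. auto.
    - rewrite Eu_plus, IHk by (auto; lia). unfold ar. rewrite Eu_atan; auto.
      unfold r.
      replace (W s (t k) * Cconj (W s 0) * (W s (t (S k)) * Cconj (W s (t k))))%C with
        ((W s (t k) * Cconj (W s (t k))) * (W s (t (S k)) * Cconj (W s 0)))%C by ring.
      rewrite Cconj_unit by auto. ring. }
  assert (Htn : t n = 1) by (unfold t; field; lra).
  assert (HE : forall s, 0 <= s <= 1 -> Eu (Th n s) = 1).
  { intros s Hs. rewrite HTh; auto. rewrite Htn, <- Wl. apply Cconj_unit; auto. }
  assert (Hcont : forall k s, (k <= n)%nat -> 0 <= s <= 1 -> continuity_pt (Th k) s).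
  { induction k; intros s Hk Hs; simpl.
    - apply continuity_pt_const. intros x y; auto.
    - apply (continuity_pt_plus (Th k)); [apply IHk; auto; lia|]. unfold ar.
      assert (Cf : forall i, continuity_pt (fun s => fst (W s (t i))) s) by (intros; apply continuity_of_comp; intros z w; apply (re_le_Cmod (z - w))).
      assert (Cs : forall i, continuity_pt (fun s => snd (W s (t i))) s) by (intros; apply continuity_of_comp; intros z w; apply (im_le_Cmod (z - w))).
      apply (continuity_pt_comp (fun s => snd (r k s) / fst (r k s)) atan).
      + apply (continuity_pt_div (fun s => snd (r k s)) (fun s => fst (r k s))).
        * unfold r; simpl. apply (continuity_pt_plus (fun s => _ * _) (fun s => _ * _));
          apply (continuity_pt_mult (fun s => _) (fun s => _)); auto; apply (continuity_pt_opp (fun s => _)); auto.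
        * unfold r; simpl. apply (continuity_pt_minus (fun s => _ * _) (fun s => _ * _));
          apply (continuity_pt_mult (fun s => _) (fun s => _)); auto; apply (continuity_pt_opp (fun s => _)); auto.
        * apply Rgt_not_eq, Hrp; auto.
      + apply derivable_continuous_pt, derivable_pt_atan. }
  assert (T1 : forall k, (k <= n)%nat -> Th k 1 = 0).
  { induction k; intros Hk; simpl; auto. rewrite IHk by lia. unfold ar, r.
    rewrite (W1 (t (S k))), (W1 (t k)) by (apply Ht; lia). rewrite Cconj_unit; auto. simpl.
    unfold Rdiv. rewrite Rmult_0_l, atan_0. ring. }
  assert (C0u : Cmod c0 = 1).
  { pose proof (Wu 0 0) as Q. rewrite W0, Cmod_mult, Cmod_Eu in Q by lra. lra. }
  assert (T0 : forall k, (k <= n)%nat -> Th k 0 = INR k * (2 * PI / INR n)).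
  { induction k; intros Hk; [simpl; ring|]. rewrite S_INR. simpl Th. rewrite IHk by lia.
    assert (Er : r k 0 = Eu (2 * PI / INR n)).
    { unfold r. rewrite !W0 by (apply Ht; lia).
      replace (2 * PI * t (S k)) with (2 * PI / INR n + 2 * PI * t k) by (pose proof (Htd k); replace (t (S k)) with (t k + / INR n) by lra; field; lra).
      rewrite Eu_plus.
      replace (c0 * (Eu (2 * PI / INR n) * Eu (2 * PI * t k)) * Cconj (c0 * Eu (2 * PI * t k)))%C with
        (Eu (2 * PI / INR n) * ((c0 * Eu (2 * PI * t k)) * Cconj (c0 * Eu (2 * PI * t k))))%C by ring.
      rewrite Cconj_unit; [ring|]. rewrite Cmod_mult, Cmod_Eu, C0u; ring. }
    unfold ar. rewrite Er. unfold Eu; simpl. fold (tan (2 * PI / INR n)). rewrite atan_tan; [ring|].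
    pose proof PI_gt_3.
    assert (0 < 2 * PI / INR n) by (apply Rdiv_lt_0_compat; lra).
    assert (2 * PI / INR n < PI / 2).
    { apply Rmult_lt_reg_r with (INR n); auto. unfold Rdiv at 1. rewrite Rmult_assoc, Rinv_l by lra. nra. }
    lra. }
  assert (Tn0 : Th n 0 = 2 * PI) by (rewrite T0 by auto; field; lra).
  assert (Tn1 : Th n 1 = 0) by auto.
  pose proof PI_gt_3.
  (* The total argument goes from 2 PI to 0 and so takes the value PI, where exp(i PI) = -1
     contradicts [HE]. *)
  destruct (Ranalysis5.IVT_interv (fun s => PI - Th n s) 0 1) as [s [Hs HTs]].
  - intros s Hs. apply continuity_pt_minus; [apply continuity_pt_const; intros x y; auto|apply Hcont; auto].
  - lra.
  - lra.
  - lra.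
  - specialize (HE s Hs). replace (Th n s) with PI in HE by lra. unfold Eu in HE. rewrite cos_PI in HE.
    injection HE as HE1 _. lra.
Qed.
End Winding.

(** Retraction onto [0,1]; it extends a homotopy to all real parameters, as the section on winding
    requires. *)
Definition clamp (x : R) : R := Rmin (Rmax x 0) 1.

Lemma clamp_range x : 0 <= clamp x <= 1.
Proof. unfold clamp. split; [apply Rmin_glb; [apply Rmax_r|lra]|apply Rmin_r]. Qed.

Lemma clamp_id x : 0 <= x <= 1 -> clamp x = x.
Proof. intros H. unfold clamp. rewrite Rmax_left, Rmin_left; lra. Qed.

Lemma clamp_lip x y : Rabs (clamp x - clamp y) <= Rabs (x - y).
Proof. unfold clamp, Rmin, Rmax. repeat destruct Rle_dec; unfold Rabs; repeat destruct Rcase_abs; lra. Qed.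

Lemma Ccont_Cmod z : Ccont (fun w => RtoC (Cmod w)) z.
Proof.
  intros e He. exists e; split; auto. intros w Hw. rewrite <- RtoC_minus, Cmod_R.
  eapply Rle_lt_trans; [|apply Hw].
  pose proof (Cmod_diff_le w z). pose proof (Cmod_diff_le z w). rewrite (Cmod_minus_sym z w) in H0.
  apply Rabs_le; lra.
Qed.

Lemma cont_path_arc (p d : C) k : cont_path (fun x => p + d * Eu (k * x))%C.
Proof.
  intros t _ eps He.
  assert (Hcs : forall f, continuity f -> forall e, 0 < e -> exists dl, 0 < dl /\ forall s, Rabs (s - t) < dl ->
     Rabs (f (k * s) - f (k * t)) < e).
  { intros f Hf e Hee.
    assert (C1 : continuity_pt (fun s => f (k * s)) t).
    { apply (continuity_pt_comp (fun s => k * s) f); [|apply Hf].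
      apply (continuity_pt_mult (fun _ => k) (fun s => s)); [apply continuity_pt_const; intros x y; auto|apply continuity_pt_id]. }
    pose proof (proj1 (continuity_pt_locally _ _) C1) as C2.
    destruct (C2 (mkposreal e Hee)) as [dl Hdl]. exists dl; split; [apply cond_pos|].
    intros s Hs. apply Hdl. apply Hs. }
  pose proof (Cmod_ge_0 d) as Pd.
  set (b := Cmod d + 1).
  destruct (Hcs cos continuity_cos (eps / (2 * b))) as [d1 [Hd1 K1]]; [apply Rdiv_lt_0_compat; unfold b; lra|].
  destruct (Hcs sin continuity_sin (eps / (2 * b))) as [d2 [Hd2 K2]]; [apply Rdiv_lt_0_compat; unfold b; lra|].
  exists (Rmin d1 d2); split; [apply Rmin_pos; auto|]. intros s _ Hs. rewrite Cnorm_Cmod.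
  pose proof (Rmin_l d1 d2). pose proof (Rmin_r d1 d2).
  change (Cmod (p + d * Eu (k * s) - (p + d * Eu (k * t)))%C < eps).
  replace (p + d * Eu (k * s) - (p + d * Eu (k * t)))%C with (d * (Eu (k * s) - Eu (k * t)))%C by ring.
  rewrite Cmod_mult.
  assert (Q : Cmod (Eu (k * s) - Eu (k * t)) < eps / b).
  { eapply Rle_lt_trans; [apply Cmod_le_re_im|]. unfold Eu; cbn [fst snd Cminus Cplus Copp].
    specialize (K1 s ltac:(lra)). specialize (K2 s ltac:(lra)).
    simpl. unfold Rminus in K1, K2. replace (eps / b) with (eps / (2 * b) + eps / (2 * b)) by (field; unfold b; lra). lra. }
  apply Rle_lt_trans with (b * Cmod (Eu (k * s) - Eu (k * t))).
  - apply Rmult_le_compat_r; [apply Cmod_ge_0|unfold b; lra].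
  - apply Rmult_lt_compat_l with (r := b) in Q; [|unfold b; lra].
    replace (b * (eps / b)) with eps in Q by (field; unfold b; lra). auto.
Qed.

(** A contraction inside [E] avoids [p], so normalising its difference from [p] would give the
    family of unit loops that [winding_contradiction] rules out. *)
Lemma circle_not_null_homotopic (E : C -> Prop) (p d : C) : simply_connected E -> ~ E p ->
  d <> 0 -> (forall t, 0 <= t <= 1 -> E (p + d * Eu (2 * PI * t))%C) -> False.
Proof.
  intros HS Hp Hd HE.
  set (gam := fun t : R => (p + d * Eu (2 * PI * t))%C).
  destruct (HS gam) as [H [Hc [H0 [Hloop [H1 HEH]]]]].
  - apply cont_path_arc.
  - unfold gam. f_equal. f_equal. unfold Eu. rewrite Rmult_0_r, Rmult_1_r, cos_0, sin_0, cos_2PI, sin_2PI. auto.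
  - intros t Ht. apply HE; auto.
  - assert (Hnz : forall s t, (H (clamp s) (clamp t) - p)%C <> 0).
    { intros s t E0. apply Hp. replace p with (H (clamp s) (clamp t) : C); [apply HEH; apply clamp_range|].
      apply Ceq_minus; auto. }
    set (nf := fun z : C => ((z - p) / RtoC (Cmod (z - p)))%C).
    assert (Hmz : forall z : C, (z - p)%C <> 0 -> RtoC (Cmod (z - p)) <> 0).
    { intros z Hz Q. apply RtoC_inj in Q. apply Hz, Cmod_eq_0; auto. }
    assert (Hnfu : forall z, (z - p)%C <> 0 -> Cmod (nf z) = 1).
    { intros z Hz. unfold nf. rewrite Cmod_div by auto. rewrite Cmod_R, Rabs_pos_eq by apply Cmod_ge_0.
      field. apply Rgt_not_eq, Cmod_gt_0; auto. }
    assert (Hnfc : forall z, (z - p)%C <> 0 -> Ccont nf z).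
    { intros z Hz. unfold nf. apply Ccont_div; auto.
      - apply Ccont_minus; [apply Ccont_id|apply Ccont_const].
      - intros e He. destruct (Ccont_Cmod (z - p)%C e He) as [dl [Hdl K]]. exists dl; split; auto.
        intros w Hw. apply K. replace (w - p - (z - p))%C with (w - z)%C by ring. auto. }
    apply (winding_contradiction (fun s t => nf (H (clamp s) (clamp t)))) with (c0 := (d / RtoC (Cmod d))%C).
    + intros s t eps He. destruct (Hnfc _ (Hnz s t) eps He) as [d1 [Hd1 K1]].
      destruct (Hc (clamp s) (clamp t) (clamp_range s) (clamp_range t) d1 Hd1) as [d2 [Hd2 K2]].
      exists d2; split; auto. intros s' t' Hs Ht. apply K1. rewrite <- Cnorm_Cmod. apply K2; try apply clamp_range.
      * eapply Rle_lt_trans; [apply clamp_lip|auto].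
      * eapply Rle_lt_trans; [apply clamp_lip|auto].
    + intros s t. apply Hnfu; auto.
    + intros s. rewrite !(clamp_id 0), !(clamp_id 1) by lra. rewrite Hloop; auto. apply clamp_range.
    + intros t Ht. rewrite (clamp_id 1), (clamp_id 0), (clamp_id t) by lra. rewrite H1; auto.
    + intros t Ht. rewrite (clamp_id 0), (clamp_id t) by lra. rewrite H0 by auto. unfold gam, nf.
      replace (p + d * Eu (2 * PI * t) - p)%C with (d * Eu (2 * PI * t))%C by ring.
      rewrite Cmod_mult, Cmod_Eu, Rmult_1_r. field. intro Q. apply RtoC_inj in Q. apply Hd, Cmod_eq_0; auto.
Qed.

(** If the boundary misses the circle while [E] has points on both sides or on it, a path in [E]
    supplies a point of [E] on the circle. Going round from it without meeting the boundary keeps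
    the whole circle in [E], although it surrounds [p] outside [E]. *)
Lemma boundary_meets_circle (E : C -> Prop) (p : C) t : simply_connected_bounded_domain E -> boundary E p -> 0 < t ->
  (exists z, boundary E z /\ Cmod (z - p) = t) \/ (forall z, E z -> Cmod (z - p) < t).
Proof.
  intros [HE [_ [Hpc [HS _]]]] [Hp Hlim] Ht. apply opn_open_set in HE.
  apply NNPP; intro Hno.
  assert (Hcirc : forall z, Cmod (z - p) = t -> ~ boundary E z).
  { intros z Hz Hb. apply Hno; left; eauto. }
  assert (exists z, E z /\ t <= Cmod (z - p)) as [z [Hz Hzt]].
  { apply NNPP; intro Hn. apply Hno; right. intros z Hz. apply Rnot_le_lt; intro. apply Hn; eauto. }
  destruct (Hlim t Ht) as [w [Hw Hwt]]. rewrite Cnorm_Cmod in Hwt. change (Cmod (w - p)%C < t) in Hwt.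
  destruct (Hpc w z Hw Hz) as [gam [Hgc [Hg0 [Hg1 HgE]]]].
  destruct (path_crosses_boundary (fun z => Cmod (z - p) < t) gam) as [tau [Htau [Hb1 Hb2]]]; auto.
  { apply opn_disc. } { rewrite Hg0; auto. } { rewrite Hg1; lra. }
  assert (Hc : exists c : C, c = gam tau) by (eexists; reflexivity).
  destruct Hc as [c Hc]. rewrite <- Hc in Hb1, Hb2.
  assert (Hct : Cmod (c - p) = t).
  { apply Rle_antisym; [|lra]. apply Rnot_lt_le; intro.
    destruct (Hb2 (Cmod (c - p) - t)) as [w' [Hw1 Hw2]]; [lra|]. rewrite Cnorm_Cmod in Hw2. change (Cmod (w' - c)%C < Cmod (c - p) - t) in Hw2.
    pose proof (Cmod_tri c w' p). rewrite (Cmod_minus_sym c w') in H0. lra. }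
  assert (HcE : E c) by (rewrite Hc; apply HgE; auto).
  set (d := (c - p)%C).
  assert (Hd : d <> 0) by (apply Cmod_gt_0; unfold d; lra).
  apply (circle_not_null_homotopic E p d HS Hp Hd).
  intros s Hs. apply NNPP; intro Hns.
  destruct (path_crosses_boundary E (fun x => (p + d * Eu (2 * PI * s * x))%C)) as [x [Hx Hbx]]; auto.
  - apply cont_path_arc.
  - rewrite Rmult_0_r. replace (p + d * Eu 0)%C with c; auto.
    unfold Eu. rewrite cos_0, sin_0. change ((1, 0)) with (RtoC 1). unfold d. ring.
  - rewrite Rmult_1_r. auto.
  - apply (Hcirc _) in Hbx; auto. replace (p + d * Eu (2 * PI * s * x) - p)%C with (d * Eu (2 * PI * s * x))%C by ring.
    rewrite Cmod_mult, Cmod_Eu. unfold d. lra.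
Qed.

(** * Counting cells near a boundary of finite length *)

Lemma rsumL_app {X} (l m : list X) f : rsumL (l ++ m) f = rsumL l f + rsumL m f.
Proof. induction l; simpl; [ring|]. rewrite IHl; ring. Qed.

Lemma rsumL_map {X Y} (h : X -> Y) l f : rsumL (map h l) f = rsumL l (fun x => f (h x)).
Proof. induction l; simpl; auto. rewrite IHl; auto. Qed.

(** Remove an interval covering the right end [b]; the others cover everything to the left of it. *)
Lemma interval_cover_length n : forall (l : list (R * R)) a b, length l = n ->
  (forall x, a <= x <= b -> exists I, In I l /\ Rabs (x - fst I) < snd I) ->
  (forall I, In I l -> 0 <= snd I) -> b - a <= rsumL l (fun I => 2 * snd I).
Proof.
  induction n; intros l a b Hl Hc Hp.
  - destruct l; [|discriminate]. simpl. destruct (Rle_dec a b); [|lra].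
    destruct (Hc a) as [I [[] _]]. lra.
  - assert (S0 : 0 <= rsumL l (fun I => 2 * snd I)).
    { apply rsumL_nonneg. intros I HI; specialize (Hp I HI); lra. }
    destruct (Rle_dec a b); [|lra].
    destruct (Hc b) as [I [HI Hb]]; [lra|]. destruct (in_split _ _ HI) as [l1 [l2 E]].
    assert (IH : fst I - snd I - a <= rsumL (l1 ++ l2) (fun I => 2 * snd I)).
    { apply IHn.
      - rewrite E, length_app in Hl. rewrite length_app. simpl in Hl. lia.
      - intros x Hx. apply Rabs_lt_between in Hb. destruct (Hc x) as [I' [HI' Hx']]; [lra|].
        exists I'; split; auto. rewrite E in HI'. apply in_app_iff in HI'. apply in_app_iff.
        destruct HI' as [|[<-|]]; auto. apply Rabs_lt_between in Hx'. lra.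
      - intros I' HI'. apply Hp. rewrite E. apply in_app_iff in HI'. apply in_app_iff. simpl. tauto. }
    rewrite rsumL_app in IH. rewrite E, rsumL_app. simpl. apply Rabs_lt_between in Hb. lra.
Qed.

Lemma interval_cover_finite (c r : nat -> R) (P : nat -> Prop) a b : a <= b ->
  (forall x, a <= x <= b -> exists i, P i /\ Rabs (x - c i) < r i) ->
  exists n, forall x, a <= x <= b -> exists i, (i < n)%nat /\ P i /\ Rabs (x - c i) < r i.
Proof.
  intros Hab Hc.
  set (Q := fun x => a <= x <= b /\ exists n, forall y, a <= y <= x -> exists i, (i < n)%nat /\ P i /\ Rabs (y - c i) < r i).
  assert (Qa : Q a).
  { split; [lra|]. destruct (Hc a) as [i [Hi1 Hi2]]; [lra|]. exists (S i). intros y Hy.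
    exists i. replace y with a by lra. auto. }
  destruct (completeness Q) as [tau [U1 U2]].
  { exists b. intros x [Hx _]; lra. } { exists a; auto. }
  assert (Ht1 : a <= tau) by (apply U1; auto).
  assert (Ht2 : tau <= b) by (apply U2; intros x [Hx _]; lra).
  destruct (Hc tau) as [k [Hk1 Hk2]]; [lra|]. apply Rabs_lt_between in Hk2.
  assert (exists t, Q t /\ c k - r k < t) as [t [[Ht [n Hn]] Htk]].
  { apply NNPP; intro N. assert (tau <= c k - r k); [|lra]. apply U2. intros x Hx.
    apply Rnot_lt_le; intro. apply N; eauto. }
  assert (Hcov : forall y, a <= y -> y < c k + r k -> exists i, (i < Nat.max n (S k))%nat /\ P i /\ Rabs (y - c i) < r i).
  { intros y Hy1 Hy2. destruct (Rle_dec y t).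
    - destruct (Hn y) as [i [Hi1 Hi2]]; [lra|]. exists i; split; auto. lia.
    - exists k. repeat split; auto; [lia|]. apply Rabs_lt_between; lra. }
  destruct (Rlt_dec b (c k + r k)).
  - exists (Nat.max n (S k)). intros x Hx. apply Hcov; lra.
  - exfalso. assert ((tau + (c k + r k)) / 2 <= tau); [|lra]. apply U1. split; [lra|].
    exists (Nat.max n (S k)). intros y Hy. apply Hcov; lra.
Qed.

Lemma sum_half_pow n : rsumL (seq 0 n) (fun i => (1/2)^i) <= 2.
Proof.
  assert (H : rsumL (seq 0 n) (fun i => (1/2)^i) = 2 - 2 * (1/2)^n).
  { induction n; [simpl; ring|]. rewrite seq_S, rsumL_app, IHn. simpl. field. }
  rewrite H. assert (0 < (1/2)^n) by (apply pow_lt; lra). lra.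
Qed.

(* The images of the covering sets under [z |-> |z - p|] cover the interval [1/8, 3/8] of radii. *)
Lemma boundary_mass (E : C -> Prop) (p : C) (U : nat -> C -> Prop) (d : nat -> R) :
  (forall t, 1/8 <= t <= 3/8 -> exists z, boundary E z /\ Cmod (z - p) = t) ->
  (forall i, 0 <= d i) -> (forall i z w, U i z -> U i w -> Cmod (z - w) <= d i) ->
  (forall z, boundary E z -> exists i, U i z) ->
  exists n0, forall n, (n0 <= n)%nat ->
    1/16 <= rsumL (seq 0 n) (fun i => ifP (exists z, U i z /\ Cmod (z - p) <= 1/2) (d i) 0).
Proof.
  intros Hm Hd Hdiam Hcov.
  set (P := fun i => exists z, U i z /\ Cmod (z - p) <= 1/2).
  assert (Hch : forall i, exists z : C, P i -> U i z /\ Cmod (z - p) <= 1/2).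
  { intros i. destruct (classic (P i)) as [[z Hz]|N]; [exists z; auto|exists p; tauto]. }
  set (ch := fun i => proj1_sig (constructive_indefinite_description _ (Hch i))).
  assert (Hchs : forall i, P i -> U i (ch i) /\ Cmod (ch i - p) <= 1/2).
  { intros i. unfold ch. destruct constructive_indefinite_description; auto. }
  (* The added terms make the intervals open at a total cost of at most 2 (2/64) = 1/16, so from the
     length 1/4 to be covered at least 1/16 remains for the diameters. *)
  set (c := fun i => Cmod (ch i - p)). set (r := fun i => d i + 1/64 * (1/2)^i).
  assert (Hr : forall i, d i < r i) by (intros i; unfold r; assert (0 < (1/2)^i) by (apply pow_lt; lra); lra).
  destruct (interval_cover_finite c r P (1/8) (3/8)) as [n0 Hn0]; [lra| |].
  { intros x Hx. destruct (Hm x Hx) as [z [Hz Hzx]]. destruct (Hcov z Hz) as [i Hi].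
    assert (HP : P i) by (exists z; split; auto; lra). exists i; split; auto.
    destruct (Hchs i HP) as [Hc1 Hc2]. eapply Rle_lt_trans; [|apply Hr].
    unfold c. rewrite <- Hzx. pose proof (Hdiam i z (ch i) Hi Hc1).
    pose proof (Cmod_tri z (ch i) p). pose proof (Cmod_tri (ch i) z p). rewrite (Cmod_minus_sym (ch i) z) in H1.
    apply Rabs_le; lra. }
  exists n0. intros n Hn.
  assert (L : 3/8 - 1/8 <= rsumL (map (fun i => (c i, ifP (P i) (r i) 0)) (seq 0 n)) (fun I => 2 * snd I)).
  { eapply interval_cover_length; [reflexivity| |].
    - intros x Hx. destruct (Hn0 x Hx) as [i [Hi1 [Hi2 Hi3]]]. exists (c i, ifP (P i) (r i) 0). split.
      + apply in_map_iff. exists i; split; auto. apply in_seq. lia.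
      + simpl. unfold ifP. destruct excluded_middle_informative; [auto|tauto].
    - intros I HI. apply in_map_iff in HI. destruct HI as [i [<- _]]. simpl. unfold ifP.
      destruct excluded_middle_informative; [|lra]. specialize (Hr i); specialize (Hd i); lra. }
  rewrite rsumL_map in L. simpl in L.
  assert (L2 : rsumL (seq 0 n) (fun i => 2 * ifP (P i) (r i) 0) <=
    rsumL (seq 0 n) (fun i => 2 * ifP (P i) (d i) 0 + 1/32 * (1/2)^i)).
  { apply rsumL_le. intros i _. unfold r, ifP. assert (0 < (1/2)^i) by (apply pow_lt; lra).
    destruct excluded_middle_informative; lra. }
  rewrite rsumL_plus, !rsumL_scal in L2. pose proof (sum_half_pow n). rewrite rsumL_scal in L. change (rsumL (seq 0 n) (pow (1/2)) <= 2) in H. change (1 / 16 <= rsumL (seq 0 n) (fun i => ifP (P i) (d i) 0)). lra.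
Qed.

Lemma length_box k : length (box k) = ((2 * k + 1) * (2 * k + 1))%nat.
Proof. unfold box, zr. rewrite length_prod, length_map, length_seq. auto. Qed.

(** All cells lie in one box around the first of them. *)
Lemma close_cells_count (l : list (Z * Z)) k : NoDup l -> (forall p q, In p l -> In q l -> (cd p q <= Z.of_nat k)%Z) ->
  (length l <= (2 * k + 1) * (2 * k + 1))%nat.
Proof.
  intros Hn H. destruct l as [|p l]; [simpl; lia|].
  rewrite <- length_box, <- (length_map (fun q => (fst p + fst q, snd p + snd q)%Z) (box k)).
  apply NoDup_incl_length; auto. intros q Hq. apply in_map_iff.
  exists (fst q - fst p, snd q - snd p)%Z. split.
  - simpl. destruct q; simpl; f_equal; ring.
  - apply in_box. simpl. specialize (H p q (or_introl eq_refl) Hq). unfold cd in H. lia.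
Qed.

Lemma rsumL_count {X} (l : list X) (P : X -> Prop) c :
  rsumL l (fun x => ifP (P x) c 0) = INR (length (filter (fun x => if excluded_middle_informative (P x) then true else false) l)) * c.
Proof.
  induction l as [|x l IH]; simpl filter; [simpl; ring|]. cbn [rsumL]. rewrite IH. unfold ifP.
  destruct excluded_middle_informative; [|ring]. cbn [length]. rewrite S_INR. ring.
Qed.

Lemma rsumL_const {X} (l : list X) c : rsumL l (fun _ => c) = INR (length l) * c.
Proof. induction l; simpl length; [simpl; ring|]. simpl rsumL. rewrite IHl, S_INR. ring. Qed.

Lemma hausdorff1_le_nonneg A M : hausdorff1_le A M -> 0 <= M.
Proof.
  intros H. apply Rnot_lt_le; intro N. destruct (H 1 (- M / 2)) as [U [d [H1 [_ [_ H2]]]]]; try lra.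
  specialize (H2 O). simpl in H2. specialize (H1 O). lra.
Qed.

Lemma sum_f_R0_rsumL d n : sum_f_R0 d n = rsumL (seq 0 (S n)) d.
Proof. induction n; [simpl; ring|]. rewrite seq_S, rsumL_app. simpl sum_f_R0. rewrite IHn. simpl. ring. Qed.

Section Count.
Variables (e u v : R).
Hypothesis He : 0 < e.

Lemma cd_of_close p q k : Rabs (gx e u (fst p) - gx e u (fst q)) <= INR k * e -> Rabs (gy e v (snd p) - gy e v (snd q)) <= INR k * e ->
  (cd p q <= Z.of_nat k)%Z.
Proof.
  unfold gx, gy. intros H1 H2. rewrite INR_IZR_INZ in *.
  apply Rabs_le_between in H1, H2.
  assert (A1 : IZR (fst p) - IZR (fst q) <= IZR (Z.of_nat k)) by (apply Rmult_le_reg_r with e; lra).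
  assert (A2 : IZR (fst q) - IZR (fst p) <= IZR (Z.of_nat k)) by (apply Rmult_le_reg_r with e; lra).
  assert (A3 : IZR (snd p) - IZR (snd q) <= IZR (Z.of_nat k)) by (apply Rmult_le_reg_r with e; lra).
  assert (A4 : IZR (snd q) - IZR (snd p) <= IZR (Z.of_nat k)) by (apply Rmult_le_reg_r with e; lra).
  rewrite <- minus_IZR in *. apply le_IZR in A1, A2, A3, A4. unfold cd. lia.
Qed.

(** Double counting: each cell has a boundary point nearby, around which covering sets of total
    diameter at least 1/16 accumulate, and each covering set is charged by a bounded number of
    cells. *)
Lemma count_near_boundary (E : C -> Prop) M W k (Q : list (Z * Z)) : simply_connected_bounded_domain E ->
  hausdorff1_le (boundary E) M -> 0 <= W -> 4 * W + 4 <= INR k * e -> NoDup Q ->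
  (forall q, In q Q -> (exists p, boundary E p /\ insq (gx e u (fst q), gy e v (snd q)) W p) /\
     (exists z, E z /\ insq (gx e u (fst q), gy e v (snd q)) W z)) ->
  INR (length Q) <= 16 * (INR ((2 * k + 1) * (2 * k + 1))) * (M + 1).
Proof.
  intros HE HM HW Hk Hnd HQ. set (K := ((2 * k + 1) * (2 * k + 1))%nat).
  pose proof (hausdorff1_le_nonneg _ _ HM) as HM0.
  assert (HK : 0 <= INR K) by apply pos_INR.
  assert (Hclose : forall q q' (z z' : C), insq (gx e u (fst q), gy e v (snd q)) W z -> insq (gx e u (fst q'), gy e v (snd q')) W z' ->
     Cmod (z - z') <= 4 -> (cd q q' <= Z.of_nat k)%Z).
  { intros q q' z z' Hz Hz' Hzz. apply mod_insq in Hzz.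
    unfold insq, inrect in *; cbn [fst snd] in *. apply cd_of_close; apply Rabs_le; lra. }
  destruct (classic (exists p t, boundary E p /\ 1/8 <= t <= 3/8 /\ forall z, E z -> Cmod (z - p) < t)) as [[p0 [t [Hp0 [Ht Hin]]]]|Hall].
  - assert (L : (length Q <= K)%nat).
    { apply close_cells_count; auto. intros q q' Hq Hq'. destruct (HQ q Hq) as [_ [z [Hz1 Hz2]]].
      destruct (HQ q' Hq') as [_ [z' [Hz1' Hz2']]]. apply (Hclose q q' z z'); auto.
      pose proof (Hin z Hz1). pose proof (Hin z' Hz1'). pose proof (Cmod_tri z p0 z') as T1.
      rewrite (Cmod_minus_sym p0 z') in T1. lra. }
    apply le_INR in L. nra.
  - assert (Hch : forall q, exists p : C, In q Q -> boundary E p /\ insq (gx e u (fst q), gy e v (snd q)) W p).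
    { intros q. destruct (classic (In q Q)) as [Hq|]; [|exists (RtoC 0); tauto].
      destruct (HQ q Hq) as [[p Hp] _]. exists p; auto. }
    set (ch := fun q => proj1_sig (constructive_indefinite_description _ (Hch q))).
    assert (Hchs : forall q, In q Q -> boundary E (ch q) /\ insq (gx e u (fst q), gy e v (snd q)) W (ch q)).
    { intros q. unfold ch. destruct constructive_indefinite_description; auto. }
    destruct (HM (1/8) 1) as [U [d [Hd [Hdiam [Hcov Hsum]]]]]; try lra.
    assert (Hmass : forall q, In q Q -> exists n0, forall n, (n0 <= n)%nat ->
       1/16 <= rsumL (seq 0 n) (fun i => ifP (exists z, U i z /\ Cmod (z - ch q) <= 1/2) (d i) 0)).
    { intros q Hq. apply boundary_mass with E; auto.
      - intros t Ht. destruct (Hchs q Hq) as [Hb _].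
        destruct (boundary_meets_circle E (ch q) t HE Hb) as [|Hin]; auto; [lra|].
        exfalso. apply Hall. exists (ch q), t. auto.
      - intros i; apply Hd.
      - intros i z w Hz Hw. rewrite <- Cnorm_Cmod. apply (Hdiam i z w); auto. }
    assert (Hn : exists n, forall q, In q Q ->
       1/16 <= rsumL (seq 0 (S n)) (fun i => ifP (exists z, U i z /\ Cmod (z - ch q) <= 1/2) (d i) 0)).
    { assert (Hall' : exists N, forall q, In q Q -> forall n, (N <= n)%nat ->
        1/16 <= rsumL (seq 0 n) (fun i => ifP (exists z, U i z /\ Cmod (z - ch q) <= 1/2) (d i) 0)).
      { clearbody ch. clear - Hmass. induction Q as [|a l IH]; [exists O; simpl; tauto|].
        destruct IH as [N HN]; [intros; apply Hmass; simpl; auto|].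
        destruct (Hmass a (or_introl eq_refl)) as [N' HN']. exists (Nat.max N N').
        intros q' [<-|Hq'] n Hn; [apply HN'; lia|apply HN; auto; lia]. }
      destruct Hall' as [N HN]. exists N. intros q' Hq'. apply HN; auto. }
    destruct Hn as [n Hn].
    assert (S1 : INR (length Q) * (1/16) <= rsumL Q (fun q => rsumL (seq 0 (S n)) (fun i => ifP (exists z, U i z /\ Cmod (z - ch q) <= 1/2) (d i) 0))).
    { rewrite <- rsumL_const. apply rsumL_le; auto. }
    rewrite rsumL_swap in S1.
    (* A set of diameter at most 1/8 meets discs of radius 1/2 only around points within 9/8 of each
       other, hence is charged by at most [K] cells. *)
    assert (S2 : rsumL (seq 0 (S n)) (fun i => rsumL Q (fun q => ifP (exists z, U i z /\ Cmod (z - ch q) <= 1/2) (d i) 0)) <=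
       rsumL (seq 0 (S n)) (fun i => INR K * d i)).
    { apply rsumL_le. intros i _. rewrite rsumL_count. apply Rmult_le_compat_r; [apply Hd|]. apply le_INR.
      apply close_cells_count; [apply NoDup_filter; auto|].
      intros q q' Hq Hq'. apply filter_In in Hq, Hq'. destruct Hq as [Hq Hr], Hq' as [Hq' Hr'].
      destruct excluded_middle_informative as [[z [Hz1 Hz2]]|] in Hr; [|discriminate].
      destruct excluded_middle_informative as [[z' [Hz1' Hz2']]|] in Hr'; [|discriminate].
      apply (Hclose q q' (ch q) (ch q')); [apply Hchs; auto|apply Hchs; auto|].
      pose proof (Hdiam i z z' Hz1 Hz1') as Hdd. rewrite Cnorm_Cmod in Hdd. change (Cmod (z - z')%C <= d i) in Hdd.
      destruct (Hd i) as [_ Hdi]. pose proof (Cmod_tri (ch q) z (ch q')) as T1. pose proof (Cmod_tri z z' (ch q')) as T2.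
      rewrite (Cmod_minus_sym (ch q) z) in T1. lra. }
    rewrite rsumL_scal in S2. specialize (Hsum n). rewrite sum_f_R0_rsumL in Hsum.
    assert (S3 : INR (length Q) * (1/16) <= INR K * rsumL (seq 0 (S n)) d) by (eapply Rle_trans; [apply S1|apply S2]).
    assert (S4 : INR K * rsumL (seq 0 (S n)) d <= INR K * (M + 1)) by (apply Rmult_le_compat_l; auto). lra.
Qed.

Lemma cell_in_insq q p w k : (cd q p <= k)%Z -> cell e u v p w ->
  insq (gx e u (fst q), gy e v (snd q)) ((IZR k + 2) * e) w.
Proof.
  intros Hp [Hx Hy]. rewrite gx_1 in Hx. rewrite gy_1 in Hy. unfold gx, gy in *.
  unfold insq, inrect; cbn [fst snd].
  assert (A1 : IZR (fst p) - IZR (fst q) <= IZR k) by (rewrite <- minus_IZR; apply IZR_le; unfold cd in Hp; lia).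
  assert (A2 : IZR (fst q) - IZR (fst p) <= IZR k) by (rewrite <- minus_IZR; apply IZR_le; unfold cd in Hp; lia).
  assert (A3 : IZR (snd p) - IZR (snd q) <= IZR k) by (rewrite <- minus_IZR; apply IZR_le; unfold cd in Hp; lia).
  assert (A4 : IZR (snd q) - IZR (snd p) <= IZR k) by (rewrite <- minus_IZR; apply IZR_le; unfold cd in Hp; lia).
  unfold gx, gy. nra.
Qed.

Lemma cell_diam q z w : cell e u v q z -> cell e u v q w -> Cmod (z - w) <= 2 * e.
Proof.
  intros [Hx Hy] [Hx' Hy']. rewrite gx_1 in Hx, Hx'. rewrite gy_1 in Hy, Hy'. apply insq_mod.
  unfold insq, inrect. lra.
Qed.

(** A shallow cell has a point of [E] and, within the margin, a point outside [E]. The segment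
    between them crosses the boundary and stays in the square, which is convex. *)
Lemma shallow_near_boundary N (E : C -> Prop) q : opn E -> shallow e u v N E E q ->
  let W := (IZR (margin N) + 2) * e in
  (exists p, boundary E p /\ insq (gx e u (fst q), gy e v (snd q)) W p) /\
  (exists z, E z /\ insq (gx e u (fst q), gy e v (snd q)) W z).
Proof.
  intros HE [Hnd [z [Hz HEz]]] W.
  assert (Hm : 0 <= IZR (margin N)) by (apply IZR_le; unfold margin; lia).
  pose proof (fun p w => cell_in_insq q p w (margin N)) as Hcorner. fold W in Hcorner.
  assert (Hzin : insq (gx e u (fst q), gy e v (snd q)) W z).
  { apply (Hcorner q); auto. unfold cd, margin. lia. }
  split; [|exists z; auto].
  assert (exists p w, (cd q p <= margin N)%Z /\ cell e u v p w /\ ~ E w) as [p [w [Hp [Hw HEw]]]].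
  { apply NNPP; intro Hn. apply Hnd. intros p w Hp Hw. apply NNPP; intro. apply Hn; eauto. }
  assert (Hwin : insq (gx e u (fst q), gy e v (snd q)) W w) by (apply (Hcorner p); auto).
  set (sg := fun t : R => (z + t * (w - z))%C).
  destruct (path_crosses_boundary E sg) as [t [Ht Hb]]; auto.
  - intros t _ eps Heps. pose proof (Cmod_ge_0 (w - z)).
    exists (eps / (Cmod (w - z) + 1)). split; [apply Rdiv_lt_0_compat; lra|]. intros s _ Hs.
    rewrite Cnorm_Cmod. change (Cmod ((z + s * (w - z)) - (z + t * (w - z)))%C < eps).
    replace ((z + s * (w - z)) - (z + t * (w - z)))%C with ((s - t)%R * (w - z))%C by (rewrite RtoC_minus; ring).
    rewrite Cmod_mult, Cmod_R.
    apply Rle_lt_trans with (Rabs (s - t) * (Cmod (w - z) + 1)).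
    + apply Rmult_le_compat_l; [apply Rabs_pos|lra].
    + apply Rmult_lt_compat_r with (r := Cmod (w - z) + 1) in Hs; [|lra].
      replace (eps / (Cmod (w - z) + 1) * (Cmod (w - z) + 1)) with eps in Hs by (field; lra). auto.
  - unfold sg. replace (z + 0 * (w - z))%C with z by ring. auto.
  - unfold sg. replace (z + 1 * (w - z))%C with w by ring. auto.
  - exists (sg t). split; auto. unfold insq, inrect, sg in *; cbn [fst snd] in *.
    simpl. destruct Hzin as [Hz1 Hz2], Hwin as [Hw1 Hw2].
    set (X := gx e u (fst q)) in *. set (Y := gy e v (snd q)) in *. clearbody X Y W.
    rewrite !Rmult_0_l. rewrite Rminus_0_r, Rplus_0_r. repeat split; nra.
Qed.
End Count.

(** * Conclusion *)

Lemma avoid_finite (ys : list R) e : 0 < e -> exists s, 0 < s < e /\ ~ In s ys.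
Proof.
  intros He. assert (H : exists d, 0 < d <= e /\ forall y, In y ys -> y <= 0 \/ d <= y).
  { induction ys as [|y ys [d [Hd H]]]; [exists e; simpl; split; [lra|tauto]|].
    destruct (Rle_dec y 0).
    - exists d; split; auto. intros y' [<-|Hy']; auto.
    - exists (Rmin d y). pose proof (Rmin_l d y). pose proof (Rmin_r d y). split.
      + split; [apply Rmin_pos; lra|lra].
      + intros y' [<-|Hy']; [right; lra|]. destruct (H y' Hy'); [auto|right; lra]. }
  destruct H as [d [Hd H]]. exists (d/2). split; [lra|]. intro Hin. destruct (H _ Hin); lra.
Qed.

(** Each [x] excludes one offset in (0,e) at most, its residue modulo [e]. *)
Lemma generic_offset (xs : list R) e : 0 < e -> exists u, 0 < u < e /\ forall x i, In x xs -> x <> u + IZR i * e.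
Proof.
  intros He.
  destruct (avoid_finite (map (fun x => x - IZR (Int_part ((x - 0) / e)) * e) xs) e He) as [s [Hs Hn]].
  exists s; split; auto. intros x i Hx E. apply Hn. apply in_map_iff. exists x; split; auto.
  assert (A1 : (i <= Int_part ((x - 0) / e))%Z) by (apply (floor_ge e He 0); lra).
  assert (A2 : (Int_part ((x - 0) / e) < i + 1)%Z) by (apply (floor_lt e He 0); rewrite plus_IZR; lra).
  replace (Int_part ((x - 0) / e)) with i by lia. lra.
Qed.

Lemma box_exists e u v M0 : 0 < e -> exists T, (1 <= T)%nat /\ forall p z, cell e u v p z -> Cmod z <= M0 -> In p (box (T - 1)).
Proof.
  intros He. destruct (INR_unbounded ((M0 + e + Rabs u + Rabs v) / e)) as [n Hn].
  exists (S n). split; [lia|]. intros p z [Hx Hy] Hz. rewrite gx_1 in Hx. rewrite gy_1 in Hy. unfold gx, gy in *.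
  replace (S n - 1)%nat with n by lia.
  assert (Hn' : M0 + e + Rabs u + Rabs v < INR n * e).
  { apply Rmult_lt_compat_r with (r := e) in Hn; auto. unfold Rdiv in Hn. rewrite Rmult_assoc, Rinv_l in Hn; lra. }
  pose proof (re_le_Cmod z) as A. pose proof (im_le_Cmod z) as B.
  assert (A' : Rabs (fst z) <= M0) by lra. assert (B' : Rabs (snd z) <= M0) by lra. apply Rabs_le_between in A', B'.
  pose proof (Rle_abs u). pose proof (Rle_abs (- u)). pose proof (Rle_abs v). pose proof (Rle_abs (- v)). rewrite Rabs_Ropp in *.
  pose proof (Rabs_pos u). pose proof (Rabs_pos v).
  rewrite INR_IZR_INZ in Hn'. apply in_box.
  assert (IZR (fst p) < IZR (Z.of_nat n)) by (apply Rmult_lt_reg_r with e; lra).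
  assert (- IZR (Z.of_nat n) < IZR (fst p)) by (apply Rmult_lt_reg_r with e; lra).
  assert (IZR (snd p) < IZR (Z.of_nat n)) by (apply Rmult_lt_reg_r with e; lra).
  assert (- IZR (Z.of_nat n) < IZR (snd p)) by (apply Rmult_lt_reg_r with e; lra).
  rewrite <- opp_IZR in *. apply lt_IZR in H5, H6, H7, H8. lia.
Qed.

(** [regular] with the scale [e] and the bound [B] fixed in advance, so that the constants can be
    chosen before the translation. *)
Definition regular_with (rho : R) (N : nat) (e B : R) (nu : C -> Z) (Lm : C -> C) : Prop :=
  (forall a l, NoDup l -> (forall b, In b l -> insq a rho b) -> (nsum nu l <= N)%nat) /\
  (forall w, (forall b, insq w (e / 2) b -> nu b = 0%Z) -> Cmod (Lm w) <= B) /\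
  (forall a, exists r H, 0 < r /\ hol (fun z => Cmod (z - a) < r) H /\
     forall w, Cmod (w - a) < r -> w <> a \/ nu a = 0%Z -> Lm w = (IZR (nu a) * / (w - a) + H w)%C).

Lemma cder_shift f (c z l : C) : cder f (z + c)%C l -> cder (fun w => f (w + c)%C) z l.
Proof.
  intros [q [Hq [Hl Hf]]]. exists (fun w => q (w + c)%C). split; [|split; auto].
  - intros eps He. destruct (Hq eps He) as [d [Hd H]]. exists d; split; auto. intros w Hw. apply H.
    replace (w + c - (z + c))%C with (w - z)%C by ring. auto.
  - intros w. rewrite (Hf (w + c)%C). ring.
Qed.

(** The reason why one constant serves all translates of the divisor: the parameters do not
    change. *)
Lemma regular_with_translate rho N e B nu Lm (c : C) : regular_with rho N e B nu Lm ->
  regular_with rho N e B (fun w => nu (w + c)%C) (fun w => Lm (w + c)%C).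
Proof.
  intros [H1 [H2 H3]]. split; [|split].
  - intros a l Hnd Hin.
    replace (nsum (fun w => nu (w + c)%C) l) with (nsum nu (map (fun w => w + c)%C l)).
    + apply (H1 (a + c)%C).
      * apply Injective_map_NoDup; auto. intros x y E. replace x with (x + c - c)%C by ring. rewrite E. ring.
      * intros b Hb. apply in_map_iff in Hb. destruct Hb as [b' [<- Hb']]. specialize (Hin b' Hb').
        unfold insq, inrect in *; simpl. lra.
    + clear. induction l; simpl; auto.
  - intros w Hw. apply H2. intros b Hb. replace b with ((b - c) + c)%C by ring. apply Hw.
    unfold insq, inrect in *; simpl in *. lra.
  - intros a. destruct (H3 (a + c)%C) as [r [H [Hr [HH E]]]]. exists r, (fun w => H (w + c)%C). split; auto. split.
    + intros z Hz. destruct (HH (z + c)%C) as [l Hl]; [replace (z + c - (a + c))%C with (z - a)%C by ring; auto|].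
      exists l. apply cder_shift; auto.
    + intros w Hw Hc. rewrite E.
      * do 2 f_equal. f_equal. ring.
      * replace (w + c - (a + c))%C with (w - a)%C by ring. auto.
      * destruct Hc as [Hc|]; auto. left. intro T. apply Hc. replace w with (w + c - c)%C by ring. rewrite T; ring.
Qed.

Section Main.
Variables (rho : R) (N : nat) (e B : R).
Hypothesis He : 0 < e.
Hypothesis HB0 : 0 <= B.
Hypothesis Hrho : (3 * INR N + 3) * e <= rho.
(** The square of half-side [W] around the corner of a cell contains all cells within the margin.
    For the annuli, 20 W <= 1 keeps the modulus within a factor 2 of the radius on cells near a
    circle of radius above 1. *)
Let W := (IZR (margin N) + 2) * e.
Hypothesis HW : 20 * W <= 1.

Lemma W_pos : e <= W.
Proof. unfold W. assert (0 <= IZR (margin N)) by (apply IZR_le; unfold margin; lia). nra. Qed.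

(* [grid_bound] with an offset chosen so that no point of the divisor lies on the grid *)
Lemma offset_bound nu Lm (A A' : C -> Prop) g (Ls : list C) M0 : regular_with rho N e B nu Lm ->
  opn A -> (forall z, A z -> A' z) -> hol A g -> NoDup Ls -> (forall b, In b Ls <-> A' b /\ nu b <> 0%Z) ->
  (forall z, A' z -> Cmod z <= M0) ->
  exists u v, 0 < u < e /\ 0 < v < e /\ exists T, forall G : Z * Z -> R, (forall p, 0 <= G p) ->
   (forall p, ~ shallow e u v N A A' p -> G p = 0) ->
   (forall p z, shallow e u v N A A' p -> cell e u v p z -> A' z -> Cmod (g z) <= G p) ->
   Cmod (csumL Ls (fun b => IZR (nu b) * g b)%C) <= (8 * e * B + INR N) * rsumL (box T) G.
Proof.
  intros [H1 [H2 H3]] HA HAA Hg Hnd HL Hbd.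
  destruct (generic_offset (map fst Ls) e He) as [u [Hu Hu']].
  destruct (generic_offset (map snd Ls) e He) as [v [Hv Hv']].
  exists u, v. do 2 (split; [auto|]). destruct (box_exists e u v M0 He) as [T [HT1 HT]].
  exists T. intros G HG0 HG1 HGg.
  apply (grid_bound e u v He nu Lm rho N B H1 H2 H3 Hrho A A' g Ls G T); auto.
  - intros b i Hb. split; [apply Hu'|apply Hv']; apply in_map; auto.
  - intros p z Hp Hz. apply (HT p z); auto.
Qed.

(** [G] is [S] on shallow cells and 0 elsewhere, so its sum is [S] times the number counted by
    [count_near_boundary]. *)
Lemma domain_bound : exists Cst, 0 <= Cst /\ forall nu Lm, regular_with rho N e B nu Lm ->
  forall (E : C -> Prop) M (Ls : list C) g S, simply_connected_bounded_domain E -> hausdorff1_le (boundary E) M ->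
  NoDup Ls -> (forall b, In b Ls <-> E b /\ nu b <> 0%Z) -> hol E g -> (forall z, E z -> Cmod (g z) <= S) ->
  Cmod (csumL Ls (fun b => IZR (nu b) * g b)%C) <= Cst * S * (M + 1).
Proof.
  destruct (INR_unbounded ((4 * W + 4) / e)) as [k Hk].
  assert (Hk' : 4 * W + 4 <= INR k * e).
  { apply Rmult_lt_compat_r with (r := e) in Hk; auto. unfold Rdiv in Hk. rewrite Rmult_assoc, Rinv_l in Hk; lra. }
  assert (Hc0 : 0 <= 8 * e * B + INR N) by (pose proof (pos_INR N); assert (0 <= e * B) by (apply Rmult_le_pos; lra); lra).
  set (K := INR ((2 * k + 1) * (2 * k + 1))). assert (HK : 0 <= K) by apply pos_INR.
  exists ((8 * e * B + INR N) * (16 * K)). split; [apply Rmult_le_pos; lra|].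
  intros nu Lm HR E M Ls g S HE HM Hnd HL Hg HS.
  destruct HE as [HE1 [[z0 Hz0] [HE3 [HE4 [M0 HM0]]]]].
  assert (HEopn : opn E) by (apply opn_open_set; auto).
  destruct (offset_bound nu Lm E E g Ls M0 HR) as [u [v [Hu [Hv [T HT]]]]]; auto.
  { intros z Hz. rewrite <- Cnorm_Cmod. auto. }
  assert (HS0 : 0 <= S) by (eapply Rle_trans; [apply Cmod_ge_0|apply (HS z0 Hz0)]).
  eapply Rle_trans; [apply (HT (fun p => ifP (shallow e u v N E E p) S 0))|].
  - intros p. unfold ifP. destruct excluded_middle_informative; lra.
  - intros p Hp. unfold ifP. destruct excluded_middle_informative; tauto.
  - intros p z Hp Hz Hez. unfold ifP. destruct excluded_middle_informative; [auto|tauto].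
  - rewrite rsumL_count. set (Q := filter _ (box T)).
    assert (HQ : INR (length Q) <= 16 * K * (M + 1)).
    { unfold K. pose proof W_pos. apply (count_near_boundary e u v He E M W); auto.
      - split; [auto|split; [eauto|split; [auto|split; [auto|exists M0; auto]]]].
      - lra.
      - apply NoDup_filter, NoDup_box.
      - intros q Hq. apply filter_In in Hq. destruct Hq as [_ Hq].
        destruct excluded_middle_informative as [Hs|]; [|discriminate].
        apply (shallow_near_boundary e u v He N E q HEopn Hs). }
    replace ((8 * e * B + INR N) * (16 * K) * S * (M + 1)) with ((8 * e * B + INR N) * (16 * K * (M + 1) * S)) by ring.
    apply Rmult_le_compat_l; auto. apply Rmult_le_compat_r; auto.
Qed.

Lemma Rabs_sin_le x : Rabs (sin x) <= Rabs x.
Proof.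
  destruct (Rtotal_order x 0) as [H|[->|H]].
  - rewrite <- Rabs_Ropp, <- sin_neg, <- (Rabs_Ropp x). assert (H' : 0 < - x) by lra.
    revert H'. generalize (- x). clear. intros x H. rewrite (Rabs_pos_eq x) by lra. apply Rabs_le.
    pose proof (sin_lt_x x H). destruct (Rle_dec x 1).
    + pose proof PI_gt_3. pose proof (sin_ge_0 x ltac:(lra) ltac:(lra)). lra.
    + pose proof (SIN_bound x). lra.
  - rewrite sin_0. lra.
  - rewrite (Rabs_pos_eq x) by lra. apply Rabs_le.
    pose proof (sin_lt_x x H). destruct (Rle_dec x 1).
    + pose proof PI_gt_3. pose proof (sin_ge_0 x ltac:(lra) ltac:(lra)). lra.
    + pose proof (SIN_bound x). lra.
Qed.

Lemma Eu_lip a b : Cmod (Eu a - Eu b) <= 2 * Rabs (a - b).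
Proof.
  assert (T : forall x y, Rabs (2 * y * sin (x / 2)) <= Rabs x * Rabs y).
  { intros x y. rewrite !Rabs_mult, (Rabs_pos_eq 2) by lra. pose proof (Rabs_sin_le (x/2)) as Q.
    unfold Rdiv in Q at 2. rewrite Rabs_mult, (Rabs_pos_eq (/2)) in Q by lra. pose proof (Rabs_pos y). nra. }
  eapply Rle_trans; [apply Cmod_le_re_im|]. unfold Eu; simpl.
  fold (cos a - cos b). fold (sin a - sin b). rewrite form2, form4.
  pose proof (T (a - b) (- sin ((a + b)/2))) as T1. pose proof (T (a - b) (cos ((a + b)/2))) as T2.
  replace (-2 * sin ((a - b) / 2) * sin ((a + b) / 2)) with (2 * - sin ((a + b) / 2) * sin ((a - b) / 2)) by ring.
  assert (Rabs (- sin ((a + b)/2)) <= 1) by (rewrite Rabs_Ropp; apply Rabs_le, SIN_bound).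
  assert (Rabs (cos ((a + b)/2)) <= 1) by (apply Rabs_le, COS_bound).
  pose proof (Rabs_pos (a - b)). nra.
Qed.

(** Rotation by PI or by a right angle leads to the right half plane. The angle is not normalised: a
    bounded range suffices for the pigeonhole in [count_near_circle]. *)
Lemma polar_unit z : Cmod z = 1 -> exists th, - (2 * PI) <= th <= 2 * PI /\ z = Eu th.
Proof.
  intros Hz. pose proof PI_gt_3.
  assert (K : forall w : C, Cmod w = 1 -> 0 < fst w -> exists th, - (PI/2) <= th <= PI/2 /\ w = Eu th).
  { intros w Hw Hp. exists (atan (snd w / fst w)). split; [pose proof (atan_bound (snd w / fst w)); lra|].
    symmetry. apply Eu_atan; auto. }
  assert (R : forall w s, Cmod w = 1 -> Cmod (w * Eu s) = 1) by (intros; rewrite Cmod_mult, Cmod_Eu; lra).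
  assert (Back : forall s th, (z * Eu s)%C = Eu th -> z = Eu (th - s)).
  { intros s th E. unfold Rminus. rewrite Eu_plus, <- E.
    replace (z * Eu s * Eu (- s))%C with (z * (Eu s * Eu (- s)))%C by ring. rewrite <- Eu_plus, Rplus_opp_r.
    unfold Eu. rewrite cos_0, sin_0. change (1, 0) with (RtoC 1). ring. }
  destruct (Rtotal_order (fst z) 0) as [L|[Z|G]].
  - destruct (K (z * Eu PI)%C) as [th [Hth E]]; [apply R; auto|unfold Eu; simpl; rewrite cos_PI, sin_PI; lra|].
    exists (th - PI). split; [lra|auto].
  - pose proof (Cmod_sqr z) as S. rewrite Hz, Z in S.
    destruct (Rle_dec (snd z) 0).
    + destruct (K (z * Eu (PI/2))%C) as [th [Hth E]]; [apply R; auto|unfold Eu; simpl; rewrite cos_PI2, sin_PI2; nra|].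
      exists (th - PI/2). split; [lra|auto].
    + destruct (K (z * Eu (- (PI/2)))%C) as [th [Hth E]]; [apply R; auto|unfold Eu; simpl; rewrite cos_neg, sin_neg, cos_PI2, sin_PI2; nra|].
      exists (th - - (PI/2)). split; [lra|auto].
  - destruct (K z Hz G) as [th [Hth E]]. exists th; split; [lra|auto].
Qed.

Lemma polar z : exists th, - (2 * PI) <= th <= 2 * PI /\ z = (Cmod z * Eu th)%C.
Proof.
  destruct (Ceq_dec z 0) as [->|Nz].
  - exists 0. pose proof PI_gt_3. split; [lra|]. rewrite Cmod_0. ring.
  - assert (P : 0 < Cmod z) by (apply Cmod_gt_0; auto).
    assert (Q : RtoC (Cmod z) <> 0) by (intro T; apply RtoC_inj in T; lra).
    destruct (polar_unit (z / Cmod z)%C) as [th [Hth E]].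
    + rewrite Cmod_div, Cmod_R, Rabs_pos_eq by (auto; lra). field; lra.
    + exists th; split; auto. rewrite <- E. field; auto.
Qed.

Lemma length_by_key {X} (l : list X) (key : X -> Z) n K : (forall x, In x l -> In (key x) (zr n)) ->
  (forall i, (length (filter (fun x => if Z.eq_dec (key x) i then true else false) l) <= K)%nat) ->
  INR (length l) <= (2 * INR n + 1) * INR K.
Proof.
  intros Hk HK.
  assert (E : INR (length l) = rsumL (zr n) (fun i => rsumL l (fun x => if Z.eq_dec (key x) i then 1 else 0))).
  { rewrite <- rsumL_swap, <- (Rmult_1_r (INR (length l))), <- rsumL_const. apply rsumL_ext. intros x Hx.
    rewrite rsumL_indicator by apply NoDup_zr. destruct in_dec; auto. exfalso; auto. }
  rewrite E.
  replace (2 * INR n + 1) with (INR (length (zr n))).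
  2:{ unfold zr. rewrite length_map, length_seq, plus_INR, mult_INR. simpl. ring. }
  rewrite <- rsumL_const. apply rsumL_le. intros i _.
  replace (rsumL l (fun x => if Z.eq_dec (key x) i then 1 else 0)) with
    (INR (length (filter (fun x => if Z.eq_dec (key x) i then true else false) l))).
  - apply le_INR; auto.
  - clear. induction l; auto. simpl filter. simpl rsumL. destruct Z.eq_dec; rewrite <- IHl; [simpl length; rewrite S_INR|]; ring.
Qed.

(** Two points in a square of half-side [W] are at most 4 W apart by [insq_mod]. *)
Definition near_circle u v (s : R) (p : Z * Z) : Prop :=
  exists z, cell e u v p z /\ s - 4 * W <= Cmod z <= s + 4 * W.

(** The angles are sorted into 2 n + 1 sectors of width 2 PI/n with n about s. Within a sector the
    chosen points differ by at most 8 W + 4 PI, so it holds boundedly many cells; and 2 n + 1 <= 2 s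
    + 3 <= 5 s as s > 1. *)
Lemma count_near_circle : exists Cn, 0 <= Cn /\ forall u v s (Q : list (Z * Z)), 1 < s -> NoDup Q ->
  (forall q, In q Q -> near_circle u v s q) -> INR (length Q) <= Cn * s.
Proof.
  pose proof W_pos as HWe. pose proof PI_gt_3 as HPI.
  destruct (INR_unbounded ((8 * W + 4 * PI + e) / e)) as [k Hk].
  assert (Hk' : 8 * W + 4 * PI + e <= INR k * e).
  { apply Rmult_lt_compat_r with (r := e) in Hk; auto. unfold Rdiv in Hk. rewrite Rmult_assoc, Rinv_l in Hk; lra. }
  set (K := ((2 * k + 1) * (2 * k + 1))%nat). assert (HK : 0 <= INR K) by apply pos_INR.
  exists (5 * INR K). split; [lra|]. intros u v s Q Hs Hnd HQ.
  destruct (archimed s) as [Hup1 Hup2].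
  set (n := Z.to_nat (up s)).
  assert (Hup0 : (0 < up s)%Z) by (apply lt_IZR; lra).
  assert (Hn : INR n = IZR (up s)) by (unfold n; rewrite INR_IZR_INZ, Z2Nat.id; auto; lia).
  assert (Hch : forall q, exists w : C * R, In q Q -> cell e u v q (fst w) /\ s - 4 * W <= Cmod (fst w) <= s + 4 * W /\
     - (2 * PI) <= snd w <= 2 * PI /\ fst w = (Cmod (fst w) * Eu (snd w))%C).
  { intros q. destruct (classic (In q Q)) as [Hq|]; [|exists (RtoC 0, 0); tauto].
    destruct (HQ q Hq) as [z [Hz1 Hz2]]. destruct (polar z) as [th [Hth E]]. exists (z, th); auto. }
  set (ch := fun q => proj1_sig (constructive_indefinite_description _ (Hch q))).
  assert (Hchs : forall q, In q Q -> cell e u v q (fst (ch q)) /\ s - 4 * W <= Cmod (fst (ch q)) <= s + 4 * W /\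
     - (2 * PI) <= snd (ch q) <= 2 * PI /\ fst (ch q) = (Cmod (fst (ch q)) * Eu (snd (ch q)))%C).
  { intros q. unfold ch. destruct constructive_indefinite_description; auto. }
  clearbody ch.
  set (h := 2 * PI / INR n). assert (Hh : 0 < h) by (apply Rdiv_lt_0_compat; lra).
  assert (Hhn : INR n * h = 2 * PI) by (unfold h; field; lra).
  set (key := fun q => Int_part ((snd (ch q) - 0) / h)).
  assert (Hkey : INR (length Q) <= (2 * INR n + 1) * INR K).
  { apply length_by_key with (key := key).
    - intros q Hq. destruct (Hchs q Hq) as [_ [_ [Hth _]]]. apply in_zr. unfold key. split.
      + apply (floor_ge h Hh 0). rewrite opp_IZR, <- INR_IZR_INZ. lra.
      + assert (Int_part ((snd (ch q) - 0) / h) < Z.of_nat n + 1)%Z; [|lia].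
        apply (floor_lt h Hh 0). rewrite plus_IZR, <- INR_IZR_INZ. lra.
    - intros i. apply close_cells_count; [apply NoDup_filter; auto|].
      intros p q Hp Hq. apply filter_In in Hp, Hq. destruct Hp as [Hp Hp'], Hq as [Hq Hq'].
      destruct (Z.eq_dec (key p) i) as [Ep|]; [|discriminate]. destruct (Z.eq_dec (key q) i) as [Eq|]; [|discriminate].
      destruct (Hchs p Hp) as [[Hpx Hpy] [Hp2 [_ Hp4]]]. destruct (Hchs q Hq) as [[Hqx Hqy] [Hq2 [_ Hq4]]].
      pose proof (floor_spec h Hh 0 (snd (ch p))) as Fp. pose proof (floor_spec h Hh 0 (snd (ch q))) as Fq.
      fold (key p) in Fp. fold (key q) in Fq. rewrite Ep, plus_IZR in Fp. rewrite Eq, plus_IZR in Fq.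
      assert (Hth : Rabs (snd (ch p) - snd (ch q)) <= h) by (apply Rabs_le; lra).
      assert (Hd : Cmod (fst (ch p) - fst (ch q)) <= 8 * W + 4 * PI).
      { pose proof (Eu_lip (snd (ch p)) (snd (ch q))) as L.
        rewrite Hp4, Hq4.
        set (a := Cmod (fst (ch p))) in *. set (b := Cmod (fst (ch q))) in *.
        replace (a * Eu (snd (ch p)) - b * Eu (snd (ch q)))%C with
          ((a - s)%R * Eu (snd (ch p)) + (s * (Eu (snd (ch p)) - Eu (snd (ch q))) + (s - b)%R * Eu (snd (ch q))))%C
          by (rewrite !RtoC_minus; ring).
        eapply Rle_trans; [apply Cmod_triangle|]. rewrite Cmod_mult, Cmod_Eu, Cmod_R.
        assert (A1 : Rabs (a - s) <= 4 * W) by (apply Rabs_le; lra).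
        assert (A2 : Rabs (s - b) <= 4 * W) by (apply Rabs_le; lra).
        assert (A3 : Cmod (s * (Eu (snd (ch p)) - Eu (snd (ch q))) + (s - b)%R * Eu (snd (ch q))) <= s * (2 * h) + 4 * W).
        { eapply Rle_trans; [apply Cmod_triangle|]. rewrite !Cmod_mult, Cmod_Eu, !Cmod_R, (Rabs_pos_eq s) by lra.
          assert (s * Cmod (Eu (snd (ch p)) - Eu (snd (ch q))) <= s * (2 * h)) by (apply Rmult_le_compat_l; lra). lra. }
        assert (s * h <= INR n * h) by (apply Rmult_le_compat_r; lra). lra. }
      apply mod_insq in Hd. unfold insq, inrect in Hd.
      rewrite gx_1 in Hpx, Hqx. rewrite gy_1 in Hpy, Hqy.
      apply (cd_of_close e u v He); apply Rabs_le; lra. }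
  rewrite Hn in Hkey. nra.
Qed.

Lemma Cmod_zpow (z : C) k : z <> 0 -> Cmod (zpow z k) = powerRZ (Cmod z) k.
Proof.
  intros Nz. unfold zpow. destruct (Z.leb_spec 0 k).
  - rewrite Cmod_pow. destruct k; try lia; simpl; auto.
  - rewrite Cmod_inv by (apply Cpow_nz; auto). rewrite Cmod_pow. destruct k; try lia. simpl. auto.
Qed.

Lemma powerRZ_comparable k s x : 0 < s -> s / 2 <= x <= 2 * s -> powerRZ x k <= 2 ^ Z.abs_nat k * powerRZ s k.
Proof.
  intros Hs Hx. destruct k as [|p|p]; simpl; [lra| |].
  - rewrite <- Rpow_mult_distr. apply pow_incr. lra.
  - assert (P : 0 < s ^ Pos.to_nat p) by (apply pow_lt; auto).
    assert (Q : 0 < x ^ Pos.to_nat p) by (apply pow_lt; lra).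
    apply Rmult_le_reg_r with (x ^ Pos.to_nat p); auto. rewrite Rinv_l by lra.
    apply Rmult_le_reg_r with (s ^ Pos.to_nat p); auto. rewrite Rmult_1_l.
    replace (2 ^ Pos.to_nat p * / s ^ Pos.to_nat p * x ^ Pos.to_nat p * s ^ Pos.to_nat p) with (2 ^ Pos.to_nat p * x ^ Pos.to_nat p) by (field; lra).
    rewrite <- Rpow_mult_distr. apply pow_incr. lra.
Qed.

Lemma annulus_bound k : exists Ck, 0 <= Ck /\ forall nu Lm, regular_with rho N e B nu Lm ->
  forall r R0 (Ls : list C), 1 < r -> r < R0 -> NoDup Ls -> (forall b, In b Ls <-> (r < Cmod b <= R0) /\ nu b <> 0%Z) ->
  Cmod (csumL Ls (fun b => IZR (nu b) * zpow b k)%C) <= Ck * (powerRZ r (k + 1) + powerRZ R0 (k + 1)).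
Proof.
  destruct count_near_circle as [Cn [HCn Hcount]]. pose proof W_pos as HWe.
  assert (Hc0 : 0 <= 8 * e * B + INR N) by (pose proof (pos_INR N); assert (0 <= e * B) by (apply Rmult_le_pos; lra); lra).
  set (D := 2 ^ Z.abs_nat k). assert (HD : 0 < D) by (apply pow_lt; lra).
  exists ((8 * e * B + INR N) * (D * Cn)). split; [repeat apply Rmult_le_pos; lra|].
  intros nu Lm HR r R0 Ls Hr HrR Hnd HL.
  assert (Hopn : opn (fun z => r < Cmod z < R0)).
  { intros z Hz. exists (Rmin (Cmod z - r) (R0 - Cmod z)). split; [apply Rmin_pos; lra|]. intros w Hw.
    pose proof (Rmin_l (Cmod z - r) (R0 - Cmod z)). pose proof (Rmin_r (Cmod z - r) (R0 - Cmod z)).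
    pose proof (Cmod_diff_le w z). pose proof (Cmod_diff_le z w) as T. rewrite (Cmod_minus_sym z w) in T. lra. }
  assert (Hnz : forall z, r < Cmod z -> z <> 0) by (intros z Hz; apply Cmod_gt_0; lra).
  assert (Hhol : hol (fun z => r < Cmod z < R0) (fun z => zpow z k)).
  { unfold zpow. destruct (0 <=? k)%Z.
    - apply hol_pow, hol_id.
    - apply hol_inv; [apply hol_pow, hol_id|]. intros z Hz. apply Cpow_nz, Hnz; lra. }
  destruct (offset_bound nu Lm (fun z => r < Cmod z < R0) (fun z => r < Cmod z <= R0) (fun z => zpow z k) Ls R0 HR)
    as [u [v [Hu [Hv [T HT]]]]]; auto; try (intros; simpl in *; lra).
  set (sh := shallow e u v N (fun z => r < Cmod z < R0) (fun z => r < Cmod z <= R0)).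
  assert (Pr : 0 < powerRZ r k) by (apply powerRZ_lt; lra).
  assert (PR : 0 < powerRZ R0 k) by (apply powerRZ_lt; lra).
  pose proof (fun q p w => cell_in_insq e u v He q p w (margin N)) as Hcellin. fold W in Hcellin.
  assert (Hnear : forall p, sh p -> near_circle u v r p \/ near_circle u v R0 p).
  { intros p [Hnd' [z [Hz Hzr]]].
    assert (exists q w, (cd p q <= margin N)%Z /\ cell e u v q w /\ ~ (r < Cmod w < R0)) as [q [w [Hq [Hw Hwr]]]].
    { apply NNPP; intro Hn. apply Hnd'. intros q w Hq Hw. apply NNPP; intro. apply Hn; eauto. }
    assert (Hzin : insq (gx e u (fst p), gy e v (snd p)) W z).
    { apply (Hcellin p p); auto. unfold cd, margin; lia. }
    assert (Hwin := Hcellin p q w Hq Hw).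
    assert (Hzw : Cmod (z - w) <= 4 * W).
    { replace (4 * W) with (2 * (W + W)) by ring. apply insq_mod. eapply insq_trans; [apply insq_sym; eauto|auto]. }
    pose proof (Cmod_diff_le z w). pose proof (Cmod_diff_le w z) as T1. rewrite (Cmod_minus_sym w z) in T1.
    destruct (Rle_dec (Cmod w) r).
    - left. exists z; split; auto. lra.
    - right. exists z; split; auto. assert (R0 <= Cmod w) by (apply Rnot_lt_le; intro; apply Hwr; lra). lra. }
  assert (Hval : forall s p z, 1 < s -> near_circle u v s p -> cell e u v p z -> Cmod (zpow z k) <= D * powerRZ s k).
  { intros s p z Hs [z0 [Hz0 Hz0s]] Hz. pose proof (cell_diam e u v p z z0 Hz Hz0) as Hd.
    pose proof (Cmod_diff_le z z0). pose proof (Cmod_diff_le z0 z) as T1. rewrite (Cmod_minus_sym z0 z) in T1.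
    rewrite Cmod_zpow by (apply Cmod_gt_0; lra). apply powerRZ_comparable; lra. }
  (* A sum over the two circles, because a cell of a thin annulus may be near both. *)
  eapply Rle_trans; [apply (HT (fun p => ifP (sh p /\ near_circle u v r p) (D * powerRZ r k) 0 + ifP (sh p /\ near_circle u v R0 p) (D * powerRZ R0 k) 0))|].
  - intros p. assert (0 <= D * powerRZ r k) by (apply Rmult_le_pos; lra). assert (0 <= D * powerRZ R0 k) by (apply Rmult_le_pos; lra).
    unfold ifP. repeat destruct excluded_middle_informative; lra.
  - intros p Hp. unfold ifP. repeat destruct excluded_middle_informative; try tauto. lra.
  - intros p z Hp Hz Hza. assert (0 <= D * powerRZ r k) by (apply Rmult_le_pos; lra). assert (0 <= D * powerRZ R0 k) by (apply Rmult_le_pos; lra).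
    destruct (Hnear p Hp) as [Hn|Hn].
    + pose proof (Hval r p z Hr Hn Hz). unfold ifP. destruct excluded_middle_informative; [|tauto].
      destruct excluded_middle_informative; lra.
    + pose proof (Hval R0 p z ltac:(lra) Hn Hz). unfold ifP. destruct excluded_middle_informative;
      (destruct excluded_middle_informative; [lra|tauto]).
  - rewrite rsumL_plus, !rsumL_count.
    set (Q1 := filter _ (box T)). set (Q2 := filter (fun x => if excluded_middle_informative (sh x /\ near_circle u v R0 x) then true else false) (box T)).
    assert (L1 : INR (length Q1) <= Cn * r).
    { apply (Hcount u v); auto; [apply NoDup_filter, NoDup_box|]. intros q Hq. apply filter_In in Hq. destruct Hq as [_ Hq].
      destruct excluded_middle_informative; [tauto|discriminate]. }
    assert (L2 : INR (length Q2) <= Cn * R0).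
    { apply (Hcount u v); auto; [lra|apply NoDup_filter, NoDup_box|]. intros q Hq. apply filter_In in Hq. destruct Hq as [_ Hq].
      destruct excluded_middle_informative; [tauto|discriminate]. }
    rewrite !powerRZ_add, !powerRZ_1 by lra.
    replace ((8 * e * B + INR N) * (D * Cn) * (powerRZ r k * r + powerRZ R0 k * R0)) with
     ((8 * e * B + INR N) * ((Cn * r) * (D * powerRZ r k) + (Cn * R0) * (D * powerRZ R0 k))) by ring.
    apply Rmult_le_compat_l; auto. apply Rplus_le_compat; apply Rmult_le_compat_r; auto; apply Rmult_le_pos; lra.
Qed.
End Main.

Lemma regular_regular_with nu Lm rho N : regular nu Lm rho N -> exists e B, 0 < e /\ 0 <= B /\ (3 * INR N + 3) * e <= rho /\
  20 * ((IZR (margin N) + 2) * e) <= 1 /\ regular_with rho N e B nu Lm.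
Proof.
  intros [Hr [H1 [H2 H3]]].
  assert (Hm : 0 <= IZR (margin N)) by (apply IZR_le; unfold margin; lia). pose proof (pos_INR N) as HN.
  set (e := Rmin (rho / (3 * INR N + 3)) (/ (20 * (IZR (margin N) + 2)))).
  assert (He : 0 < e).
  { unfold e. apply Rmin_pos; [apply Rdiv_lt_0_compat; lra|apply Rinv_0_lt_compat; lra]. }
  destruct (H2 (e/2)) as [B [HB HB']]; [lra|].
  exists e, B. split; [auto|split; [lra|split; [|split]]].
  - apply Rle_trans with ((3 * INR N + 3) * (rho / (3 * INR N + 3))); [|right; field; lra].
    apply Rmult_le_compat_l; [lra|apply Rmin_l].
  - rewrite <- Rmult_assoc. apply Rle_trans with (20 * (IZR (margin N) + 2) * (/ (20 * (IZR (margin N) + 2)))); [|right; field; lra].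
    apply Rmult_le_compat_l; [lra|apply Rmin_r].
  - split; [auto|split; auto].
Qed.

Lemma div_integral_csumL (nu : C -> Z) (g : C -> C) L : div_integral nu g L = csumL L (fun b => IZR (nu b) * g b)%C.
Proof. induction L; simpl; [reflexivity|]. unfold div_integral in *. simpl. rewrite IHL. reflexivity. Qed.

Lemma div_mass_csumL (nu : C -> Z) L : RtoC (IZR (div_mass nu L)) = csumL L (fun b => IZR (nu b) * RtoC 1)%C.
Proof.
  induction L; simpl; [reflexivity|]. rewrite plus_IZR, RtoC_plus, Cmult_1_r, <- IHL. reflexivity.
Qed.

Lemma Cpowz_zpow (w : C) k : Cpowz w k = zpow w k.
Proof. unfold Cpowz, zpow. destruct (0 <=? k)%Z; rewrite ?Defs_Cinv_eq, Defs_Cpow_eq; auto. Qed.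

Lemma csumL_div_ext (nu : C -> Z) (g h : C -> C) L : (forall z, g z = h z) -> div_integral nu g L = div_integral nu h L.
Proof. intros H. rewrite !div_integral_csumL. apply csumL_ext. intros; rewrite H; auto. Qed.

Theorem mainTheorem18 :
  forall (f : Cx -> option Cx) (nu : Cx -> Z),
    N1 f -> is_divisor f nu ->
    (exists C : R,
      forall c : Cx,
      let nuc := fun w => nu (Cadd w c) in
      forall (E : Cx -> Prop) (M : R),
        simply_connected_bounded_domain E ->
        hausdorff1_le (boundary E) M ->
        forall L : list Cx, enumerates_support nuc E L ->
        (forall (g : Cx -> Cx) (S : R),
           holomorphic_on E g -> (forall z, E z -> Cnorm (g z) <= S) ->
           Cnorm (div_integral nuc g L) <= C * S * (M + 1)) /\
        Rabs (IZR (div_mass nuc L)) <= C * (M + 1)) /\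
    (forall k : Z, exists Ck : R,
      forall c : Cx,
      let nuc := fun w => nu (Cadd w c) in
      forall r R0 : R, 1 < r -> r < R0 ->
      forall L : list Cx,
        enumerates_support nuc (fun w => r < Cnorm w <= R0) L ->
        Cnorm (div_integral nuc (fun w => Cpowz w k) L)
          < Ck * (powerRZ r (k + 1) + powerRZ R0 (k + 1))).
Proof.
  intros f nu HN Hd.
  destruct (N1_regular f nu HN Hd) as [rho [N Hreg]].
  destruct (regular_regular_with _ _ _ _ Hreg) as [e [B [He [HB [Hrho [HW HR]]]]]].
  split.
  - destruct (domain_bound rho N e B He HB Hrho) as [K [HK H]].
    exists K. intros c nuc E M HE HM L [Hnd HL].
    pose proof (regular_with_translate _ _ _ _ _ _ c HR) as HRc.
    split.
    + intros g S Hg HS. rewrite Cnorm_Cmod, div_integral_csumL.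
      apply (H _ _ HRc E M L g S); auto.
      * apply hol_of_holomorphic_on; auto.
      * intros z Hz. rewrite <- Cnorm_Cmod; auto.
    + rewrite <- Cmod_R, div_mass_csumL. replace (K * (M + 1)) with (K * 1 * (M + 1)) by ring.
      apply (H _ _ HRc E M L (fun _ => RtoC 1) 1); auto.
      * apply hol_const.
      * intros z _. rewrite Cmod_1; lra.
  - intros k. destruct (annulus_bound rho N e B He HB Hrho HW k) as [K [HK H]].
    (* Adding 1 makes the inequality strict, both powers being positive. *)
    exists (K + 1). intros c nuc r R0 Hr HrR L [Hnd HL].
    pose proof (regular_with_translate _ _ _ _ _ _ c HR) as HRc.
    rewrite Cnorm_Cmod, (csumL_div_ext _ _ (fun w => zpow w k)) by (intros; apply Cpowz_zpow).
    rewrite div_integral_csumL.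
    assert (P : 0 < powerRZ r (k + 1)) by (apply powerRZ_lt; lra).
    assert (Q : 0 < powerRZ R0 (k + 1)) by (apply powerRZ_lt; lra).
    eapply Rle_lt_trans; [apply (H _ _ HRc r R0 L); auto|nra].
    intros b. rewrite HL, Cnorm_Cmod. reflexivity.
Qed.
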